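(* For every $n\in\mathbb{N}$ let $P_n^{(1)}(x)$ and $P_n^{(2)}(x)$ be real polynomials (not identically zero) of degree at most $n$. Suppose that (i) all roots of these polynomials are real and upper bounded by $A$, where $A\in\mathbb{R}$ does not depend on $n$; (ii) for some probability measures $\mu_1$ and $\mu_2$ on $[-\infty,A]$ we have, as $n\to\infty$, $[\![P_n^{(1)}]\!]_n\to\mu_1$ and $[\![P_n^{(2)}]\!]_n\to\mu_2$ weakly on $[-\infty,A]$; (iii) $\mu_1(\{-\infty\})+\mu_2(\{-\infty\})<1$. Then, as $n\to\infty$, the probability measure $[\![P_n^{(1)}\boxplus_nP_n^{(2)}]\!]_n$ converges weakly on $[-\infty,2A]$ to some probability measure $\mu$ on $[-\infty,2A]$. If $\mu_1(\{-\infty\})=\mu_2(\{-\infty\})=0$, then $\mu=\mu_1\boxplus\mu_2$ is the classical free additive convolution of the probability measures $\mu_1$ and $\mu_2$.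
   Context: Empirical zero distribution: for a polynomial $P\not\equiv0$ with $\deg P\le n$, $$[\![P]\!]_n:=\frac1n\sum_{z\in\mathbb{C}:P(z)=0}\delta_z+\frac{n-\deg P}{n}\delta_\infty,$$ zeros counted with multiplicity; here $\infty$ is identified with $-\infty$, so that $[\![P]\!]_n$ is a probability measure on $[-\infty,A]$ if all roots are real and at most $A$. Finite free additive convolution: for $P_n^{(i)}(x)=\sum_{k=0}^n a_{k:n}^{(i)}x^k$, $i=1,2$, $$P_n^{(1)}(x)\boxplus_nP_n^{(2)}(x)=\frac1{n!}\sum_{k=0}^n\frac{x^k}{k!}\sum_{j_1+j_2=n+k}a_{j_1:n}^{(1)}a_{j_2:n}^{(2)}\,j_1!\,j_2!,$$ where $j_1,j_2\in\{0,\dots,n\}$. (Under (iii) this is not identically zero for large $n$; the convergence concerns large $n$.) Classical free additive convolution $\boxplus$: the Voiculescu/Bercovici–Voiculescu convolution of probability measures on $\mathbb{R}$ (the distribution of the sum of two freely independent self-adjoint random variables with distributions $\mu_1,\mu_2$). For measures on $(-\infty,A]$ it is characterized by $R_{\mu_1\boxplus\mu_2}(s)=R_{\mu_1}(s)+R_{\mu_2}(s)$ for all sufficiently small $s>0$, where $R_\mu(s)=s\,G_\mu^{\leftarrow}(s)-1$, $G_\mu(t)=\int\frac{\mu(dz)}{t-z}$ for $t>A$, and $G_\mu^{\leftarrow}$ is the inverse of the decreasing function $G_\mu|_{(A,\infty)}$. *)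

(* Defs.v *)
From HB Require Import structures.
From mathcomp Require Import all_boot all_order all_algebra.
From mathcomp Require Import complex.
From mathcomp Require Import all_classical all_reals all_analysis.
From mathcomp Require Import measurable_realfun.

Set Implicit Arguments.
Unset Strict Implicit.
Unset Printing Implicit Defensive.

Import Order.TTheory GRing.Theory Num.Theory.
Import numFieldNormedType.Exports.

Local Open Scope classical_set_scope.
Local Open Scope ring_scope.

Section Polynomials.
Context {R : realType}.

Definition complexify (P : {poly R}) : {poly R[i]} :=
  map_poly (fun x : R => x%:C%C) P.

Definition real_rooted_le (a : R) (P : {poly R}) : Prop :=
  forall z : R[i], root (complexify P) z -> exists2 x : R, z = x%:C%C & x <= a.

(* The coefficient index j_i of the convolution ranges over {0, ..., n}. *)
Definition finite_free_add (n : nat) (P Q : {poly R}) : {poly R} :=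
  (n`!%:R)^-1 *: \sum_(k < n.+1) ((k`!%:R)^-1 *
    \sum_(j1 < n.+1) \sum_(j2 < n.+1 | (j1 + j2 == n + k)%N)
      P`_j1 * Q`_j2 * j1`!%:R * j2`!%:R) *: 'X^k.

(* All complex zeros, repeated according to multiplicity (for P != 0). *)
Definition complex_zeros (P : {poly R}) : seq R[i] :=
  sval (closed_field_poly_normal (complexify P)).

Definition real_zeros (P : {poly R}) : seq R :=
  [seq complex.Re z | z <- complex_zeros P & complex.Im z == 0].

(* The empirical zero distribution [[P]]_n, for 0 < n, P != 0 and deg P <= n,
   restricted to the extended real line with the point at infinity of the
   Riemann sphere placed at -oo. Nothing is lost, and this is a probability
   measure, exactly when all complex zeros of P are real. *)
Definition empirical_zeros (n : nat) (P : {poly R}) :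
    {measure set (\bar R) -> \bar R} :=
  measure_add
    (mscale (n%:R^-1 : R)%:nng
      (msum (fun i => \d_(((real_zeros P)`_i)%:E)) (size (real_zeros P))))
    (mscale ((n - (size P).-1)%:R / n%:R : R)%:nng \d_(-oo%E)).

End Polynomials.

Section Measures.
Context {R : realType}.

Definition lower_ray (a : R) : set (\bar R) := [set x | (x <= a%:E)%E].

(* lower_ray a = [-oo, a] is compact, so every f below is bounded on it. *)
Definition weak_cvg_on (S : set (\bar R))
    (m : nat -> {measure set (\bar R) -> \bar R})
    (mu : {measure set (\bar R) -> \bar R}) : Prop :=
  forall f : \bar R -> R, {within S, continuous f} ->
    \int[m n]_(x in S) f x @[n --> \oo] --> \int[mu]_(x in S) f x.

HB.instance Definition _ := isMeasurableFun.Build _ _ (\bar R) R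
  (fine : \bar R -> R) (fine_measurable measurableT).

(* A probability measure on \bar R without mass at -oo and +oo, seen as a
   probability measure on R: in that case the push-forward by fine is just the
   restriction to R. *)
Definition finite_part (mu : probability (\bar R) R) : probability R R :=
  distribution mu (fine : \bar R -> R).

Definition cauchy_transform (nu : probability R R) (t : R) : R :=
  \int[nu]_z (t - z)^-1.

(* R(s) = s G^{<-}(s) - 1, where G^{<-} inverts the Cauchy transform restricted
   to ]a, +oo[. It is meaningful for nu carried by ]-oo, a] and small s > 0;
   outside the range of G the inverse takes the dummy value 0. *)
Definition R_transform (a : R) (nu : probability R R) (s : R) : R :=
  s * 'pinv_(fun=> 0) `]a, +oo[%classic (cauchy_transform nu) s - 1.

(* nu is the (Bercovici-Voiculescu) free additive convolution of nu1 and nu2,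
   both carried by ]-oo, a]. It is carried by ]-oo, 2a] and, among probability
   measures bounded above, it is characterized by additivity of the R-transform
   near 0^+, which is taken here as the definition. *)
Definition is_free_add_conv (a : R) (nu1 nu2 nu : probability R R) : Prop :=
  nu `]-oo, 2 * a]%classic = 1%E /\
  \forall s \near 0^'+,
    R_transform (2 * a) nu s = R_transform a nu1 s + R_transform a nu2 s.

End Measures.

(* Main.v *)
From HB Require Import structures.
Require Import Defs.
From mathcomp Require Import all_boot all_order all_algebra.
From mathcomp Require Import complex.
From mathcomp Require Import all_classical all_reals all_analysis.
From mathcomp Require Import measurable_realfun ring lra zify.
Import Order.TTheory GRing.Theory Num.Theory.
Import numFieldNormedType.Exports.
Local Open Scope classical_set_scope.
Local Open Scope ring_scope.

(** Translating both sequences, one may assume that all zeros are nonpositive, so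
that the coefficients p_j and q_j are nonnegative. The convolution is n!^-1 times
the sum over j of j! q_j P^(n - j), and it has only real zeros by the theorem of
Walsh and Szego (conv_op_lower), which follows from Laguerre's theorem on polar
derivatives by removing the roots of P one at a time.

The limit is found from the growth of the sums L_p(s) of p_k k! s^-k. Up to its
normalization the convolution multiplies these sums, except that it drops the
terms of the product with j1 + j2 < n (laplace_sum_conv). At s = n sigma, the sum
L_p(s) is, up to a factor polynomial in n, the supremum over t > 0 of
p(t) e^(-n sigma t); hence log L_p / n tends to the Legendre transform of the
limiting logarithmic potential U of the zeros (laplace_rate), whose derivative in
sigma is - tau(sigma), where tau inverts the Cauchy transform G = U'. For small
sigma the dropped terms are exponentially negligible. Indeed it is enough that
the Legendre transforms plus log sigma decrease in sigma, that is, that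
K = tau1 + tau2 - 1 / sigma be positive; since sigma tau_i(sigma) tends to
1 - mu_i {-oo} as sigma tends to 0, this is what the assumption on the masses at
minus infinity ensures.

So the rate of the convolution has the derivative - K. Legendre duality in the
other direction (conv_slope) shows that the Cauchy transform of its zeros
converges at K(sigma) to sigma (cauchy_avg_conv). As sigma K(sigma) - 1 is the sum
of the sigma tau_i(sigma) - 1, this is the additivity of R-transforms.

It remains to see that convergence of Cauchy transforms at all large arguments t
implies weak convergence. With a zero z encoded by a bounded coordinate x, the
kernel at t0 and the difference quotients in t give the averages of all powers
of one kernel; an explicit polynomial approximation of the absolute value gives
the averages of the distances to fixed points in this coordinate (avg_cvg_dist),
hence those of ramps. The ramps with rational ends force the quantile functions
to converge outside a countable set, and the limit measure is the law of the
limiting quantile function (quantile_limit). Finally, the mass of the limit at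
minus infinity is read off from t G(t) as t tends to infinity; it vanishes when
those of mu1 and mu2 do. *)

Local Arguments derivn : simpl never.

(** * Real-rootedness of the convolution *)

(** This is n! times the finite free convolution, written as a differential
    operator applied to P. In this form P can lose its roots one at a time. *)
Definition conv_op {F : nzRingType} (n : nat) (P Q : {poly F}) : {poly F} :=
  \sum_(j < n.+1) (Q`_j * j`!%:R) *: P^`(n - j).

(** Stability with respect to the open upper half plane: the two closed half
    planes together will pin the zeros of a convolution to the real line. *)
Definition lower_stable {R : rcfType} (P : {poly R[i]}) :=
  forall z : R[i], root P z -> complex.Im z <= 0.

Lemma derivn_XsubC_mul (F : comNzRingType) (P : {poly F}) (a : F) m :
  (('X - a%:P) * P)^`(m) = ('X - a%:P) * P^`(m) + P^`(m.-1) *+ m.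
Proof.
elim: m => [|m IH]; first by rewrite !derivn0 mulr0n addr0.
rewrite derivnS IH derivD derivM derivXsubC mul1r -derivnS derivMn.
case: m {IH} => [|m]; first by rewrite !mulr0n !addr0 addrC.
by rewrite -derivnS [in RHS]mulrS addrCA addrA.
Qed.

(** Removing the root a of the left factor lowers n by one and replaces Q by
    its polar derivative with respect to the pole z - a, because the m-th
    derivative of (X - a) P is (X - a) P^(m) + m P^(m-1). This identity at a
    fixed point z drives the induction of conv_op_lower. *)
Lemma conv_op_polar (F : comNzRingType) n (P Q : {poly F}) (a z : F) :
  (size P <= n.+1)%N ->
  (conv_op n.+1 (('X - a%:P) * P) Q).[z] =
  (conv_op n P (Q *+ n.+1 + ((z - a)%:P - 'X) * Q^`())).[z].
Proof.
move=> sP; rewrite /conv_op !horner_sum.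
under eq_bigr do rewrite hornerZ derivn_XsubC_mul hornerD hornerMn hornerM
  hornerXsubC mulrDr.
rewrite big_split /= big_ord_recl /= subn0 (derivn_poly0 sP) horner0 !mulr0.
rewrite add0r [X in _ + X]big_ord_recr /= subnn mulr0n mulr0 addr0 -big_split /=.
apply: eq_bigr => j _; rewrite hornerZ /bump /= !add1n subSS.
have jn : (j <= n)%N by rewrite -ltnS.
have -> : (n.+1 - j).-1 = (n - j)%N by rewrite subSn.
rewrite coefD coefMn [(_ - 'X) * _]mulrBl coefB coefCM coefXM.
have E : (n.+1 - j)%N%:R = n.+1%:R - j%:R :> F by rewrite natrB // leqW.
rewrite -[_ *+ (n.+1 - j)]mulr_natr E coef_deriv -[Q`_j *+ _]mulr_natr factS natrM.
rewrite -[Q`_j.+1 *+ _]mulr_natr.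
case: (j : nat) => [|k] /=; first ring.
rewrite coef_deriv -[Q`_k.+1 *+ _]mulr_natr; ring.
Qed.

Local Notation sqn z := (complex.Re z ^+ 2 + complex.Im z ^+ 2).

(** The inversion q |-> u = 1/(x - q) carries the lower half plane to the disc
    Im x |u|^2 + Im u <= 0, and points above the real axis to its outside. *)
Lemma Im_inv_sub (R : rcfType) (x q : R[i]) : x != q ->
  complex.Im x * sqn (x - q)^-1 + complex.Im (x - q)^-1 =
  complex.Im q * sqn (x - q)^-1.
Proof.
case: x q => [a b] [c d]; rewrite eq_complex /= => xq.
have N0 : (a - c) ^+ 2 + (b - d) ^+ 2 != 0.
  by rewrite paddr_eq0 ?sqr_ge0 // !sqrf_eq0 !subr_eq0.
by field.
Qed.

Lemma logderiv_prod_XsubC (F : fieldType) (s : seq F) (x : F) : x \notin s ->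
  (\prod_(q <- s) ('X - q%:P))^`().[x] =
  (\prod_(q <- s) ('X - q%:P)).[x] * \sum_(q <- s) (x - q)^-1.
Proof.
elim: s => [|q s IH]; first by rewrite !big_nil derivC horner0 mulr0.
rewrite inE negb_or => /andP[xq /IH {}IH].
rewrite !big_cons derivM derivXsubC mul1r hornerD !hornerM IH hornerXsubC.
by field; rewrite subr_eq0.
Qed.

(** Laguerre's theorem for a half plane. At a zero x of the polar derivative
    with pole w, the number v = 1/(x - w) is the average of the 1/(x - q) over
    the roots q of Q, completed by zeros to n terms. If Im x > 0, all these
    numbers lie in the disc of Im_inv_sub, which is convex, while v lies
    outside since Im w > 0. *)
Lemma lower_stable_polar (R : rcfType) n (Q : {poly R[i]}) (w : R[i]) :
  Q != 0 -> (size Q <= n.+2)%N -> lower_stable Q -> 0 < complex.Im w ->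
  lower_stable (Q *+ n.+1 + (w%:P - 'X) * Q^`()).
Proof.
move=> Q0 sQ stQ w0 x; rewrite leNgt => /rootP; apply: contraPN => x0.
have [s Qs] := closed_field_poly_normal Q.
have lQ : lead_coef Q != 0 by rewrite lead_coef_eq0.
have rs q : q \in s -> complex.Im q <= 0.
  by move=> qs; apply: stQ; rewrite Qs rootZ // root_prod_XsubC.
have xs : x \notin s by apply: contraL x0 => /rs; rewrite leNgt.
have ss : (size s <= n.+1)%N.
  by move: sQ; rewrite Qs size_scale // size_prod_XsubC ltnS.
rewrite Qs !hornerE hornerMn derivZ !hornerZ logderiv_prod_XsubC //.
set S := \sum_(q <- s) (x - q)^-1; set p := (\prod_(q <- s) _).[x].
have p0 : lead_coef Q * p != 0.
  by rewrite mulf_neq0 // -rootE root_prod_XsubC.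
have -> : lead_coef Q * p *+ n.+1 + (w - x) * (lead_coef Q * (p * S)) =
  (lead_coef Q * p) * (n.+1%:R + (w - x) * S) by rewrite -mulr_natr; ring.
move/eqP; rewrite mulf_eq0 (negPf p0) /= => /eqP E.
have n0 : n.+1%:R != 0 :> R[i] by rewrite pnatr_eq0.
have wx : x - w != 0.
  apply/eqP => wx; have /eqP := E; rewrite -[w - x]opprB wx oppr0 mul0r addr0.
  by rewrite (negPf n0).
set v := (x - w)^-1.
have Sv : S = v *+ n.+1.
  by rewrite /v -mulr_natl; apply: (mulfI wx); rewrite mulrCA mulfV // mulr1;
    apply/eqP; rewrite -subr_eq0; apply/eqP; rewrite -[RHS]oppr0 -E; ring.
have Ev := @Im_inv_sub _ x w; rewrite -/v -subr_eq0 in Ev; have {}Ev := Ev wx.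
have Nv : 0 < sqn v.
  rewrite lt_def addr_ge0 ?sqr_ge0 // andbT paddr_eq0 ?sqr_ge0 // !sqrf_eq0.
  by rewrite -(eq_complex v 0) invr_eq0.
(* Supporting half plane at v of the convex function |u|^2. *)
have tangent q : q \in s -> complex.Im x *
    (2 * (complex.Re v * complex.Re (x - q)^-1 +
          complex.Im v * complex.Im (x - q)^-1) - sqn v) +
    complex.Im (x - q)^-1 <= 0.
  move=> qs; have xq : x != q by apply: contraNneq xs => ->.
  have := Im_inv_sub _ _ _ xq; have := rs _ qs.
  move: (complex.Re (x - q)^-1) (complex.Im (x - q)^-1) => a b dq Eab.
  have : 0 <= (complex.Re v - a) ^+ 2 + (complex.Im v - b) ^+ 2.
    by rewrite addr_ge0 ?sqr_ge0.
  have : 0 <= a ^+ 2 + b ^+ 2 by rewrite addr_ge0 ?sqr_ge0.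
  move: (complex.Re v) (complex.Im v) (complex.Im x) (complex.Im q) x0 dq Eab.
  move=> va vb y iq; clear; nra.
have : complex.Im x *
    (2 * (complex.Re v * complex.Re S + complex.Im v * complex.Im S)
       - (size s)%:R * sqn v) + complex.Im S <= 0.
  rewrite /S; elim: s {Qs rs xs ss S p p0 E Sv} tangent => [|q s IH] tan.
    by rewrite !big_nil /= !(mulr0, mul0r, addr0, subr0).
  have {}IH := IH (fun q qs => tan q (mem_behead (s := _ :: _) qs)).
  have {tan} := tan q (mem_head _ _).
  rewrite !big_cons !raddfD /= -[(size s).+1]add1n natrD.
  move: IH.
  move: (complex.Re (\sum_(_ <- _) _)) (complex.Im (\sum_(_ <- _) _)) => a b.
  move: (complex.Re (x - q)^-1) (complex.Im (x - q)^-1) => a' b'.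
  move: (complex.Re v) (complex.Im v) (complex.Im x) (_%:R) => va vb y k.
  clear; nra.
have -> : complex.Re S = complex.Re v * n.+1%:R by rewrite Sv raddfMn /= mulr_natr.
have -> : complex.Im S = complex.Im v * n.+1%:R by rewrite Sv raddfMn /= mulr_natr.
have : (size s)%:R <= n.+1%:R :> R by rewrite ler_nat.
have : 0 < n.+1%:R :> R by rewrite ltr0n.
move: Ev Nv x0 w0 (size s)%:R n.+1%:R.
move: (complex.Re v) (complex.Im v) (complex.Im x) (complex.Im w).
move=> va vb y iw; clear => E1 N0 y0 iw0 k m m0 km.
move: E1 N0; set N := _ ^+ 2 + _ => E1 N0 H.
have : 0 <= y * N * (m - k) by rewrite !mulr_ge0 ?subr_ge0 // ltW.
have : 0 < m * (iw * N) by rewrite !mulr_gt0.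
rewrite -E1; move: H; rewrite /N; nra.
Qed.

Lemma coef_polar (F : comNzRingType) n (Q : {poly F}) (w : F) j :
  (Q *+ n + (w%:P - 'X) * Q^`())`_j =
  (n%:R - j%:R) * Q`_j + w * j.+1%:R * Q`_j.+1.
Proof.
rewrite coefD coefMn mulrBl coefB coefCM coefXM coef_deriv.
rewrite -[Q`_j *+ n]mulr_natr -[Q`_j.+1 *+ _]mulr_natr.
case: j => [|j] /=; first ring.
by rewrite coef_deriv -[Q`_j.+1 *+ _]mulr_natr; ring.
Qed.

Lemma size_polar (F : comNzRingType) n (Q : {poly F}) (w : F) :
  (size Q <= n.+2)%N -> (size (Q *+ n.+1 + (w%:P - 'X) * Q^`())%R <= n.+1)%N.
Proof.
move=> sQ; apply/leq_sizeP => j nj; rewrite coef_polar.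
rewrite [Q`_j.+1]nth_default ?(leq_trans sQ) // mulr0 addr0.
move: nj; rewrite leq_eqVlt => /predU1P[<-|nj]; first by rewrite subrr mul0r.
by rewrite nth_default ?mulr0 // (leq_trans sQ).
Qed.

(** The polar derivative loses one degree only when deg Q is maximal; then the
    next coefficient vanishes only if the pole is the mean of the roots, which
    is not above the real axis. The bound keeps deg P + deg Q >= n alive along
    the induction. *)
Lemma size_polar_ge (R : rcfType) n (Q : {poly R[i]}) (w : R[i]) :
  Q != 0 -> (size Q <= n.+2)%N -> lower_stable Q -> 0 < complex.Im w ->
  (minn (size Q) n.+1 <= size (Q *+ n.+1 + (w%:P - 'X) * Q^`())%R)%N.
Proof.
move=> Q0 sQ stQ w0; have sQ0 : (0 < size Q)%N by rewrite size_poly_gt0.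
have lQ : lead_coef Q != 0 by rewrite lead_coef_eq0.
set Q1 := (_ + _)%R.
have szP j : Q1`_j != 0 -> (j < size Q1)%N.
  by rewrite ltnNge; apply: contraNN => /(nth_default 0) ->.
move: sQ; rewrite leq_eqVlt => /predU1P[sQ|sQ]; last first.
  rewrite geq_min -(prednK sQ0) szP // coef_polar [Q`__.+1]nth_default ?prednK //.
  have dn : ((size Q).-1 < n.+1)%N by rewrite prednK.
  by rewrite mulr0 addr0 mulf_neq0 // -natrB 1?ltnW // pnatr_eq0 -lt0n subn_gt0.
rewrite geq_min; apply/orP; right; apply: szP; rewrite coef_polar.
have [s Qs] := closed_field_poly_normal Q.
have rs q : q \in s -> complex.Im q <= 0.
  by move=> qs; apply: stQ; rewrite Qs rootZ // root_prod_XsubC.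
have ss : size s = n.+1.
  by move: sQ; rewrite Qs size_scale // size_prod_XsubC => -[].
have -> : Q`_n = - lead_coef Q * \sum_(q <- s) q.
  rewrite {1}Qs coefZ -[n]/(n.+1.-1) -ss coefPn_prod_XsubC ?ss //.
  by rewrite mulrN mulNr.
have -> : Q`_n.+1 = lead_coef Q by rewrite lead_coefE sQ.
rewrite (_ : _ + _ = lead_coef Q * (w * n.+1%:R - \sum_(q <- s) q)); last first.
  by rewrite -[n.+1%:R]natr1; ring.
rewrite mulf_neq0 // subr_eq0; apply/eqP => E.
have : complex.Im (\sum_(q <- s) q) <= 0.
  by rewrite raddf_sum big_seq; apply: sumr_le0 => q /rs.
rewrite -E mulr_natr raddfMn /=; apply/negP; rewrite -ltNge pmulrn_lgt0 //.
Qed.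

(** The half plane case of the Walsh-Szego theorem, by induction on deg P:
    conv_op_polar strips a root of P and lower_stable_polar says that the new
    right factor is stable again. *)
Theorem conv_op_lower (R : rcfType) n (P Q : {poly R[i]}) (z : R[i]) :
  (size P <= n.+1)%N -> (size Q <= n.+1)%N ->
  (n.+1 < size P + size Q)%N ->
  lower_stable P -> lower_stable Q -> 0 < complex.Im z ->
  (conv_op n P Q).[z] != 0.
Proof.
move: {2}(size P) (leqnn (size P)) => m.
elim: m n P Q => [|m IH] n P Q.
  by rewrite leqn0 => /eqP -> _ sQ; rewrite add0n ltnNge sQ.
move=> sPm sP sQ sPQ stP stQ z0.
have P0 : P != 0.
  by apply: contraTneq sPQ => ->; rewrite size_poly0 add0n -leqNgt.
have Q0 : Q != 0.
  by apply: contraTneq sPQ => ->; rewrite size_poly0 addn0 -leqNgt.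
have [sP1|sP1] := leqP (size P) 1.
  have /size_poly1P[c c0 ->] : size P == 1%N by rewrite eqn_leq sP1 size_poly_gt0.
  have sQn : size Q = n.+1.
    apply/eqP; rewrite eqn_leq sQ -ltnS (leq_trans sPQ) //.
    by rewrite -[(size Q).+1]add1n leq_add2r.
  rewrite /conv_op horner_sum (bigD1 ord_max) //= subnn derivn0 big1 ?addr0.
    rewrite hornerZ hornerC !mulf_neq0 // ?pnatr_eq0 -?lt0n ?fact_gt0 //.
    by rewrite -[n]/(n.+1.-1) -sQn -lead_coefE lead_coef_eq0.
  move=> j jn; rewrite derivnC ifN ?scaler0 ?horner0 // subn_eq0 -ltnNge.
  by rewrite ltn_neqAle -ltnS ltn_ord andbT -(inj_eq val_inj) in jn *.
case: n => [|n] in sP sQ sPQ *; first by move: sP1; rewrite ltnNge sP.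
have [a /factor_theorem[P' PE]] : exists a, root P a.
  by apply/closed_rootP; rewrite gtn_eqF.
have stP' : lower_stable P' by move=> x P'x; apply: stP; rewrite PE rootM P'x.
have a0 : complex.Im a <= 0 by apply: stP; rewrite PE rootM root_XsubC eqxx orbT.
have P'0 : P' != 0 by apply: contraNneq P0 => P'0; rewrite PE P'0 mul0r.
have sP' : size P = (size P').+1 by rewrite PE size_Mmonic ?monicXsubC // size_XsubC addn2.
have w0 : 0 < complex.Im (z - a) by rewrite raddfB /= subr_gt0 (le_lt_trans a0).
have sP'n : (size P' <= n.+1)%N by rewrite -ltnS -sP'.
have -> : P = ('X - a%:P) * P' by rewrite mulrC.
rewrite (conv_op_polar _ _ _ _ _ _ sP'n).
apply: IH => //.
- by rewrite -ltnS -sP'.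
- exact: size_polar.
- have := size_polar_ge _ _ _ _ Q0 sQ stQ w0; set Q1 := (_ + _)%R => sQ1.
  rewrite sP' in sPQ sP1.
  apply: leq_trans (leq_add (leqnn _) sQ1).
  rewrite addn_minr leq_min; apply/andP; split; first by rewrite -ltnS -addSn.
  by rewrite -[n.+2]add1n leq_add2r.
- exact: lower_stable_polar.
Qed.

(** * Algebra of the finite free convolution *)

Lemma coef_finite_free_add (R : realType) n (P Q : {poly R}) k : (k <= n)%N ->
  (finite_free_add n P Q)`_k = (n`!%:R * k`!%:R)^-1 *
    \sum_(j1 < n.+1) \sum_(j2 < n.+1 | (j1 + j2 == n + k)%N)
      P`_j1 * Q`_j2 * j1`!%:R * j2`!%:R.
Proof.
move=> kn; rewrite /finite_free_add coefZ coef_sum.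
rewrite (bigD1 (Ordinal (n:=n.+1) (m:=k) kn)) //= coefZ coefXn eqxx mulr1.
rewrite [X in _ + X]big1 ?addr0 => [|i ik]; first by rewrite invfM -[RHS]mulrA.
rewrite coefZ coefXn; case: eqP => [ki|_]; last by rewrite mulr0.
by case/eqP: ik; apply: val_inj.
Qed.

Lemma size_finite_free_add (R : realType) n (P Q : {poly R}) :
  (size (finite_free_add n P Q) <= n.+1)%N.
Proof.
apply/leq_sizeP => j nj; rewrite coefZ coef_sum big1 ?mulr0 // => i _.
by rewrite coefZ coefXn gtn_eqF ?mulr0 // (leq_trans (ltn_ord i)).
Qed.

Lemma finite_free_addC (R : realType) n (P Q : {poly R}) :
  finite_free_add n P Q = finite_free_add n Q P.
Proof.
rewrite /finite_free_add; congr (_ *: _); apply: eq_bigr => k _.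
congr (_ * _ *: _); under [RHS]eq_bigr do rewrite big_mkcond.
rewrite exchange_big /=; apply: eq_bigr => i _; rewrite big_mkcond /=.
apply: eq_bigr => j _; rewrite addnC; case: ifP => // _; ring.
Qed.

Lemma finite_free_add_conv_op (R : realType) n (P Q : {poly R}) :
  (size P <= n.+1)%N -> n`!%:R *: finite_free_add n P Q = conv_op n P Q.
Proof.
move=> sP; apply/polyP => k; rewrite coefZ /conv_op coef_sum.
have [nk|kn] := ltnP n k.
  rewrite nth_default ?mulr0 ?(leq_trans (size_finite_free_add _ _ _ _)) //.
  rewrite big1 // => j _; rewrite coefZ coef_derivn [P`__]nth_default ?mul0rn ?mulr0 //.
  by rewrite (leq_trans sP) // (leq_trans nk) // leq_addl.
rewrite coef_finite_free_add // invfM mulrA mulrA mulfV ?mul1r; last first.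
  by rewrite pnatr_eq0 -lt0n fact_gt0.
under eq_bigr do rewrite big_mkcond; rewrite exchange_big mulr_sumr /=.
apply: eq_bigr => j _; rewrite coefZ coef_derivn -big_mkcond /=.
have jn : (j <= n)%N by rewrite -ltnS.
have k0 : k`!%:R != 0 :> R by rewrite pnatr_eq0 -lt0n fact_gt0.
have Ek : (n - j + k)`!%:R = (((n - j + k) ^_ (n - j)) * k`!)%:R :> R.
  by rewrite -[X in (_ * X`!)%N](addKn (n - j)) ffact_fact // leq_addr.
have [jk|kj] := leqP (n - j + k) n.
  rewrite (bigD1 (Ordinal (n:=n.+1) (m:=(n - j + k)) jk)) /=; last first.
    by rewrite addnAC subnK.
  rewrite big1 ?addr0 => [|i /andP[/eqP ijk /eqP ik]]; last first.
    by case: ik; apply: val_inj => /=; rewrite addnBAC // -ijk addnK.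
  by rewrite Ek natrM -[_ *+ (_ ^_ _)]mulr_natr; field.
rewrite [P`__]nth_default ?(leq_trans sP) // mul0rn mulr0 big1 ?mulr0 // => i /eqP ijk.
by move: kj; rewrite addnBAC // -ijk addnK ltnNge -ltnS ltn_ord.
Qed.

Lemma finite_free_add_shiftl (R : realType) n (P Q : {poly R}) (a : R) :
  (size P <= n.+1)%N ->
  finite_free_add n (P \Po ('X + a%:P)) Q = finite_free_add n P Q \Po ('X + a%:P).
Proof.
move=> sP; have n0 : n`!%:R != 0 :> R by rewrite pnatr_eq0 -lt0n fact_gt0.
apply: (scalerI n0); rewrite -comp_polyZ !finite_free_add_conv_op //; last first.
  by rewrite size_comp_poly2 ?size_XaddC.
rewrite /conv_op rmorph_sum /=; apply: eq_bigr => j _; rewrite comp_polyZ.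
congr (_ *: _); elim: (n - j)%N => [|m IH]; first by rewrite !derivn0.
by rewrite !derivnS IH deriv_comp derivD derivX derivC addr0 mulr1.
Qed.

(** Both factors commute with translations: P because its derivatives do, and Q
    by symmetry. Hence zeros bounded above can be moved to the negative axis. *)
Lemma finite_free_add_shift (R : realType) n (P Q : {poly R}) (a : R) :
  (size P <= n.+1)%N -> (size Q <= n.+1)%N ->
  finite_free_add n (P \Po ('X + a%:P)) (Q \Po ('X + a%:P)) =
  finite_free_add n P Q \Po ('X + (2 * a)%:P).
Proof.
move=> sP sQ; rewrite finite_free_add_shiftl // finite_free_addC.
rewrite finite_free_add_shiftl // finite_free_addC -comp_polyA; congr (_ \Po _).
by rewrite comp_polyD comp_polyX comp_polyC -addrA -polyCD mulr2n mulrDl mul1r.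
Qed.

Lemma root_complexify_conj (R : realType) (P : {poly R}) (z : R[i]) :
  root (complexify P) z -> root (complexify P) (conjc z).
Proof.
rewrite !rootE => /eqP Pz; have : conjc (complexify P).[z] = 0 by rewrite Pz rmorph0.
rewrite -horner_map /= -map_poly_comp => <-; apply/eqP; congr (_.[_]).
by apply: eq_map_poly => x /=; rewrite oppr0.
Qed.

Lemma finite_free_add_upper (R : realType) n (P Q : {poly R}) (a b : R) (w : R[i]) :
  (size P <= n.+1)%N -> (size Q <= n.+1)%N -> (n.+1 < size P + size Q)%N ->
  real_rooted_le a P -> real_rooted_le b Q ->
  0 < complex.Im w -> ~~ root (complexify (finite_free_add n P Q)) w.
Proof.
move=> sP sQ sPQ rP rQ w0; apply/negP => Rw.
have stable c (S : {poly R}) : real_rooted_le c S -> lower_stable (complexify S).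
  by move=> rS z /rS[x -> _].
have := @conv_op_lower R n (complexify P) (complexify Q) w.
rewrite !size_map_poly => /(_ sP sQ sPQ (stable _ _ rP) (stable _ _ rQ) w0).
apply/negP; rewrite negbK.
have -> : conv_op n (complexify P) (complexify Q) = complexify (conv_op n P Q).
  rewrite /complexify /conv_op rmorph_sum /=; apply: eq_bigr => j _.
  by rewrite map_polyZ /= rmorphM /= derivn_map coef_map rmorph_nat.
rewrite -finite_free_add_conv_op // /complexify map_polyZ hornerZ.
by rewrite (rootP Rw) mulr0.
Qed.

(** A polynomial without zeros in the upper half plane does not vanish at i. *)
Lemma finite_free_add_neq0 (R : realType) n (P Q : {poly R}) (a b : R) :
  (size P <= n.+1)%N -> (size Q <= n.+1)%N -> (n.+1 < size P + size Q)%N ->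
  real_rooted_le a P -> real_rooted_le b Q -> finite_free_add n P Q != 0.
Proof.
move=> sP sQ sPQ rP rQ.
have := finite_free_add_upper _ _ _ _ _ _ 'i%C sP sQ sPQ rP rQ ltr01.
by apply: contraNneq => ->; rewrite /complexify rmorph0 root0.
Qed.

Lemma finite_free_add_real_rooted (R : realType) n (P Q : {poly R}) (a b : R) (z : R[i]) :
  (size P <= n.+1)%N -> (size Q <= n.+1)%N -> (n.+1 < size P + size Q)%N ->
  real_rooted_le a P -> real_rooted_le b Q ->
  root (complexify (finite_free_add n P Q)) z -> complex.Im z = 0.
Proof.
move=> sP sQ sPQ rP rQ Rz.
have nz w := finite_free_add_upper _ _ _ _ _ _ w sP sQ sPQ rP rQ.
apply/eqP; rewrite eq_le; apply/andP; split; rewrite leNgt; apply/negP.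
  by move=> /nz; rewrite Rz.
move=> z0; have := root_complexify_conj _ _ _ Rz; apply/negP; apply: nz.
by case: z z0 {Rz} => x y /=; rewrite oppr_gt0.
Qed.

Set Implicit Arguments.
Unset Strict Implicit.

(** * Laplace sums *)

Section LaplaceSum.
Context {R : realType}.
Implicit Types (p q r : {poly R}) (s t u : R).

(** This is s times the Laplace transform of p at s. Multiplying Laplace sums
    multiplies the numbers p_j j!, which is what the convolution does. *)
Definition laplace_sum (n : nat) p s := \sum_(k < n.+1) p`_k * k`!%:R / s ^+ k.

Definition nonneg_coef p := forall k, 0 <= p`_k.

Lemma horner_nonneg p t : nonneg_coef p -> 0 <= t -> 0 <= p.[t].
Proof.
move=> p0 t0; rewrite horner_coef; apply: sumr_ge0 => i _.
by rewrite mulr_ge0 // exprn_ge0.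
Qed.

(** Termwise (s t)^k / k! <= e^(s t). *)
Lemma horner_expR_le_laplace n p s t : (size p <= n.+1)%N -> nonneg_coef p ->
  0 < s -> 0 <= t -> p.[t] * expR (- (s * t)) <= laplace_sum n p s.
Proof.
move=> sp p0 s0 t0; rewrite (horner_coef_wide _ sp) mulr_suml.
apply: ler_sum => k _; rewrite -!mulrA ler_wpM2l // expRN ler_pdivrMr ?expR_gt0 //.
have st0 : 0 <= s * t by rewrite mulr_ge0 // ltW.
have E : (s * t) ^+ k / k`!%:R <= expR (s * t).
  case: (k : nat) => [|j]; first by rewrite expr0 fact0 divr1 -expR0 ler_expR.
  by apply: le_trans (expR_ge1Dxn j st0); rewrite lerDr.
have -> : t ^+ k = k`!%:R / s ^+ k * ((s * t) ^+ k / k`!%:R).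
  by rewrite exprMn; field; rewrite expf_neq0 ?gt_eqF //= pnatr_eq0 -lt0n fact_gt0.
by rewrite ler_wpM2l // divr_ge0 // exprn_ge0 // ltW.
Qed.

Lemma expn_expR_step k :
  k.+1%:R * (k.+1%:R ^+ k.+1 * expR (- k.+1%:R)) <=
  k.+2%:R ^+ k.+2 * expR (- k.+2%:R) :> R.
Proof.
have k2 : 0 < k.+2%:R :> R by [].
have := expR_ge1Dx (- k.+2%:R^-1 : R).
have -> : 1 - k.+2%:R^-1 = k.+1%:R / k.+2%:R :> R.
  have -> : k.+1%:R = k.+2%:R - 1 :> R by rewrite -[k.+2%:R]natr1 addrK.
  by rewrite mulrBl mulfV ?gt_eqF // mul1r.
move=> /(@lerXn2r _ k.+2 _ _) H.
have {H} := H _ _; rewrite !nnegrE divr_ge0 // expR_ge0 => /(_ isT isT).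
rewrite -expRM_natl mulrN mulfV ?gt_eqF // exprMn exprVn ler_pdivrMr ?exprn_gt0 //.
rewrite mulrA -exprS => H.
have -> : - k.+2%:R = - 1 - k.+1%:R :> R by rewrite -[k.+2%:R]natr1 opprD addrC.
by rewrite expRD mulrA ler_wpM2r ?expR_ge0 // mulrC.
Qed.

(** The upper half of Stirling's formula up to a linear factor, from
    1 - x <= e^(-x) at x = 1/(k+2). *)
Lemma fact_le_expR k :
  k`!%:R <= expR 1 * k.+1%:R * (k%:R ^+ k * expR (- k%:R)) :> R.
Proof.
case: k => [|k].
  by rewrite fact0 expr0 oppr0 expR0 !mulr1 -[leLHS]expR0 ler_expR.
have : k.+1`!%:R <= expR 1 * k.+1%:R * (k.+1%:R ^+ k.+1 * expR (- k.+1%:R)) :> R.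
  elim: k => [|k IH]; first by rewrite expr1 mulr1 mul1r -expRD subrr expR0.
  rewrite factS natrM -mulrA [_ * (k.+2%:R * _)]mulrCA ler_wpM2l //.
  by apply: le_trans IH _; rewrite -mulrA ler_wpM2l ?expR_ge0 // expn_expR_step.
move=> /le_trans; apply; rewrite ler_wpM2r ?mulr_ge0 ?exprn_ge0 ?expR_ge0 //.
by rewrite ler_wpM2l ?expR_ge0 // ler_nat.
Qed.

(** With horner_expR_le_laplace, the Laplace sum equals the supremum of
    p(t) e^(-s t) up to a factor polynomial in n. The k-th term is estimated at
    t = k/s, where t^k e^(-s t) is maximal; since all coefficients are
    nonnegative, p_k t^k <= p(t). *)
Lemma laplace_sum_le n p s B : (size p <= n.+1)%N -> nonneg_coef p -> 0 < s ->
  (forall t, 0 <= t -> p.[t] * expR (- (s * t)) <= B) ->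
  laplace_sum n p s <= n.+1%:R * (expR 1 * n.+1%:R) * B.
Proof.
move=> sp p0 s0 HB.
have B0 : 0 <= B.
  by apply: le_trans (HB 0 (lexx _)); rewrite mulr_ge0 ?horner_nonneg ?expR_ge0.
have -> : n.+1%:R * (expR 1 * n.+1%:R) * B =
    \sum_(k < n.+1) (expR 1 * n.+1%:R * B).
  by rewrite sumr_const card_ord -[RHS]mulr_natl !mulrA.
apply: ler_sum => k _.
set t := k%:R / s; have t0 : 0 <= t by rewrite divr_ge0 // ltW.
have : p`_k * t ^+ k * expR (- k%:R) <= B.
  apply: le_trans (HB t t0); rewrite /t [s * _]mulrC divfK ?gt_eqF // ler_wpM2r ?expR_ge0 //.
  rewrite (horner_coef_wide _ sp) (bigD1 k) //= lerDl; apply: sumr_ge0 => i _.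
  by rewrite mulr_ge0 ?exprn_ge0.
move=> {HB} H.
have e0 : 0 <= expR 1 * k.+1%:R :> R by rewrite mulr_ge0 ?expR_ge0.
have : p`_k * k`!%:R / s ^+ k <= expR 1 * k.+1%:R * (p`_k * t ^+ k * expR (- k%:R)).
  have -> : expR 1 * k.+1%:R * (p`_k * t ^+ k * expR (- k%:R)) =
    p`_k * (expR 1 * k.+1%:R * (k%:R ^+ k * expR (- k%:R))) / s ^+ k.
    by rewrite /t exprMn exprVn; ring.
  have sk0 : 0 <= (s ^+ k)^-1 by rewrite invr_ge0 exprn_ge0 // ltW.
  by rewrite ler_wpM2r // ler_wpM2l // fact_le_expR.
move=> /le_trans; apply; apply: le_trans (ler_wpM2l e0 H) _.
by rewrite ler_wpM2r // ler_wpM2l ?expR_ge0 // ler_nat ltn_ord.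
Qed.

(** The convolution keeps the terms with j1 + j2 >= n of the product of the two
    Laplace sums. *)
Lemma laplace_sum_conv n p q s : 0 < s ->
  n`!%:R / s ^+ n * laplace_sum n (finite_free_add n p q) s =
  \sum_(j1 < n.+1) \sum_(j2 < n.+1 | (n <= j1 + j2)%N)
    p`_j1 * j1`!%:R / s ^+ j1 * (q`_j2 * j2`!%:R / s ^+ j2).
Proof.
move=> s0; have sn0 : s != 0 by rewrite gt_eqF.
rewrite /laplace_sum mulr_sumr.
transitivity (\sum_(k < n.+1) \sum_(j1 < n.+1) \sum_(j2 < n.+1 | (j1 + j2 == n + k)%N)
    p`_j1 * j1`!%:R / s ^+ j1 * (q`_j2 * j2`!%:R / s ^+ j2)).
  apply: eq_bigr => k _; rewrite coef_finite_free_add -1?ltnS //.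
  have f0 m : m`!%:R != 0 :> R by rewrite pnatr_eq0 -lt0n fact_gt0.
  set S := \sum_(j1 < _) _.
  have -> : n`!%:R / s ^+ n * ((n`!%:R * k`!%:R)^-1 * S * k`!%:R / s ^+ k) =
            (s ^+ (n + k))^-1 * S.
    by rewrite exprD; field; rewrite !expf_neq0 // !f0.
  rewrite mulr_sumr; apply: eq_bigr => j1 _; rewrite mulr_sumr.
  apply: eq_bigr => j2 /eqP <-; rewrite exprD; field.
  by rewrite !expf_neq0.
rewrite exchange_big /=; apply: eq_bigr => j1 _.
under eq_bigr do rewrite big_mkcond /=.
rewrite exchange_big /= [RHS]big_mkcond; apply: eq_bigr => j2 _.
rewrite -big_mkcond /=; case: leqP => [nj|jn]; last first.
  by rewrite big1 // => k /eqP E; move: jn; rewrite E ltnNge leq_addr.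
have kn : (j1 + j2 - n < n.+1)%N.
  by rewrite ltnS leq_subLR leq_add // -ltnS.
rewrite (bigD1 (Ordinal kn)) /=; last by rewrite subnKC.
rewrite big1 ?addr0 // => k /andP[/eqP E /eqP]; case; apply: val_inj => /=.
by rewrite E addKn.
Qed.

Lemma laplace_sum_mul n p q s :
  laplace_sum n p s * laplace_sum n q s = \sum_(j1 < n.+1) \sum_(j2 < n.+1)
    p`_j1 * j1`!%:R / s ^+ j1 * (q`_j2 * j2`!%:R / s ^+ j2).
Proof.
by rewrite mulr_suml; apply: eq_bigr => j1 _; rewrite mulr_sumr.
Qed.

Lemma laplace_sum_conv_le n p q s : nonneg_coef p -> nonneg_coef q -> 0 < s ->
  n`!%:R / s ^+ n * laplace_sum n (finite_free_add n p q) s <=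
  laplace_sum n p s * laplace_sum n q s.
Proof.
move=> p0 q0 s0; rewrite laplace_sum_conv // laplace_sum_mul.
apply: ler_sum => j1 _; rewrite big_mkcond; apply: ler_sum => j2 _.
by case: ifP => // _; rewrite !mulr_ge0 ?invr_ge0 ?exprn_ge0 // ltW.
Qed.

(** The discarded terms have j1 + j2 < n, so passing from s' to s multiplies
    each of them by at most (s' / s)^n. They are negligible as soon as
    s^n times the product of the Laplace sums decreases exponentially in s. *)
Lemma laplace_sum_conv_ge n p q s s' : nonneg_coef p -> nonneg_coef q ->
  0 < s -> s <= s' ->
  laplace_sum n p s * laplace_sum n q s <=
  n`!%:R / s ^+ n * laplace_sum n (finite_free_add n p q) s +
  (s' / s) ^+ n * (laplace_sum n p s' * laplace_sum n q s').
Proof.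
move=> p0 q0 s0 ss'; have s'0 : 0 < s' by apply: lt_le_trans ss'.
rewrite laplace_sum_conv // !laplace_sum_mul mulr_sumr -big_split /=.
apply: ler_sum => j1 _; rewrite mulr_sumr [\sum_(_ < _ | (n <= _)%N) _]big_mkcond -big_split /=.
apply: ler_sum => j2 _.
have r0 t m : 0 < t -> 0 <= (t ^+ m)^-1 by move=> t0; rewrite invr_ge0 exprn_ge0 // ltW.
case: leqP => [_|jn].
  rewrite lerDl !mulr_ge0 ?r0 // exprn_ge0 //; exact: ltW (divr_gt0 _ _).
rewrite add0r.
have -> : p`_j1 * j1`!%:R / s ^+ j1 * (q`_j2 * j2`!%:R / s ^+ j2) =
  (s' / s) ^+ (j1 + j2) * (p`_j1 * j1`!%:R / s' ^+ j1 * (q`_j2 * j2`!%:R / s' ^+ j2)).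
  by rewrite exprD !exprMn !exprVn; field; rewrite !expf_neq0 ?gt_eqF.
have ge1 : 1 <= s' / s by rewrite ler_pdivlMr // mul1r.
by rewrite ler_wpM2r ?mulr_ge0 ?r0 // ler_weXn2l // ltnW.
Qed.

End LaplaceSum.

(** * Averages, generating polynomials and potentials *)

Section Average.
Context {R : realType} {T : Type}.
Implicit Types (s : seq T) (f g : T -> R).

Definition avg s f : R := (size s)%:R^-1 * \sum_(x <- s) f x.

Lemma size_mul_avg s f : (size s)%:R * avg s f = \sum_(x <- s) f x.
Proof.
case: s => [|x s]; first by rewrite /avg big_nil !mulr0.
by rewrite /avg mulrA mulfV ?mul1r // pnatr_eq0.
Qed.

Lemma avgD s f g : avg s (fun x => f x + g x) = avg s f + avg s g.
Proof. by rewrite /avg big_split mulrDr. Qed.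

Lemma avgZ s c f : avg s (fun x => c * f x) = c * avg s f.
Proof. by rewrite /avg -mulr_sumr mulrCA. Qed.

Lemma avgB s f g : avg s (fun x => f x - g x) = avg s f - avg s g.
Proof. by rewrite /avg sumrB mulrBr. Qed.

Lemma avg_cst s c : (0 < size s)%N -> avg s (fun=> c) = c.
Proof.
move=> s0; rewrite /avg big_const_seq count_predT iter_addr_0 -[c *+ _]mulr_natl.
by rewrite mulrA mulVf ?mul1r // pnatr_eq0 -lt0n.
Qed.

End Average.

Lemma ler_avg (R : realType) (T : eqType) (s : seq T) (f g : T -> R) :
  {in s, forall x, f x <= g x} -> avg s f <= avg s g.
Proof.
move=> fg; rewrite /avg ler_wpM2l ?invr_ge0 // big_seq [leRHS]big_seq.
exact: ler_sum.
Qed.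

Lemma eq_avg (R : realType) (T : eqType) (s : seq T) (f g : T -> R) :
  {in s, forall x, f x = g x} -> avg s f = avg s g.
Proof. by move=> fg; congr (_ * _); apply: eq_big_seq. Qed.

Lemma avg_ge0 (R : realType) (T : eqType) (s : seq T) (f : T -> R) :
  {in s, forall x, 0 <= f x} -> 0 <= avg s f.
Proof.
move=> f0; rewrite /avg mulr_ge0 ?invr_ge0 // big_seq; exact: sumr_ge0.
Qed.

Lemma avg_sqr (R : realType) (T : eqType) (s : seq T) (f : T -> R) :
  avg s f ^+ 2 <= avg s (fun x => f x ^+ 2).
Proof.
case: (posnP (size s)) => [|s0].
  by move=> /size0nil ->; rewrite /avg !big_nil !mulr0 expr0n.
set m := avg s f.
have : 0 <= avg s (fun x => f x ^+ 2 - (2 * m * f x - m ^+ 2)).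
  by apply: avg_ge0 => x _; rewrite [leRHS](_ : _ = (f x - m) ^+ 2) ?sqr_ge0 //; ring.
by rewrite !avgB avgZ avg_cst // -/m; lra.
Qed.

Section Pgf.
Context {R : realType}.
Implicit Types (s : seq R) (t u y : R).

(** A zero z <= a of a polynomial is encoded by y = 1 / (1 + a - z); zeros at
    minus infinity become y = 0. *)
Definition unit_seq s := {in s, forall y, 0 <= y <= 1}.

(** In terms of the zero z this is log ((a + t - z) / (1 + a - z)). *)
Definition logpot t y := ln (1 - y + t * y).
(** In terms of the zero z this is 1 / (a + t - z). *)
Definition cauchyk t y := y / (1 - y + t * y).

Lemma logpot_arg_gt0 t y : 0 < t -> 0 <= y <= 1 -> 0 < 1 - y + t * y.
Proof.
move=> t0 /andP[y0 y1]; have [->|yn0] := eqVneq y 0; first lra.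
by rewrite addrC ltr_pwDl ?subr_ge0 // mulr_gt0 // lt_def yn0.
Qed.

(** Up to a constant, the polynomial with zeros z translated by a: the factor
    a + t - z is 1 - y + t y divided by y. It is the probability generating
    function of a sum of independent Bernoulli variables. *)
Definition pgf s : {poly R} := \prod_(y <- s) ((1 - y)%:P + y *: 'X).

Lemma horner_pgf s t : (pgf s).[t] = \prod_(y <- s) (1 - y + t * y).
Proof.
rewrite /pgf horner_prod; apply: eq_bigr => y _.
by rewrite !hornerE mulrC.
Qed.

Lemma horner_pgf_gt0 s t : unit_seq s -> 0 < t -> 0 < (pgf s).[t].
Proof.
move=> us t0; rewrite horner_pgf big_seq.
by apply: prodr_gt0 => y /us; apply: logpot_arg_gt0.
Qed.

Lemma size_pgf s : (size (pgf s) <= (size s).+1)%N.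
Proof.
elim: s => [|y s IH]; first by rewrite /pgf big_nil size_poly1.
rewrite /pgf big_cons -/(pgf s) (leq_trans (size_polyMleq _ _)) //.
have : (size ((1 - y)%:P + y *: 'X)%R <= 2)%N.
  rewrite (leq_trans (size_polyD _ _)) // geq_max (leq_trans (size_polyC_leq1 _)) //=.
  by rewrite (leq_trans (size_scale_leq _ _)) // size_polyX.
by move: IH; rewrite /=; move: (size _) (size (pgf s)) (size s) => a b c; lia.
Qed.

Lemma pgf_nonneg s : unit_seq s -> nonneg_coef (pgf s).
Proof.
elim: s => [|y s IH] us k.
  by rewrite /pgf big_nil coef1; case: (k == 0%N).
have /andP[y0 y1] := us y (mem_head _ _).
have {}IH := IH (fun z zs => us z (mem_behead (s := y :: s) zs)).
rewrite /pgf big_cons -/(pgf s) mulrDl coefD coefCM -scalerAl coefZ coefXM.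
by rewrite addr_ge0 // mulr_ge0 ?subr_ge0 //; case: ifP.
Qed.

Lemma ln_pgf s t : unit_seq s -> 0 < t ->
  ln (pgf s).[t] = (size s)%:R * avg s (logpot t).
Proof.
move=> us t0; rewrite size_mul_avg horner_pgf.
elim: s us => [|y s IH] us; first by rewrite !big_nil ln1.
have us' : unit_seq s by move=> z zs; apply: us; rewrite inE zs orbT.
rewrite !big_cons lnM ?IH // posrE ?logpot_arg_gt0 ?us ?mem_head //.
by rewrite -horner_pgf horner_pgf_gt0.
Qed.

(** The logarithm is concave in u; the bound is stated without logarithms
    because the value at u = 0 may vanish. *)
Lemma pgf_tangent s t u : unit_seq s -> 0 < t -> 0 <= u ->
  (pgf s).[u] <= (pgf s).[t] * expR ((size s)%:R * avg s (cauchyk t) * (u - t)).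
Proof.
move=> us t0 u0; rewrite size_mul_avg mulr_suml expR_sum !horner_pgf -big_split /=.
rewrite big_seq [leRHS]big_seq; apply: ler_prod => y /us /[dup] y01 /andP[y0 y1].
have a0 := logpot_arg_gt0 t0 y01.
apply/andP; split; first by rewrite addr_ge0 ?subr_ge0 // mulr_ge0.
apply: le_trans (ler_wpM2l (ltW a0) (expR_ge1Dx _)).
rewrite mulrDr mulr1 /cauchyk mulrA mulrCA mulfV ?gt_eqF // mulr1; lra.
Qed.

Lemma cauchyk_ge0 t y : 0 < t -> 0 <= y <= 1 -> 0 <= cauchyk t y.
Proof.
move=> t0 y01; rewrite divr_ge0 ?(ltW (logpot_arg_gt0 _ _)) //.
by case/andP: y01.
Qed.

Lemma cauchyk_le1 t y : 0 < t -> 0 <= y <= 1 -> t * cauchyk t y <= 1.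
Proof.
move=> t0 y01; rewrite /cauchyk mulrA ler_pdivrMr ?logpot_arg_gt0 //.
by case/andP: y01; lra.
Qed.

Lemma cauchyk_sub t u y : 0 < t -> 0 < u -> 0 <= y <= 1 ->
  cauchyk t y - cauchyk u y = (u - t) * (cauchyk t y * cauchyk u y).
Proof.
move=> t0 u0 y01; rewrite /cauchyk.
by field; rewrite !gt_eqF ?logpot_arg_gt0.
Qed.

Lemma cauchyk_nonincr t u y : 0 < t -> t <= u -> 0 <= y <= 1 ->
  cauchyk u y <= cauchyk t y.
Proof.
move=> t0 tu y01; have u0 : 0 < u by apply: lt_le_trans tu.
rewrite -subr_ge0 cauchyk_sub //; apply: mulr_ge0; first by rewrite subr_ge0.
by apply: mulr_ge0; apply: cauchyk_ge0.
Qed.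

Lemma mul_cauchyk_nondecr t u y : 0 < t -> t <= u -> 0 <= y <= 1 ->
  t * cauchyk t y <= u * cauchyk u y.
Proof.
move=> t0 tu y01; have u0 : 0 < u by apply: lt_le_trans tu.
rewrite -subr_ge0.
have -> : u * cauchyk u y - t * cauchyk t y =
   (u - t) * (1 - y) * (y / (1 - y + t * y) / (1 - y + u * y)).
  by rewrite /cauchyk; field; rewrite !gt_eqF ?logpot_arg_gt0.
have /andP[y0 y1] := y01.
by rewrite !mulr_ge0 ?subr_ge0 ?invr_ge0 ?(ltW (logpot_arg_gt0 _ _)).
Qed.

End Pgf.

(** What is used of a logarithmic potential U and of its derivative G, the
    Cauchy transform, of a probability measure on the closed half-line, mass at
    minus infinity included. These inequalities are closed, so they pass from
    finite averages to limits. *)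
Record profile {R : realType} (U G : R -> R) : Prop := Profile {
  profile_tangent : forall t u, 0 < t -> 0 < u -> U u <= U t + G t * (u - t);
  profile_drop : forall t u, 0 < t -> t <= u -> G u ^+ 2 * (u - t) <= G t - G u;
  profile_mul_nondecr : forall t u, 0 < t -> t <= u -> t * G t <= u * G u;
  profile_ge0 : forall t, 0 < t -> 0 <= G t;
  profile_le1 : forall t, 0 < t -> t * G t <= 1 }.

Lemma profile_avg (R : realType) (s : seq R) : unit_seq s -> (0 < size s)%N ->
  profile (fun t => avg s (logpot t)) (fun t => avg s (cauchyk t)).
Proof.
move=> us s0; split=> [t u t0 u0|t u t0 tu|t u t0 tu|t t0|t t0].
- have n0 : 0 < (size s)%:R :> R by rewrite ltr0n.
  have H := pgf_tangent us t0 (ltW u0).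
  have pu := horner_pgf_gt0 us u0; have pt := horner_pgf_gt0 us t0.
  move: H; rewrite -(@ler_ln _ (pgf s).[u]) ?posrE ?mulr_gt0 ?expR_gt0 //.
  rewrite lnM ?posrE ?expR_gt0 ?horner_pgf_gt0 // expRK !ln_pgf //.
  by rewrite -mulrA -mulrDr ler_pM2l.
- have u0 : 0 < u by apply: lt_le_trans tu.
  have ut0 : 0 <= u - t by rewrite subr_ge0.
  have -> : avg s (cauchyk t) - avg s (cauchyk u) =
     (u - t) * avg s (fun y => cauchyk t y * cauchyk u y).
    by rewrite -avgB -avgZ; apply: eq_avg => y /us y01; rewrite cauchyk_sub.
  rewrite mulrC ler_wpM2l //; apply: le_trans (avg_sqr _ _) _.
  apply: ler_avg => y /us y01; rewrite expr2 ler_wpM2r ?cauchyk_ge0 //.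
  exact: cauchyk_nonincr.
- rewrite -!avgZ; apply: ler_avg => y /us y01; exact: mul_cauchyk_nondecr.
- by apply: avg_ge0 => y /us y01; apply: cauchyk_ge0.
- rewrite -avgZ -[leRHS](avg_cst 1 s0); apply: ler_avg => y /us y01.
  exact: cauchyk_le1.
Qed.

Lemma profile_lim (R : realType) (Un Gn : nat -> R -> R) (U G : R -> R) :
  (\forall n \near \oo, profile (Un n) (Gn n)) ->
  (forall t, 0 < t -> Un n t @[n --> \oo] --> U t) ->
  (forall t, 0 < t -> Gn n t @[n --> \oo] --> G t) ->
  profile U G.
Proof.
move=> pn Ut Gt; split=> [t u t0 u0|t u t0 tu|t u t0 tu|t t0|t t0].
- apply: (ler_cvg_to (Ut u u0) (cvgD (Ut t t0) (cvgMr_tmp (Gt t t0)))).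
  by apply: filterS pn => n pn; apply: profile_tangent.
- have u0 : 0 < u by apply: lt_le_trans tu.
  apply: (ler_cvg_to (cvgMr_tmp (cvgM (Gt u u0) (Gt u u0))) (cvgB (Gt t t0) (Gt u u0))).
  by apply: filterS pn => n pn; apply: (profile_drop pn).
- have u0 : 0 < u by apply: lt_le_trans tu.
  apply: (ler_cvg_to (cvgMl_tmp (Gt t t0)) (cvgMl_tmp (Gt u u0))).
  by apply: filterS pn => n pn; apply: (profile_mul_nondecr pn).
- apply: (ler_cvg_to (cvg_cst 0) (Gt t t0)).
  by apply: filterS pn => n pn; apply: (profile_ge0 pn).
- apply: (@ler_cvg_to _ _ _ _ _ (fun=> 1) _ 1 (cvgMl_tmp (Gt t t0)) (cvg_cst _)).
  by apply: filterS pn => n pn; apply: (profile_le1 pn).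
Qed.

(** * Exponential rates *)

Section Rates.
Context {R : realType}.
Implicit Types (s : seq R) (t u y : R).

Definition polyfac n : R := n.+1%:R * (expR 1 * n.+1%:R).

Lemma polyfac_gt0 n : 0 < polyfac n.
Proof. by rewrite /polyfac !mulr_gt0 ?expR_gt0. Qed.

Lemma ln_nat_rate : n%:R^-1 * ln n.+1%:R @[n --> \oo] --> (0 : R).
Proof.
have H : 4 * Num.sqrt (harmonic n) @[n --> \oo] --> (0 : R).
  rewrite -(mulr0 (4:R)); apply: cvgMl_tmp; rewrite -[X in _ --> X](@sqrtr0 R).
  by apply: continuous_cvg; [exact: sqrt_continuous|exact: cvg_harmonic].
apply: (squeeze_cvgr _ (cvg_cst 0) H).
near=> n; have n0 : (0 < n)%N by near: n; exact: nbhs_infty_gt.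
have nR : 0 < n%:R :> R by rewrite ltr0n.
apply/andP; split; first by rewrite mulr_ge0 // ln_ge0 // ler1n.
rewrite /harmonic /= sqrtrV //; set q := Num.sqrt n.+1%:R.
have q0 : 0 < q by rewrite sqrtr_gt0.
have qq : q * q = n.+1%:R by rewrite -expr2 sqr_sqrtr.
rewrite -qq lnM ?posrE // ler_pdivrMl // mulrA ler_pdivlMr //.
have lq : ln q <= q by apply: ltW; apply: ln_sublinear.
have : q * q <= 2 * n%:R.
  by rewrite qq -natrM ler_nat; lia.
have := ler_wpM2r (ltW q0) lq; lra.
Unshelve. all: by end_near. Qed.

Lemma inv_nat_cvg0 : n%:R^-1 @[n --> \oo] --> (0 : R).
Proof.
apply/(@gtr0_cvgV0 R _ _ _ (fun n : nat => n%:R)); last exact: cvgr_idn.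
by near=> n; rewrite ltr0n; near: n; exact: nbhs_infty_gt.
Unshelve. all: by end_near. Qed.

Lemma polyfac_rate : n%:R^-1 * ln (polyfac n) @[n --> \oo] --> (0 : R).
Proof.
have -> : (fun n => n%:R^-1 * ln (polyfac n)) =
    (fun n => n%:R^-1 + 2 * (n%:R^-1 * ln n.+1%:R)) :> (nat -> R).
  apply/funext => n; rewrite /polyfac !lnM ?posrE ?mulr_gt0 ?expR_gt0 //.
  by rewrite expRK; ring.
rewrite -[X in _ --> X](addr0 0) -[X in _ --> (_ + X)](mulr0 2).
by apply: cvgD; [exact: inv_nat_cvg0|apply: cvgMl_tmp; exact: ln_nat_rate].
Qed.

Lemma pgf_tilt s n t u sigma : unit_seq s -> size s = n -> 0 < t -> 0 <= u ->
  (pgf s).[u] * expR (- (n%:R * sigma * u)) <=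
  (pgf s).[t] * expR (- (n%:R * sigma * t)) *
    expR (n%:R * ((avg s (cauchyk t) - sigma) * (u - t))).
Proof.
move=> us sn t0 u0.
have := ler_wpM2r (expR_ge0 (- (n%:R * sigma * u))) (pgf_tangent us t0 u0).
move=> /le_trans; apply; rewrite sn; move: (avg s (cauchyk t)) => g.
rewrite -!mulrA -!expRD ler_wpM2l //.
  exact: ltW (horner_pgf_gt0 us t0).
by rewrite ler_expR le_eqVlt; apply/orP; left; apply/eqP; ring.
Qed.

(** The function u |-> p(u) e^(-n sigma u) is log-concave, and the bounds at
    tau / 2 and 2 tau trap its maximum between these two points. There the
    tangent at tau is off by at most n |G_n(tau) - sigma| tau. *)
Lemma laplace_pgf_le s n tau sigma : unit_seq s -> size s = n -> (0 < n)%N ->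
  0 < tau -> 0 < sigma ->
  sigma <= avg s (cauchyk (tau / 2)) -> avg s (cauchyk (2 * tau)) <= sigma ->
  laplace_sum n (pgf s) (n%:R * sigma) <=
  polyfac n * ((pgf s).[tau] * expR (- (n%:R * sigma * tau)) *
    expR (n%:R * (`|avg s (cauchyk tau) - sigma| * tau))).
Proof.
move=> us sn n0 t0 s0 Glo Ghi; have nR : 0 < n%:R :> R by rewrite ltr0n.
apply: laplace_sum_le; rewrite -?sn ?size_pgf ?sn //.
  exact: pgf_nonneg.
  by rewrite mulr_gt0.
have mid u : tau / 2 <= u <= 2 * tau ->
    (pgf s).[u] * expR (- (n%:R * sigma * u)) <=
    (pgf s).[tau] * expR (- (n%:R * sigma * tau)) *
    expR (n%:R * (`|avg s (cauchyk tau) - sigma| * tau)).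
  move=> /andP[lo hi]; have u0 : 0 <= u by lra.
  apply: le_trans (pgf_tilt sigma us sn t0 u0) _.
  rewrite ler_wpM2l ?mulr_ge0 ?expR_ge0 ?(ltW (horner_pgf_gt0 us t0)) //.
  rewrite ler_expR ler_wpM2l //; apply: le_trans (ler_norm _) _.
  by rewrite normrM ler_wpM2l // ler_norml; lra.
have side u v : 0 <= u -> 0 < v -> (avg s (cauchyk v) - sigma) * (u - v) <= 0 ->
    (pgf s).[u] * expR (- (n%:R * sigma * u)) <=
    (pgf s).[v] * expR (- (n%:R * sigma * v)).
  move=> u0 v0 H; apply: le_trans (pgf_tilt sigma us sn v0 u0) _.
  rewrite ler_piMr ?mulr_ge0 ?expR_ge0 ?(ltW (horner_pgf_gt0 us v0)) //.
  by rewrite expR_le1 pmulr_rle0.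
move=> u u0; have [ult|ule] := ltP u (tau / 2).
  apply: le_trans (mid (tau / 2) _); last lra.
  by apply: side => //; [lra|rewrite mulr_ge0_le0 // ?subr_ge0 // subr_le0 ltW].
have [ugt|uge] := ltP (2 * tau) u; last by apply: mid; rewrite ule.
apply: le_trans (mid (2 * tau) _); last lra.
by apply: side => //; [lra|rewrite mulr_le0_ge0 // ?subr_le0 // subr_ge0 ltW].
Qed.

(** Laplace's method without integrals: the rate is the Legendre transform of
    the concave potential U, reached where its slope G equals sigma. *)
Lemma laplace_rate (ys : nat -> seq R) (U : R) (G : R -> R) tau sigma :
  (\forall n \near \oo, size (ys n) = n /\ unit_seq (ys n)) ->
  avg (ys n) (logpot tau) @[n --> \oo] --> U ->
  (forall t, 0 < t -> avg (ys n) (cauchyk t) @[n --> \oo] --> G t) ->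
  0 < tau -> 0 < sigma -> G tau = sigma ->
  sigma < G (tau / 2) -> G (2 * tau) < sigma ->
  n%:R^-1 * ln (laplace_sum n (pgf (ys n)) (n%:R * sigma)) @[n --> \oo]
    --> U - sigma * tau.
Proof.
move=> ysn cU cG t0 s0 Gt Glo Ghi.
have th0 : 0 < tau / 2 by rewrite divr_gt0.
have t20 : 0 < 2 * tau by rewrite mulr_gt0.
have cL : avg (ys n) (logpot tau) - sigma * tau @[n --> \oo] --> U - sigma * tau.
  by apply: cvgB => //; exact: cvg_cst.
have cH : n%:R^-1 * ln (polyfac n) + (avg (ys n) (logpot tau) - sigma * tau)
   + `|avg (ys n) (cauchyk tau) - sigma| * tau @[n --> \oo] --> U - sigma * tau.
  rewrite -[X in _ --> X]addr0; apply: cvgD.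
    rewrite -[X in _ --> X]add0r; apply: cvgD => //; exact: polyfac_rate.
  rewrite -[X in _ --> X](mul0r tau); apply: cvgMr_tmp.
  rewrite -[X in _ --> X](normr0 R) -(subrr sigma); apply: cvg_norm.
  by apply: cvgB; [rewrite -[X in _ --> X]Gt; exact: cG|exact: cvg_cst].
apply: (squeeze_cvgr _ cL cH); near=> n.
have n0 : (0 < n)%N by near: n; exact: nbhs_infty_gt.
have [sn us] : size (ys n) = n /\ unit_seq (ys n) by near: n.
have nR : 0 < n%:R :> R by rewrite ltr0n.
have ns : 0 < n%:R * sigma by rewrite mulr_gt0.
have p0 := horner_pgf_gt0 us t0.
have spn : (size (pgf (ys n)) <= n.+1)%N by have := size_pgf (ys n); rewrite sn.
have low := horner_expR_le_laplace spn (pgf_nonneg us) ns (ltW t0).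
have lap0 : 0 < laplace_sum n (pgf (ys n)) (n%:R * sigma).
  by apply: lt_le_trans low; rewrite mulr_gt0 ?expR_gt0.
have up : laplace_sum n (pgf (ys n)) (n%:R * sigma) <=
  polyfac n * ((pgf (ys n)).[tau] * expR (- (n%:R * sigma * tau)) *
    expR (n%:R * (`|avg (ys n) (cauchyk tau) - sigma| * tau))).
  apply: laplace_pgf_le => //; near: n.
    exact: (cvgr_ge _ (cG _ th0)).
  exact: (cvgr_le _ (cG _ t20)).
apply/andP; split.
  rewrite ler_pdivlMl // mulrBr -[n in n%:R * avg _ _]sn -ln_pgf //.
  move: low; rewrite -(@ler_ln _ (_ * _)) ?posrE ?mulr_gt0 ?expR_gt0 //.
  by rewrite lnM ?posrE ?expR_gt0 // expRK -mulrA.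
move: (polyfac n) (polyfac_gt0 n) up => F F0 up.
have := up; rewrite -(@ler_ln _ (laplace_sum _ _ _)) ?posrE ?mulr_gt0 ?expR_gt0 //.
rewrite lnM ?posrE ?mulr_gt0 ?expR_gt0 // lnM ?posrE ?mulr_gt0 ?expR_gt0 //.
rewrite lnM ?posrE ?expR_gt0 // !expRK ln_pgf // sn => {}up.
rewrite ler_pdivrMl //; apply: le_trans up _.
by rewrite le_eqVlt; apply/orP; left; apply/eqP; field; rewrite gt_eqF.
Unshelve. all: by end_near. Qed.

(** If Y is exponentially smaller than X, then V lies between X / 2 and X. *)
Lemma rate_perturb (V X Y : nat -> R) (x y : R) :
  (\forall n \near \oo, [/\ 0 < X n, 0 < Y n, V n <= X n & X n <= V n + Y n]) ->
  n%:R^-1 * ln (X n) @[n --> \oo] --> x ->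
  n%:R^-1 * ln (Y n) @[n --> \oo] --> y -> y < x ->
  n%:R^-1 * ln (V n) @[n --> \oo] --> x.
Proof.
move=> VXY cX cY yx.
have cL : n%:R^-1 * ln (X n) - n%:R^-1 * ln 2 @[n --> \oo] --> x.
  rewrite -[X in _ --> X]subr0 -[X in _ --> _ - X](mul0r (ln 2)).
  by apply: cvgB => //; apply: cvgMr_tmp; exact: inv_nat_cvg0.
have cD : n%:R^-1 * ln (X n) - n%:R^-1 * ln (Y n) - n%:R^-1 * ln 2
    @[n --> \oo] --> x - y.
  rewrite -[X in _ --> X]subr0 -[X in _ --> _ - X](mul0r (ln 2)).
  apply: cvgB; first exact: cvgB.
  by apply: cvgMr_tmp; exact: inv_nat_cvg0.
apply: (squeeze_cvgr _ cL cX); near=> n.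
have n0 : (0 < n)%N by near: n; exact: nbhs_infty_gt.
have nR : 0 < n%:R :> R by rewrite ltr0n.
have [X0 Y0 VX XV] : [/\ 0 < X n, 0 < Y n, V n <= X n & X n <= V n + Y n] by near: n.
have : 0 <= n%:R^-1 * ln (X n) - n%:R^-1 * ln (Y n) - n%:R^-1 * ln 2.
  by near: n; apply: (cvgr_ge _ cD); rewrite subr_gt0.
rewrite -!mulrBr pmulr_rge0 ?invr_gt0 // -addrA -opprD subr_ge0 => H.
have {}H : Y n * 2 <= X n.
  by rewrite -ler_ln ?posrE ?mulr_gt0 // lnM ?posrE.
have V0 : 0 < V n by lra.
rewrite !ler_pM2l ?invr_gt0 //; apply/andP; split; last by rewrite ler_ln ?posrE.
by rewrite -ln_div ?posrE // ler_ln ?posrE ?divr_gt0 // ler_pdivrMr //; lra.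
Unshelve. all: by end_near. Qed.

(** The factor n! / n^n is the one produced by laplace_sum_conv at n sigma; with
    it the rate has a limit. *)
Definition conv_rate n (r : {poly R}) sigma :=
  n%:R^-1 * ln (n`!%:R / n%:R ^+ n * laplace_sum n r (n%:R * sigma)).

(** The last hypothesis says that sigma^n times the product of the Laplace sums
    decreases, so that the terms discarded by the convolution do not count. *)
Lemma conv_rate_cvg (p q : nat -> {poly R}) (N : R -> R) (sigma sigma' : R) :
  (forall n, nonneg_coef (p n)) -> (forall n, nonneg_coef (q n)) ->
  0 < sigma -> sigma < sigma' ->
  (forall x : R, 0 < x -> \forall n \near \oo, 0 < laplace_sum n (p n) (n%:R * x) *
         laplace_sum n (q n) (n%:R * x)) ->
  (forall x : R, x = sigma \/ x = sigma' ->
    n%:R^-1 * ln (laplace_sum n (p n) (n%:R * x) *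
         laplace_sum n (q n) (n%:R * x)) @[n --> \oo] --> N x) ->
  N sigma' + ln sigma' < N sigma + ln sigma ->
  conv_rate n (finite_free_add n (p n) (q n)) sigma @[n --> \oo]
    --> N sigma + ln sigma.
Proof.
move=> p0 q0 s0 ss' lap0 cN NN; have s'0 : 0 < sigma' by apply: lt_trans ss'.
pose V n := n`!%:R / (n%:R * sigma) ^+ n *
  laplace_sum n (finite_free_add n (p n) (q n)) (n%:R * sigma).
pose X n := laplace_sum n (p n) (n%:R * sigma) * laplace_sum n (q n) (n%:R * sigma).
pose Y n := (sigma' / sigma) ^+ n *
  (laplace_sum n (p n) (n%:R * sigma') * laplace_sum n (q n) (n%:R * sigma')).
have H : \forall n \near \oo, [/\ 0 < X n, 0 < Y n, V n <= X n & X n <= V n + Y n].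
  near=> n; have n0 : (0 < n)%N by near: n; exact: nbhs_infty_gt.
  have nR : 0 < n%:R :> R by rewrite ltr0n.
  have ns0 : 0 < n%:R * sigma by rewrite mulr_gt0.
  split.
  - by near: n; apply: lap0.
  - by rewrite mulr_gt0 ?exprn_gt0 ?divr_gt0 //; near: n; apply: lap0.
  - exact: laplace_sum_conv_le.
  - have -> : Y n = (n%:R * sigma' / (n%:R * sigma)) ^+ n *
      (laplace_sum n (p n) (n%:R * sigma') * laplace_sum n (q n) (n%:R * sigma')).
      by congr (_ ^+ _ * _); field; rewrite !gt_eqF.
    apply: laplace_sum_conv_ge => //; rewrite ler_pM2l // ltW //.
have cX : n%:R^-1 * ln (X n) @[n --> \oo] --> N sigma by apply: cN; left.
have cY : n%:R^-1 * ln (Y n) @[n --> \oo] --> ln sigma' - ln sigma + N sigma'.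
  have : ln sigma' - ln sigma + n%:R^-1 * ln (laplace_sum n (p n) (n%:R * sigma') *
         laplace_sum n (q n) (n%:R * sigma')) @[n --> \oo] -->
         ln sigma' - ln sigma + N sigma'.
    by apply: cvgD; [exact: cvg_cst|apply: cN; right].
  apply: cvg_trans; apply: near_eq_cvg; near=> n.
  have n0 : (0 < n)%N by near: n; exact: nbhs_infty_gt.
  rewrite /Y lnM ?posrE ?exprn_gt0 ?divr_gt0 //; last by near: n; apply: lap0.
  rewrite lnXn ?divr_gt0 // ln_div ?posrE // mulrDr; congr (_ + _).
  by rewrite -[(_ - _) *+ n]mulr_natl mulrA mulVf ?mul1r // pnatr_eq0 -lt0n.
have := rate_perturb H cX cY; rewrite addrAC ltrBlDr addrC => /(_ NN) cV.
have : n%:R^-1 * ln (V n) + ln sigma @[n --> \oo] --> N sigma + ln sigma.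
  by apply: cvgD => //; exact: cvg_cst.
apply: cvg_trans; apply: near_eq_cvg; near=> n.
have n0 : (0 < n)%N by near: n; exact: nbhs_infty_gt.
have nR : 0 < n%:R :> R by rewrite ltr0n.
have : 0 < V n.
  have XV : X n <= V n + Y n by near: n; apply: filterS H => n [].
  suff : Y n < X n by lra.
  have [X0 Y0] : 0 < X n /\ 0 < Y n by near: n; apply: filterS H => n [].
  rewrite -ltr_ln ?posrE // -(@ltr_pM2l _ n%:R^-1) ?invr_gt0 // -subr_gt0.
  near: n; apply: (cvgr_gt _ (cvgB cX cY)); lra.
move=> V0; rewrite /conv_rate.
have -> : n`!%:R / n%:R ^+ n * laplace_sum n (finite_free_add n (p n) (q n)) (n%:R * sigma)
   = sigma ^+ n * V n.
  by rewrite /V exprMn; field; rewrite !expf_neq0 // gt_eqF.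
rewrite lnM ?posrE ?exprn_gt0 // lnXn // mulrDr addrC; congr (_ + _).
by rewrite -[ln _ *+ n]mulr_natl mulrA mulVf ?mul1r // gt_eqF.
Unshelve. all: by end_near. Qed.

(** A finite Legendre duality. If the slope at t of the potential of s lies on
    the far side of sigma as seen from sigma', then u |-> p(u) e^(-n sigma u) is
    monotone beyond t, and its supremum is attained where comparing sigma with
    sigma' costs at most e^(n (sigma' - sigma) t). *)
Lemma laplace_slope s n (c t sigma sigma' : R) : unit_seq s -> size s = n ->
  0 < c -> (0 < n)%N -> 0 < t -> 0 < sigma -> 0 < sigma' ->
  (sigma' - sigma) * (avg s (cauchyk t) - sigma) <= 0 ->
  laplace_sum n (c *: pgf s) (n%:R * sigma) <=
  polyfac n * (expR (n%:R * ((sigma' - sigma) * t)) *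
    laplace_sum n (c *: pgf s) (n%:R * sigma')).
Proof.
move=> us sn c0 n0 t0 s0 s'0 H; have nR : 0 < n%:R :> R by rewrite ltr0n.
have spn : (size (c *: pgf s) <= n.+1)%N.
  by apply: leq_trans (size_scale_leq _ _) _; have := size_pgf s; rewrite sn.
have pc : nonneg_coef (c *: pgf s).
  by move=> k; rewrite coefZ; apply: mulr_ge0; [exact: ltW|exact: pgf_nonneg].
apply: laplace_sum_le => //; first by rewrite mulr_gt0.
have main u : 0 <= u -> (sigma' - sigma) * (u - t) <= 0 ->
    (c *: pgf s).[u] * expR (- (n%:R * sigma * u)) <=
    expR (n%:R * ((sigma' - sigma) * t)) * laplace_sum n (c *: pgf s) (n%:R * sigma').
  move=> u0 Hu.
  apply: (@le_trans _ _ (expR (n%:R * ((sigma' - sigma) * t)) *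
     ((c *: pgf s).[u] * expR (- (n%:R * sigma' * u))))); last first.
    rewrite ler_wpM2l ?expR_ge0 //; apply: horner_expR_le_laplace => //.
    by rewrite mulr_gt0.
  rewrite mulrCA -expRD ler_wpM2l ?horner_nonneg // ler_expR.
  have := ler_wpM2l (ltW nR) Hu; lra.
move=> u u0; have [Hu|Hu] := leP ((sigma' - sigma) * (u - t)) 0; first exact: main.
apply: le_trans (main t (ltW t0) _); last by rewrite subrr mulr0.
rewrite !hornerZ -[leLHS]mulrA -[leRHS]mulrA ler_wpM2l ?(ltW c0) //.
apply: le_trans (pgf_tilt sigma us sn t0 u0) _.
rewrite ler_piMr ?mulr_ge0 ?expR_ge0 ?(ltW (horner_pgf_gt0 us t0)) //.
rewrite expR_le1 pmulr_rle0 // -(@pmulr_rle0 _ ((sigma' - sigma) ^+ 2)); last first.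
  by rewrite exprn_even_gt0 //=; apply: contraTneq Hu => ->; rewrite mul0r ltxx.
have -> : (sigma' - sigma) ^+ 2 * ((avg s (cauchyk t) - sigma) * (u - t)) =
  ((sigma' - sigma) * (avg s (cauchyk t) - sigma)) * ((sigma' - sigma) * (u - t)) by ring.
by rewrite mulr_le0_ge0 // ltW.
Qed.

(** The contrapositive of laplace_slope in the limit: chords of the limiting
    rate tell on which side of sigma the Cauchy transform at t eventually lies. *)
Lemma conv_slope (ws : nat -> seq R) (c : nat -> R) (M M' t sigma sigma' : R) :
  (\forall n \near \oo, [/\ size (ws n) = n, unit_seq (ws n) & 0 < c n]) ->
  0 < t -> 0 < sigma -> 0 < sigma' ->
  conv_rate n (c n *: pgf (ws n)) sigma @[n --> \oo] --> M ->
  conv_rate n (c n *: pgf (ws n)) sigma' @[n --> \oo] --> M' ->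
  (sigma' - sigma) * t < M - M' ->
  \forall n \near \oo, 0 < (sigma' - sigma) * (avg (ws n) (cauchyk t) - sigma).
Proof.
move=> wsn t0 s0 s'0 cM cM' H.
have cD : conv_rate n (c n *: pgf (ws n)) sigma - conv_rate n (c n *: pgf (ws n)) sigma'
   - n%:R^-1 * ln (polyfac n) @[n --> \oo] --> M - M'.
  rewrite -[X in _ --> X]subr0; apply: cvgB; [exact: cvgB|exact: polyfac_rate].
near=> n; have n0 : (0 < n)%N by near: n; exact: nbhs_infty_gt.
have nR : 0 < n%:R :> R by rewrite ltr0n.
have [sn us c0] : [/\ size (ws n) = n, unit_seq (ws n) & 0 < c n] by near: n.
have : (sigma' - sigma) * t < conv_rate n (c n *: pgf (ws n)) sigma -
    conv_rate n (c n *: pgf (ws n)) sigma' - n%:R^-1 * ln (polyfac n).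
  by near: n; exact: (cvgr_gt _ cD).
rewrite !ltNge; apply: contraNN => le0.
have := laplace_slope us sn c0 n0 t0 s0 s'0 le0.
have lap0 x : 0 < x -> 0 < laplace_sum n (c n *: pgf (ws n)) (n%:R * x).
  move=> x0; apply: (@lt_le_trans _ _ ((c n *: pgf (ws n)).[1] * expR (- (n%:R * x * 1)))).
    by rewrite mulr_gt0 ?expR_gt0 // hornerZ mulr_gt0 ?horner_pgf_gt0.
  apply: horner_expR_le_laplace => //; last by rewrite mulr_gt0.
    by apply: leq_trans (size_scale_leq _ _) _; have := size_pgf (ws n); rewrite sn.
  by move=> k; rewrite coefZ; apply: mulr_ge0; [exact: ltW|exact: pgf_nonneg].
have f0 : 0 < n`!%:R / n%:R ^+ n :> R.
  by rewrite divr_gt0 ?exprn_gt0 // ltr0n fact_gt0.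
move: (polyfac n) (polyfac_gt0 n) => F F0.
rewrite -ler_ln ?posrE ?mulr_gt0 ?expR_gt0 ?lap0 //.
rewrite lnM ?posrE ?mulr_gt0 ?expR_gt0 ?lap0 //.
rewrite lnM ?posrE ?expR_gt0 ?lap0 // expRK => Hs.
rewrite /conv_rate !(lnM f0) ?posrE ?lap0 //.
rewrite -!mulrBr ler_pdivrMl //; lra.
Unshelve. all: by end_near. Qed.

End Rates.

(** * Inverse Cauchy transforms *)

Lemma IVT_lipschitz_decr (R : realType) (f : R -> R) (a b L v : R) : a <= b ->
  0 <= L ->
  (forall x y, a <= x -> x <= y -> y <= b -> 0 <= f x - f y <= L * (y - x)) ->
  f b <= v <= f a -> exists2 c, a <= c <= b & f c = v.
Proof.
move=> ab L0 Lf /andP[bv va].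
(* Clamping to [a, b] turns f into a function continuous everywhere. *)
pose cl x := Num.max a (Num.min b x).
have clP x : a <= cl x <= b.
  by rewrite /cl le_max lexx /= ge_max ab ge_min lexx.
have cl_mono x y : x <= y -> 0 <= cl y - cl x <= y - x.
  rewrite /cl /Num.max /Num.min => xy.
  by case: (ltP b x) => bx; case: (ltP b y) => yb; case: ltP => ?; case: ltP => ?; lra.
have gL x y : x <= y -> `|f (cl x) - f (cl y)| <= L * (y - x).
  move=> xy; have /andP[c1 c2] := cl_mono _ _ xy.
  have /andP[ax _] := clP x; have /andP[_ yb] := clP y.
  have cxy : cl x <= cl y by rewrite -subr_ge0.
  have /andP[h1 h2] := Lf _ _ ax cxy yb.
  by rewrite ger0_norm //; apply: le_trans h2 _; rewrite ler_wpM2l.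
have cont : continuous (fun x => f (cl x)).
  move=> x; apply/cvgrPdist_le => e e0.
  have L1 : 0 < L + 1 by lra.
  near=> y.
  have H : `|x - y| <= e / (L + 1).
    by near: y; apply: cvgr_dist_le => //; rewrite divr_gt0.
  have {}H : (L + 1) * `|x - y| <= e by rewrite mulrC -ler_pdivlMr.
  apply: le_trans H; have [xy|/ltW yx] := leP x y.
    by apply: le_trans (gL _ _ xy) _; rewrite ler0_norm ?subr_le0 //; nra.
  by rewrite distrC; apply: le_trans (gL _ _ yx) _; rewrite ger0_norm ?subr_ge0 //; nra.
have cla : cl a = a by rewrite /cl min_r // maxxx.
have clb : cl b = b by rewrite /cl minxx max_r.
have [||c cab fc] := @IVT R (fun x => f (cl x)) a b v ab.
- exact: continuous_subspaceT.
- by rewrite cla clb ge_min bv orbT /= le_max va.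
- by exists (cl c).
Unshelve. all: by end_near. Qed.

Section ProfileInverse.
Context {R : realType}.
Variables (U G : R -> R).
Hypothesis P : profile U G.
Implicit Types (t u s : R).

Lemma profile_nonincr t u : 0 < t -> t <= u -> G u <= G t.
Proof.
move=> t0 tu; rewrite -subr_ge0; apply: le_trans (profile_drop P t0 tu).
by rewrite mulr_ge0 ?sqr_ge0 ?subr_ge0.
Qed.

Lemma profile_gt0 T t : 0 < T -> 0 < G T -> 0 < t -> 0 < G t.
Proof.
move=> T0 GT0 t0; have [tT|/ltW Tt] := leP t T.
  exact: lt_le_trans (profile_nonincr t0 tT).
have := profile_mul_nondecr P T0 Tt => /(lt_le_trans (mulr_gt0 T0 GT0)).
by rewrite pmulr_rgt0.
Qed.

Hypothesis Gpos : forall t, 0 < t -> 0 < G t.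

Lemma profile_decr t u : 0 < t -> t < u -> G u < G t.
Proof.
move=> t0 tu; rewrite -subr_gt0; apply: lt_le_trans (profile_drop P t0 (ltW tu)).
by rewrite mulr_gt0 ?subr_gt0 // exprn_gt0 // Gpos // (lt_trans t0).
Qed.

Lemma profile_inverse T s : 0 < T -> 0 < s -> s < G T ->
  exists2 t, T <= t & G t = s.
Proof.
move=> T0 s0 sT; pose b := Num.max T s^-1.
have Tb : T <= b by rewrite le_max lexx.
have b0 : 0 < b by apply: lt_le_trans Tb.
have Gb : G b <= s.
  have sb : 1 <= b * s.
    by rewrite -[leLHS](mulVf (lt0r_neq0 s0)) ler_pM2r // /b le_max lexx orbT.
  by rewrite -(ler_pM2l b0); apply: le_trans (profile_le1 P b0) sb.
have GT0 := Gpos T0.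
have [|x y Tx xy yb||c /andP[Tc _] Gc] := @IVT_lipschitz_decr R G T b (G T / T) s Tb.
- by rewrite divr_ge0 // ltW.
- have x0 : 0 < x by apply: lt_le_trans Tx.
  rewrite subr_ge0 profile_nonincr //=.
  have := profile_mul_nondecr P x0 xy => H.
  have GyT : G y <= G T by apply: profile_nonincr => //; apply: le_trans Tx xy.
  have Gy0 : 0 <= G y by apply: ltW; apply: Gpos; apply: lt_le_trans xy.
  rewrite mulrAC ler_pdivlMr //.
  have h1 : T * (G x - G y) <= x * (G x - G y).
    by rewrite ler_wpM2r // subr_ge0 profile_nonincr.
  have h2 : x * (G x - G y) <= (y - x) * G y by lra.
  have h3 : (y - x) * G y <= (y - x) * G T by rewrite ler_wpM2l // subr_ge0.
  lra.
- by rewrite Gb ltW.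
- by exists c.
Qed.

(** The inverse of G is locally Lipschitz, by profile_drop. *)
Lemma profile_inv_lip s s' t t' : 0 < s -> s <= s' -> 0 < t -> 0 < t' ->
  G t = s -> G t' = s' -> 0 <= t - t' <= (s' - s) / s ^+ 2.
Proof.
move=> s0 ss' t0 t'0 Gt Gt'.
have tt' : t' <= t.
  by rewrite leNgt; apply/negP => /(profile_decr t0); rewrite Gt Gt' ltNge ss'.
rewrite subr_ge0 tt' /= ler_pdivlMr ?exprn_gt0 // mulrC -Gt -Gt'.
exact: (profile_drop P).
Qed.

(** The inverse of G also drops at a minimal speed, because t G(t) is
    nondecreasing. This is what makes the inverse for the convolution, which
    contains the increasing term - 1 / s, strictly decreasing. *)
Lemma profile_inv_expand s s' t t' : 0 < s -> s <= s' -> 0 < t -> 0 < t' ->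
  G t = s -> G t' = s' -> t' * (s' - s) / s <= t - t'.
Proof.
move=> s0 ss' t0 t'0 Gt Gt'.
have /andP[] := profile_inv_lip s0 ss' t0 t'0 Gt Gt'; rewrite subr_ge0 => tt' _.
rewrite ler_pdivrMr //; have := profile_mul_nondecr P t'0 tt'.
by rewrite Gt Gt'; lra.
Qed.

(** The derivative of the Legendre transform U(t) - s t is - t, here in the
    form of bounds on its chords. *)
Lemma profile_legendre s s' t t' : 0 < t -> 0 < t' -> G t = s -> G t' = s' ->
  (s' - s) * t' <= (U t - s * t) - (U t' - s' * t') <= (s' - s) * t.
Proof.
move=> t0 t'0 Gt Gt'.
have := profile_tangent P t0 t'0; have := profile_tangent P t'0 t0.
rewrite Gt Gt'; lra.
Qed.

End ProfileInverse.

Lemma ln_sub_le (R : realType) (x y : R) : 0 < x -> 0 < y -> ln y - ln x <= (y - x) / x.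
Proof.
move=> x0 y0; rewrite -ln_div ?posrE //.
have -> : y / x = 1 + (y - x) / x by field; rewrite gt_eqF.
apply: le_ln1Dx.
have : 0 < y / x by rewrite divr_gt0.
have -> : y / x = 1 + (y - x) / x by field; rewrite gt_eqF.
lra.
Qed.

(** * The Cauchy transform of the convolution *)

Lemma profile_cvg (R : realType) (ys : nat -> seq R) (U G : R -> R) : (forall n, unit_seq (ys n)) ->
  (\forall n \near \oo, size (ys n) = n) ->
  (forall t : R, 0 < t -> avg (ys n) (logpot t) @[n --> \oo] --> U t) ->
  (forall t : R, 0 < t -> avg (ys n) (cauchyk t) @[n --> \oo] --> G t) ->
  profile U G.
Proof.
move=> us sn cU cG.
apply: (@profile_lim _ (fun n t => avg (ys n) (logpot t))
  (fun n t => avg (ys n) (cauchyk t))) => //.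
near=> n; apply: profile_avg => //.
have -> : size (ys n) = n by near: n.
near: n; exact: nbhs_infty_gt.
Unshelve. all: by end_near. Qed.


(** In this section ys1 and ys2 encode the zeros of the two factors, ws those of
    the convolution, and c absorbs the normalization of the polynomials. *)
Section Core.
Context {R : realType}.
Variables (ys1 ys2 ws : nat -> seq R) (c : nat -> R) (U1 G1 U2 G2 : R -> R).
Hypothesis unit1 : forall n, unit_seq (ys1 n).
Hypothesis unit2 : forall n, unit_seq (ys2 n).
Hypothesis size1 : \forall n \near \oo, size (ys1 n) = n.
Hypothesis size2 : \forall n \near \oo, size (ys2 n) = n.
Hypothesis convE : \forall n \near \oo, [/\ size (ws n) = n, unit_seq (ws n), 0 < c n &
  finite_free_add n (pgf (ys1 n)) (pgf (ys2 n)) = c n *: pgf (ws n)].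
Hypothesis cU1 : forall t, 0 < t -> avg (ys1 n) (logpot t) @[n --> \oo] --> U1 t.
Hypothesis cU2 : forall t, 0 < t -> avg (ys2 n) (logpot t) @[n --> \oo] --> U2 t.
Hypothesis cG1 : forall t, 0 < t -> avg (ys1 n) (cauchyk t) @[n --> \oo] --> G1 t.
Hypothesis cG2 : forall t, 0 < t -> avg (ys2 n) (cauchyk t) @[n --> \oo] --> G2 t.
Variable T : R.
Hypothesis T0 : 0 < T.
Hypothesis TG : 1 < T * G1 T + T * G2 T.

Let P1 : profile U1 G1. Proof. exact: profile_cvg unit1 size1 cU1 cG1. Qed.
Let P2 : profile U2 G2. Proof. exact: profile_cvg unit2 size2 cU2 cG2. Qed.

Let G1T : 0 < G1 T.
Proof. by rewrite -(pmulr_rgt0 _ T0); have := profile_le1 P2 T0; have := TG; lra. Qed.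
Let G2T : 0 < G2 T.
Proof. by rewrite -(pmulr_rgt0 _ T0); have := profile_le1 P1 T0; have := TG; lra. Qed.

Let pos1 t : 0 < t -> 0 < G1 t. Proof. exact: (profile_gt0 P1 T0). Qed.
Let pos2 t : 0 < t -> 0 < G2 t. Proof. exact: (profile_gt0 P2 T0). Qed.

Let sigma0 := Num.min (G1 T) (G2 T).
Let sigma00 : 0 < sigma0. Proof. by rewrite lt_min G1T. Qed.

(* Inverses of G1 and G2 on ]0, sigma0[, with values in [T, +oo[. *)
Let tau1 s := get [set t | T <= t /\ G1 t = s].
Let tau2 s := get [set t | T <= t /\ G2 t = s].
(* The inverse Cauchy transform expected for the convolution: s K(s) - 1 is the
   sum of the two functions s tau(s) - 1. *)
Let K s := tau1 s + tau2 s - s^-1.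

Let tau1P s : 0 < s < sigma0 -> T <= tau1 s /\ G1 (tau1 s) = s.
Proof.
rewrite lt_min => /and3P[s0 s1 _].
have [t Tt Gt] := profile_inverse P1 pos1 T0 s0 s1.
by apply: (@getPex _ [set t | T <= t /\ G1 t = s]); exists t.
Qed.

Let tau2P s : 0 < s < sigma0 -> T <= tau2 s /\ G2 (tau2 s) = s.
Proof.
rewrite lt_min => /and3P[s0 _ s1].
have [t Tt Gt] := profile_inverse P2 pos2 T0 s0 s1.
by apply: (@getPex _ [set t | T <= t /\ G2 t = s]); exists t.
Qed.

Let tau1_gt0 s : 0 < s < sigma0 -> 0 < tau1 s.
Proof. by move=> /tau1P[/(lt_le_trans T0)]. Qed.
Let tau2_gt0 s : 0 < s < sigma0 -> 0 < tau2 s.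
Proof. by move=> /tau2P[/(lt_le_trans T0)]. Qed.

(* The excess kappa > 0 reflects that the two masses at minus infinity add up
   to less than 1; it keeps K positive and decreasing. *)
Let kappa := T * G1 T + T * G2 T - 1.
Let kappa0 : 0 < kappa. Proof. by rewrite /kappa subr_gt0. Qed.

Let K_ge s : 0 < s < sigma0 -> kappa / s <= K s.
Proof.
move=> ss; have [T1 E1] := tau1P ss; have [T2 E2] := tau2P ss.
have /andP[s0 _] := ss.
have := profile_mul_nondecr P1 T0 T1; have := profile_mul_nondecr P2 T0 T2.
rewrite E1 E2 ler_pdivrMr // /K /kappa => h1 h2.
by rewrite !mulrDl mulNr mulVf ?gt_eqF //; lra.
Qed.

Let K_gt0 s : 0 < s < sigma0 -> 0 < K s.
Proof.
by move=> ss; apply: lt_le_trans (K_ge ss); rewrite divr_gt0 //; case/andP: ss.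
Qed.

Let K_decr s s' : 0 < s -> s < s' -> s' < sigma0 ->
  (s' - s) / s * K s' <= K s - K s'.
Proof.
move=> s0 ss' s'0; have ss : 0 < s < sigma0 by rewrite s0 (lt_trans ss').
have ss1 : 0 < s' < sigma0 by rewrite s'0 (lt_trans s0).
have [T1 E1] := tau1P ss; have [T2 E2] := tau2P ss.
have [T1' E1'] := tau1P ss1; have [T2' E2'] := tau2P ss1.
have := profile_inv_expand P1 pos1 s0 (ltW ss') (tau1_gt0 ss) (tau1_gt0 ss1) E1 E1'.
have := profile_inv_expand P2 pos2 s0 (ltW ss') (tau2_gt0 ss) (tau2_gt0 ss1) E2 E2'.
have s'p : 0 < s' by case/andP: ss1.
have E : (s' - s) / s * K s' = tau1 s' * (s' - s) / s + tau2 s' * (s' - s) / s -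
   (s^-1 - s'^-1).
  by rewrite /K; field; rewrite !gt_eqF.
rewrite E /K; lra.
Qed.

Let K_lt s s' : 0 < s -> s < s' -> s' < sigma0 -> K s' < K s.
Proof.
move=> s0 ss' s'0; rewrite -subr_gt0; apply: lt_le_trans (K_decr s0 ss' s'0).
apply: mulr_gt0; first by rewrite divr_gt0 ?subr_gt0.
by apply: K_gt0; rewrite s'0 (lt_trans s0).
Qed.

Let K_lip s s' : 0 < s -> s <= s' -> s' < sigma0 ->
  tau1 s + tau2 s - (tau1 s' + tau2 s') <= 2 * ((s' - s) / s ^+ 2).
Proof.
move=> s0 ss' s'0; have ss : 0 < s < sigma0 by rewrite s0 (le_lt_trans ss').
have ss1 : 0 < s' < sigma0 by rewrite s'0 (lt_le_trans s0).
have [T1 E1] := tau1P ss; have [T2 E2] := tau2P ss.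
have [T1' E1'] := tau1P ss1; have [T2' E2'] := tau2P ss1.
have /andP[_ h1] := profile_inv_lip P1 pos1 s0 ss' (tau1_gt0 ss) (tau1_gt0 ss1) E1 E1'.
have /andP[_ h2] := profile_inv_lip P2 pos2 s0 ss' (tau2_gt0 ss) (tau2_gt0 ss1) E2 E2'.
lra.
Qed.

Let K_onto t : K (sigma0 / 2) <= t -> exists2 s, 0 < s < sigma0 & K s = t.
Proof.
set b := sigma0 / 2 => Kt.
have b0 : 0 < b by rewrite divr_gt0.
have bs : b < sigma0 by rewrite /b; have := sigma00; lra.
have t0 : 0 < t by apply: lt_le_trans Kt; apply: K_gt0; rewrite b0.
pose a := Num.min b (kappa / t).
have a0 : 0 < a by rewrite lt_min b0 divr_gt0.
have ab : a <= b by rewrite ge_min lexx.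
have sa : 0 < a < sigma0 by rewrite a0 (le_lt_trans ab).
have tK : t <= K a.
  apply: le_trans (K_ge sa); rewrite ler_pdivlMr // mulrC -ler_pdivlMr //.
  by rewrite ge_min lexx orbT.
have [|x y ax xy yb||s /andP[as_ sb] Ks] := @IVT_lipschitz_decr R K a b (2 / a ^+ 2) t ab.
- by rewrite divr_ge0 // exprn_ge0 // ltW.
- have x0 : 0 < x by apply: lt_le_trans ax.
  have y0 : 0 < y by apply: lt_le_trans xy.
  have ys : y < sigma0 by apply: le_lt_trans bs.
  apply/andP; split.
    move: xy; rewrite le_eqVlt => /predU1P[->|xy]; first by rewrite subrr.
    by rewrite subr_ge0 ltW // K_lt.
  have := K_lip x0 xy ys.
  have h1 : (y - x) / x ^+ 2 <= (y - x) / a ^+ 2.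
    rewrite ler_wpM2l ?subr_ge0 // lef_pV2 ?posrE ?exprn_gt0 //.
    by rewrite lerXn2r ?nnegrE // ltW.
  have h2 : y^-1 <= x^-1 by rewrite lef_pV2.
  by rewrite /K mulrAC -mulrA; lra.
- by rewrite Kt.
- by exists s => //; rewrite (lt_le_trans a0) // (le_lt_trans sb).
Qed.

(* Legendre transforms, and the limit M of conv_rate; the derivative of M is
   - K. *)
Let N s := (U1 (tau1 s) - s * tau1 s) + (U2 (tau2 s) - s * tau2 s).
Let M s := N s + ln s.

Let M_slope s s' : 0 < s -> s < s' -> s' < sigma0 ->
  (s' - s) * (tau1 s' + tau2 s' - s^-1) <= M s - M s' <=
  (s' - s) * (tau1 s + tau2 s - s'^-1).
Proof.
move=> s0 ss' s'0; have ss : 0 < s < sigma0 by rewrite s0 (lt_trans ss').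
have ss1 : 0 < s' < sigma0 by rewrite s'0 (lt_trans s0).
have [T1 E1] := tau1P ss; have [T2 E2] := tau2P ss.
have [T1' E1'] := tau1P ss1; have [T2' E2'] := tau2P ss1.
have := profile_legendre P1 (tau1_gt0 ss) (tau1_gt0 ss1) E1 E1'.
have := profile_legendre P2 (tau2_gt0 ss) (tau2_gt0 ss1) E2 E2'.
have s'p : 0 < s' by case/andP: ss1.
have l1 := ln_sub_le s0 s'p; have l2 := ln_sub_le s'p s0.
have l3 : (s - s') / s' = - ((s' - s) * s'^-1) by ring.
rewrite l3 in l2.
move=> /andP[a1 a2] /andP[b1 b2]; rewrite /M /N; apply/andP; split; lra.
Qed.

Let laplace_gt0 ys x n : unit_seq (ys n) -> size (ys n) = n -> (0 < n)%N ->
  0 < x -> 0 < laplace_sum n (pgf (ys n)) (n%:R * x : R).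
Proof.
move=> us sn n0 x0.
apply: (@lt_le_trans _ _ ((pgf (ys n)).[1] * expR (- (n%:R * x * 1)))).
  by rewrite mulr_gt0 ?expR_gt0 ?horner_pgf_gt0.
apply: horner_expR_le_laplace => //; last by rewrite mulr_gt0 // ltr0n.
  by have := size_pgf (ys n); rewrite sn.
exact: pgf_nonneg.
Qed.

Let M_rate s : 0 < s < sigma0 ->
  conv_rate n (c n *: pgf (ws n)) s @[n --> \oo] --> M s.
Proof.
move=> ss; have /andP[s0 ss0] := ss.
(* The discarded terms are negligible if M is smaller at some s' > s. *)
have [s' [ss' s's0 Ms']] : exists s', [/\ s < s', s' < sigma0 & M s' < M s].
  pose d := Num.min ((sigma0 - s) / 2) (K s * s ^+ 2 / 4).
  have d0 : 0 < d.
    by rewrite lt_min !divr_gt0 ?subr_gt0 ?mulr_gt0 ?exprn_gt0 ?K_gt0.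
  have d1 : d <= (sigma0 - s) / 2 by rewrite ge_min lexx.
  have d2 : d <= K s * s ^+ 2 / 4 by rewrite ge_min lexx orbT.
  have ssd : s < s + d by rewrite ltrDl.
  have sds : s + d < sigma0 by lra.
  exists (s + d); split => //; rewrite -subr_gt0.
  have /andP[h _] := M_slope s0 ssd sds; apply: lt_le_trans h.
  have -> : s + d - s = d by ring.
  rewrite pmulr_rgt0 //.
  have := K_lip s0 (ltW ssd) sds; have -> : s + d - s = d by ring.
  have h : d / s ^+ 2 <= K s / 4.
    by rewrite ler_pdivrMr ?exprn_gt0 // mulrAC.
  have := K_gt0 ss; rewrite /K in h *; lra.
have ss1 : 0 < s' < sigma0 by rewrite s's0 (lt_trans s0).
have rate1 x : 0 < x < sigma0 ->
   n%:R^-1 * ln (laplace_sum n (pgf (ys1 n)) (n%:R * x)) @[n --> \oo]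
     --> U1 (tau1 x) - x * tau1 x.
  move=> xs; have [Tx Ex] := tau1P xs; have t0 := tau1_gt0 xs.
  apply: (@laplace_rate _ ys1 _ G1) => //.
  - by apply: filterS size1 => n.
  - exact: cU1.
  - by case/andP: xs.
  - by rewrite -{1}Ex; apply: (profile_decr P1 pos1); [exact: divr_gt0|lra].
  - by rewrite -{2}Ex; apply: (profile_decr P1 pos1) => //; lra.
have rate2 x : 0 < x < sigma0 ->
   n%:R^-1 * ln (laplace_sum n (pgf (ys2 n)) (n%:R * x)) @[n --> \oo]
     --> U2 (tau2 x) - x * tau2 x.
  move=> xs; have [Tx Ex] := tau2P xs; have t0 := tau2_gt0 xs.
  apply: (@laplace_rate _ ys2 _ G2) => //.
  - by apply: filterS size2 => n.
  - exact: cU2.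
  - by case/andP: xs.
  - by rewrite -{1}Ex; apply: (profile_decr P2 pos2); [exact: divr_gt0|lra].
  - by rewrite -{2}Ex; apply: (profile_decr P2 pos2) => //; lra.
have := @conv_rate_cvg _ (fun n => pgf (ys1 n)) (fun n => pgf (ys2 n)) N s s'
  (fun n => pgf_nonneg (@unit1 n)) (fun n => pgf_nonneg (@unit2 n)) s0 ss'.
move=> H; have {H} := H _ _ Ms'.
have lap0 x : 0 < x -> \forall n \near \oo,
   0 < laplace_sum n (pgf (ys1 n)) (n%:R * x) /\ 0 < laplace_sum n (pgf (ys2 n)) (n%:R * x).
  move=> x0; near=> n.
  have n0 : (0 < n)%N by near: n; exact: nbhs_infty_gt.
  have s1 : size (ys1 n) = n by near: n.
  have s2 : size (ys2 n) = n by near: n.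
  by split; apply: laplace_gt0.
move=> H; have {H} := H _ _.
have l1 : forall x : R, 0 < x -> \forall n \near \oo,
  0 < laplace_sum n (pgf (ys1 n)) (n%:R * x) * laplace_sum n (pgf (ys2 n)) (n%:R * x).
  by move=> x x0; apply: filterS (lap0 x x0) => n [? ?]; rewrite mulr_gt0.
have l2 : forall x : R, x = s \/ x = s' ->
  n%:R^-1 * ln (laplace_sum n (pgf (ys1 n)) (n%:R * x) *
     laplace_sum n (pgf (ys2 n)) (n%:R * x)) @[n --> \oo] --> N x.
  move=> x xs; have {}xs : 0 < x < sigma0 by case: xs => ->.
  apply: cvg_trans (cvgD (rate1 x xs) (rate2 x xs)); apply: near_eq_cvg.
  have x0 : 0 < x by case/andP: xs.
  apply: filterS (lap0 x x0) => n [? ?] /=.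
  by rewrite lnM ?posrE // mulrDr.
move=> /(_ l1 l2) H; apply: cvg_trans H; apply: near_eq_cvg.
by apply: filterS convE => n [_ _ _ ->].
Unshelve. all: by end_near. Qed.

Let G_conv s : 0 < s < sigma0 -> avg (ws n) (cauchyk (K s)) @[n --> \oo] --> s.
Proof.
move=> ss; have /andP[s0 ss0] := ss; have K0 := K_gt0 ss.
have wsn : \forall n \near \oo, [/\ size (ws n) = n, unit_seq (ws n) & 0 < c n].
  by apply: filterS convE => n [].
apply/cvgrPdist_le => e e0; near=> n; rewrite ler_norml; apply/andP; split.
- suff : avg (ws n) (cauchyk (K s)) < s + e by move: (avg _ _) => g; lra.
  near: n.
  (* A chord of M between s1 < s2, both above s and below s + e, with slope
     flatter than - K(s). *)
  pose s1 := s + Num.min (sigma0 - s) e / 3.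
  have m0 : 0 < Num.min (sigma0 - s) e by rewrite lt_min subr_gt0 ss0.
  have m1 : Num.min (sigma0 - s) e <= sigma0 - s by rewrite ge_min lexx.
  have m2 : Num.min (sigma0 - s) e <= e by rewrite ge_min lexx orbT.
  have s1s : s < s1 by rewrite /s1; lra.
  have s10 : s1 < sigma0 by rewrite /s1; lra.
  have s1e : s1 < s + e / 2 by rewrite /s1; lra.
  have s1p : 0 < s1 by apply: lt_trans s1s.
  have KK : K s1 < K s by apply: K_lt.
  pose d := Num.min (Num.min ((sigma0 - s1) / 2) (e / 2)) ((K s - K s1) * s1 ^+ 2 / 2).
  have d0 : 0 < d by rewrite !lt_min !divr_gt0 ?subr_gt0 ?mulr_gt0 ?subr_gt0 ?exprn_gt0.
  have d1 : d <= (sigma0 - s1) / 2 by rewrite !ge_min lexx.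
  have d2 : d <= e / 2 by rewrite !ge_min lexx orbT.
  have d3 : d <= (K s - K s1) * s1 ^+ 2 / 2 by rewrite ge_min lexx orbT.
  pose s2 := s1 + d.
  have s12 : s1 < s2 by rewrite /s2 ltrDl.
  have s20 : s2 < sigma0 by rewrite /s2; lra.
  have s2p : 0 < s2 by apply: lt_trans s12.
  have sl : (s1 - s2) * K s < M s2 - M s1.
    have /andP[_ h] := M_slope s1p s12 s20.
    suff h' : tau1 s1 + tau2 s1 - s2^-1 < K s.
      have : (s2 - s1) * (tau1 s1 + tau2 s1 - s2^-1) < (s2 - s1) * K s.
        by rewrite ltr_pM2l // subr_gt0.
      lra.
    have -> : tau1 s1 + tau2 s1 - s2^-1 = K s1 + (s1^-1 - s2^-1) by rewrite /K; ring.
    have : s1^-1 - s2^-1 <= d / s1 ^+ 2.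
      have -> : s1^-1 - s2^-1 = d / (s1 * s2).
        by rewrite /s2; field; rewrite !gt_eqF // -/s2.
      rewrite ler_pM2l // lef_pV2 ?posrE ?mulr_gt0 // expr2 ler_pM2l //.
      exact: ltW.
    have : d / s1 ^+ 2 <= (K s - K s1) / 2.
      by rewrite ler_pdivrMr ?exprn_gt0 // mulrAC.
    lra.
  have ss2 : 0 < s2 < sigma0 by rewrite s2p.
  have ss1 : 0 < s1 < sigma0 by rewrite s1p.
  have := conv_slope wsn K0 s2p s1p (M_rate ss2) (M_rate ss1) sl.
  apply: filterS => n; rewrite nmulr_rgt0 ?subr_lt0 //; rewrite /s2; lra.
- suff : s - e < avg (ws n) (cauchyk (K s)) by move: (avg _ _) => g; lra.
  near: n.
  (* Symmetrically, a chord between s - e and s, steeper than - K(s). *)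
  pose s1 := s - Num.min s e / 2.
  have m0 : 0 < Num.min s e by rewrite lt_min s0.
  have m1 : Num.min s e <= s by rewrite ge_min lexx.
  have m2 : Num.min s e <= e by rewrite ge_min lexx orbT.
  have s1p : 0 < s1 by rewrite /s1; lra.
  have s1s : s1 < s by rewrite /s1; lra.
  have s1e : s - e < s1 by rewrite /s1; lra.
  have s10 : s1 < sigma0 by apply: lt_trans ss0.
  have KK : K s < K s1 by apply: K_lt.
  pose d := Num.min ((s - s1) / 2) ((K s1 - K s) * s1 ^+ 2 / 4).
  have d0 : 0 < d.
    rewrite lt_min; apply/andP; split; first by rewrite divr_gt0 ?subr_gt0.
    by rewrite divr_gt0 // mulr_gt0 ?exprn_gt0 // subr_gt0.
  have d1 : d <= (s - s1) / 2 by rewrite !ge_min lexx.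
  have d2 : d <= (K s1 - K s) * s1 ^+ 2 / 4 by rewrite !ge_min lexx orbT.
  pose s2 := s1 + d.
  have s12 : s1 < s2 by rewrite /s2 ltrDl.
  have s20 : s2 < sigma0 by rewrite /s2; lra.
  have s2p : 0 < s2 by apply: lt_trans s12.
  have sl : (s2 - s1) * K s < M s1 - M s2.
    have /andP[h _] := M_slope s1p s12 s20.
    apply: lt_le_trans h; rewrite ltr_pM2l ?subr_gt0 //.
    have := K_lip s1p (ltW s12) s20.
    have -> : s2 - s1 = d by rewrite /s2; ring.
    have : d / s1 ^+ 2 <= (K s1 - K s) / 4.
      by rewrite ler_pdivrMr ?exprn_gt0 // mulrAC.
    have -> : K s1 = tau1 s1 + tau2 s1 - s1^-1 by [].
    by move: KK; rewrite /(K s1); lra.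
  have ss2 : 0 < s2 < sigma0 by rewrite s2p.
  have ss1 : 0 < s1 < sigma0 by rewrite s1p.
  have := conv_slope wsn K0 s1p s2p (M_rate ss1) (M_rate ss2) sl.
  apply: filterS => n; rewrite pmulr_rgt0 ?subr_gt0 //; lra.
Unshelve. all: by end_near. Qed.

(** The chords of the limiting rate M have slopes close to - K, so by
    conv_slope the Cauchy transform of the convolution at K(s) is squeezed
    around s. As K is continuous and unbounded near 0, this covers all large
    arguments. *)
Theorem cauchy_avg_conv : exists (s0 t0 : R) (tau tau' : R -> R),
  let K s := tau s + tau' s - s^-1 in
  [/\ 0 < s0,
      forall s, 0 < s < s0 -> [/\ 0 < tau s, G1 (tau s) = s, 0 < tau' s & G2 (tau' s) = s],
      forall s, 0 < s < s0 -> 0 < K s /\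
        avg (ws n) (cauchyk (K s)) @[n --> \oo] --> s &
      forall t, t0 <= t -> exists2 s, 0 < s < s0 & K s = t].
Proof.
exists sigma0, (K (sigma0 / 2)), tau1, tau2; split => //.
- move=> s ss; have [_ E1] := tau1P ss; have [_ E2] := tau2P ss.
  by split => //; [exact: tau1_gt0|exact: tau2_gt0].
- by move=> s ss; split; [exact: K_gt0|exact: G_conv].
Qed.

End Core.

(** * From Cauchy transforms to more general averages *)

Lemma cvg_approx (R : realType) (u : nat -> R) :
  (forall e : R, 0 < e -> exists x : R, \forall n \near \oo, `|x - u n| < e) ->
  exists l : R, u n @[n --> \oo] --> l.
Proof.
move=> H; suff : cvg (u n @[n --> \oo]) by move=> ?; exists (lim (u n @[n --> \oo])).
by apply: cauchy_cvg; apply: cauchy_exP => e e0; apply: H.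
Qed.

Section AvgCvg.
Context {R : realType}.
Variable ws : nat -> seq R.
Hypothesis wsP : \forall n \near \oo, (0 < size (ws n))%N /\ unit_seq (ws n).
Implicit Types (f g : R -> R).

(** The functions with this property form a vector space closed under uniform
    limits on [0, 1]. Starting from Cauchy kernels, it is enlarged until it
    contains functions that separate points. *)
Definition avg_cvg f := exists l : R, avg (ws n) f @[n --> \oo] --> l.

Lemma avg_cvg_cst c : avg_cvg (fun=> c).
Proof.
exists c; apply: cvg_near_cst.
by apply: filterS wsP => n [? _]; rewrite avg_cst.
Qed.

Lemma avg_cvgD f g : avg_cvg f -> avg_cvg g -> avg_cvg (fun y => f y + g y).
Proof.
move=> [l fl] [m gm]; exists (l + m).
rewrite (_ : (fun n => avg (ws n) _) = (fun n => avg (ws n) f + avg (ws n) g)).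
  exact: cvgD.
by apply/funext => n; rewrite avgD.
Qed.

Lemma avg_cvgZ a f : avg_cvg f -> avg_cvg (fun y => a * f y).
Proof.
move=> [l fl]; exists (a * l).
rewrite (_ : (fun n => avg (ws n) _) = (fun n => a * avg (ws n) f)).
  exact: cvgMl_tmp.
by apply/funext => n; rewrite avgZ.
Qed.

Lemma avg_cvg_uniform f :
  (forall e, 0 < e -> exists2 g, avg_cvg g &
     forall y, 0 <= y <= 1 -> `|f y - g y| <= e) -> avg_cvg f.
Proof.
move=> H; apply: cvg_approx => e e0.
have [|g [l gl] fg] := H (e / 2); first by rewrite divr_gt0.
exists l; near=> n.
have [s0 us] : (0 < size (ws n))%N /\ unit_seq (ws n) by near: n.
have h1 : `|l - avg (ws n) g| < e / 2.
  by near: n; move/cvgrPdist_lt: gl; apply; rewrite divr_gt0.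
have h2 : avg (ws n) f <= avg (ws n) g + e / 2.
  rewrite -[X in _ + X](avg_cst _ s0) -avgD; apply: ler_avg => y /us /fg.
  by rewrite ler_norml; lra.
have h3 : avg (ws n) g - e / 2 <= avg (ws n) f.
  rewrite -[X in _ - X](avg_cst _ s0) -avgB; apply: ler_avg => y /us /fg.
  by rewrite ler_norml; lra.
by move: h1; rewrite !ltr_norml; lra.
Unshelve. all: by end_near. Qed.

(** For a = cauchyk t y and b = cauchyk (t + h) y: the derivative of the k-th
    power of a Cauchy kernel with respect to t is - k times its (k+1)-st power,
    with an explicit error, uniform in y. *)
Lemma power_diff_quotient (a b h : R) k : 0 <= b -> b <= a -> a <= 1 -> 0 <= h ->
  a - b = h * (a * b) ->
  `|(a ^+ k - b ^+ k) - h * (k%:R * a ^+ k.+1)| <= k%:R ^+ 2 * h ^+ 2.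
Proof.
move=> b0 ba a1 h0 E; have a0 : 0 <= a by apply: le_trans ba.
have ab1 : a * b <= 1 by rewrite mulr_ile1 // (le_trans ba).
have ab0 : 0 <= a * b by rewrite mulr_ge0.
have pw j : 0 <= a ^+ j - b ^+ j <= j%:R * h.
  elim: j => [|j /andP[IH1 IH2]]; first by rewrite !expr0 subrr mul0r lexx.
  have -> : a ^+ j.+1 - b ^+ j.+1 = a * (a ^+ j - b ^+ j) + b ^+ j * (h * (a * b)).
    by rewrite -E !exprS; ring.
  have bj0 : 0 <= b ^+ j by rewrite exprn_ge0.
  have bj1 : b ^+ j <= 1 by rewrite exprn_ile1 // (le_trans ba).
  have hab : 0 <= h * (a * b) by rewrite mulr_ge0.
  have hab1 : h * (a * b) <= h by rewrite ler_piMr.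
  rewrite addr_ge0 ?mulr_ge0 //= -natr1 mulrDl mul1r; apply: lerD.
    by apply: le_trans IH2; rewrite ler_piMl.
  by apply: le_trans hab1; rewrite ler_piMl.
elim: k => [|k IH].
  by rewrite !expr0 subrr mul0r mulr0 subr0 normr0 mulr_ge0 // sqr_ge0.
have -> : a ^+ k.+1 - b ^+ k.+1 - h * (k.+1%:R * a ^+ k.+2) =
    a * (a ^+ k - b ^+ k - h * (k%:R * a ^+ k.+1)) - h * a * (a ^+ k.+1 - b ^+ k.+1).
  have {1}-> : b ^+ k.+1 = b ^+ k * (a - h * (a * b)) by rewrite exprSr -E; ring.
  rewrite -natr1 !exprS; ring.
have /andP[p0 p1] := pw k.+1.
apply: le_trans (ler_normB _ _) _; rewrite !normrM (ger0_norm a0) (ger0_norm h0) (ger0_norm p0).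
have h1 : a * `|a ^+ k - b ^+ k - h * (k%:R * a ^+ k.+1)| <= k%:R ^+ 2 * h ^+ 2.
  by apply: le_trans IH; rewrite ler_piMl.
have h2 : h * a * (a ^+ k.+1 - b ^+ k.+1) <= h * (k.+1%:R * h).
  rewrite -mulrA ler_wpM2l //; apply: le_trans p1; rewrite ler_piMl //.
have hh : 0 <= h ^+ 2 by rewrite sqr_ge0.
have kh : 0 <= k%:R * h ^+ 2 by rewrite mulr_ge0.
rewrite -natr1 in h2 *; lra.
Qed.

Lemma avg_cvg_cauchyk_pow (t0 : R) : 1 <= t0 ->
  (forall t, t0 <= t -> avg_cvg (cauchyk t)) ->
  forall k t, t0 <= t -> avg_cvg (fun y => cauchyk t y ^+ k.+1).
Proof.
move=> t01 H; elim=> [|k IH] t tt; first exact: H.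
apply: avg_cvg_uniform => e e0.
have k0 : 0 < k.+1%:R :> R by [].
pose h : R := e / k.+1%:R.
have h0 : 0 < h by rewrite divr_gt0.
exists (fun y => (h * k.+1%:R)^-1 * (cauchyk t y ^+ k.+1 - cauchyk (t + h) y ^+ k.+1)).
  apply: avg_cvgZ; under eq_fun do rewrite -[X in _ - X]mul1r -mulNr.
  by apply: avg_cvgD; [exact: IH|apply: avg_cvgZ; apply: IH; lra].
move=> y y01.
have tp : 0 < t by lra.
have thp : 0 < t + h by lra.
have b0 := cauchyk_ge0 thp y01.
have ba : cauchyk (t + h) y <= cauchyk t y by apply: cauchyk_nonincr => //; lra.
have a1 : cauchyk t y <= 1.
  apply: le_trans (cauchyk_le1 tp y01); rewrite ler_peMl ?cauchyk_ge0 //; lra.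
have E : cauchyk t y - cauchyk (t + h) y = h * (cauchyk t y * cauchyk (t + h) y).
  by rewrite cauchyk_sub //; ring.
have := power_diff_quotient k.+1 b0 ba a1 (ltW h0) E.
move: (cauchyk t y) (cauchyk (t + h) y) => a b D.
have hk : 0 < h * k.+1%:R by rewrite mulr_gt0.
rewrite distrC.
have -> : (h * k.+1%:R)^-1 * (a ^+ k.+1 - b ^+ k.+1) - a ^+ k.+2 =
  (h * k.+1%:R)^-1 * (a ^+ k.+1 - b ^+ k.+1 - h * (k.+1%:R * a ^+ k.+2)).
  by field; rewrite !gt_eqF.
rewrite normrM gtr0_norm ?invr_gt0 // ler_pdivrMl //; apply: le_trans D _.
rewrite le_eqVlt; apply/orP; left; apply/eqP.
rewrite /h; field; rewrite gt_eqF //.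
Qed.

Lemma avg_cvg_horner (t : R) (p : {poly R}) :
  (forall k, avg_cvg (fun y => cauchyk t y ^+ k.+1)) ->
  avg_cvg (fun y => p.[cauchyk t y]).
Proof.
move=> H.
have : forall m, avg_cvg (fun y => \sum_(i < m) p`_i * cauchyk t y ^+ i).
  elim=> [|m IH]; first by under eq_fun do rewrite big_ord0; exact: avg_cvg_cst.
  under eq_fun do rewrite big_ord_recr; apply: avg_cvgD => //=.
  apply: avg_cvgZ; case: m {IH} => [|m] //.
  by under eq_fun do rewrite expr0; exact: avg_cvg_cst.
by move=> /(_ (size p)); under [X in _ -> avg_cvg X]eq_fun do rewrite horner_coef.
Qed.

(** The iteration p + (u^2 - p^2) / 2, which converges to |u| uniformly on
    [-1, 1]. *)
Fixpoint abs_poly (u : {poly R}) (k : nat) : {poly R} :=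
  if k is j.+1 then
    abs_poly u j + 2^-1 *: (u * u - abs_poly u j * abs_poly u j)
  else 0.

(** The error d_j = |u| - p_j satisfies d_(j+1) = d_j (1 - (|u| + p_j) / 2), from
    which d_j (1 + j |u| / 2) <= |u| follows by induction. *)
Lemma abs_poly_approx (u : {poly R}) (x : R) k : `|u.[x]| <= 1 ->
  `| `|u.[x]| - (abs_poly u k.+1).[x] | <= 2 / k.+1%:R.
Proof.
move=> u1; set v := `|u.[x]|.
have v0 : 0 <= v by exact: normr_ge0.
have vv : u.[x] * u.[x] = v * v by rewrite -normrM ger0_norm // -expr2 sqr_ge0.
have key j : [/\ 0 <= (abs_poly u j).[x], (abs_poly u j).[x] <= v &
    (v - (abs_poly u j).[x]) * (1 + j%:R * (v / 2)) <= v].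
  elim: j => [|j [p0 pv pk]] /=.
    by rewrite horner0 subr0 mul0r addr0 mulr1.
  rewrite hornerD hornerZ hornerD hornerN !hornerM vv; move: pk p0 pv; set p := (abs_poly u j).[x].
  move=> pk p0 pv.
  have d0 : 0 <= v - p by rewrite subr_ge0.
  have vp2 : v + p <= 2 by rewrite /v /p in pv u1 *; lra.
  split.
  - have : p * p <= v * v by rewrite ler_pM.
    lra.
  - have -> : p + 2^-1 * (v * v - p * p) = v - (v - p) * (1 - (v + p) / 2) by field.
    by rewrite lerBlDr lerDl mulr_ge0 //; lra.
  - have -> : v - (p + 2^-1 * (v * v - p * p)) = (v - p) * (1 - (v + p) / 2) by field.
    have w0 : 0 <= v / 2 by rewrite divr_ge0.
    have jw : 0 <= j%:R * (v / 2) by rewrite mulr_ge0.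
    apply: le_trans pk.
    suff : (1 - (v + p) / 2) * (1 + j.+1%:R * (v / 2)) <= 1 + j%:R * (v / 2).
      by move=> /(ler_wpM2l d0); rewrite [X in X <= _]mulrA.
    rewrite -[j.+1%:R]natr1.
    have c0 : 0 <= 1 + (j%:R + 1) * (v / 2) by lra.
    have c1 : (1 - (v + p) / 2) * (1 + (j%:R + 1) * (v / 2)) <=
           (1 - v / 2) * (1 + (j%:R + 1) * (v / 2)).
      by rewrite ler_wpM2r //; lra.
    have : 0 <= v / 2 * ((j%:R + 1) * (v / 2)) by rewrite !mulr_ge0 // addr_ge0.
    lra.
have [p0 pv pk] := key k.+1.
rewrite ger0_norm ?subr_ge0 //.
have d0 : 0 <= v - (abs_poly u k.+1).[x] by rewrite subr_ge0.
move: d0 pk; set d := v - _ => d0 pk.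
have [v00|vn0] := eqVneq v 0.
  have -> : d = 0 by apply/eqP; rewrite eq_le d0 andbT /d lerBlDr v00 add0r.
  by rewrite divr_ge0.
have vp : 0 < v by rewrite lt_def vn0.
rewrite ler_pdivlMr // -(ler_pM2r vp).
have : d * (k.+1%:R * (v / 2)) <= v.
  by apply: le_trans pk; rewrite ler_wpM2l // lerDr.
lra.
Qed.

(** Differences of distances to fixed points are the ramps with which zeros will
    be counted. *)
Theorem avg_cvg_dist (t0 a : R) : 1 <= t0 ->
  (forall t, t0 <= t -> avg_cvg (cauchyk t)) -> 0 <= a <= 1 ->
  avg_cvg (fun y => `|cauchyk t0 y - a|).
Proof.
move=> t01 H a01; apply: avg_cvg_uniform => e e0.
have := avg_cvg_cauchyk_pow t01 H => /(_ _ t0 (lexx _)) pw.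
pose k := Num.truncn (2 / e).
exists (fun y => (abs_poly ('X - a%:P) k.+1).[cauchyk t0 y]).
  exact: avg_cvg_horner.
move=> y y01; have tp : 0 < t0 by lra.
have x0 := cauchyk_ge0 tp y01.
have x1 : cauchyk t0 y <= 1.
  by apply: le_trans (cauchyk_le1 tp y01); rewrite ler_peMl.
have := @abs_poly_approx ('X - a%:P) (cauchyk t0 y) k.
rewrite hornerXsubC => /(_ _)/le_trans; apply.
  by rewrite ler_norml; lra.
rewrite ler_pdivrMr // mulrC -ler_pdivrMr // ltW //.
by have := truncnS_gt (2 / e).
Qed.

End AvgCvg.

(** * Continuous functions on the extended half-line *)

Section ReciprocalKernel.
Context {R : realType}.
Implicit Types (a t r : R) (z : \bar R).

(** The value 0 at minus infinity makes it continuous on the extended half-line;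
    the value 0 above a keeps it bounded everywhere. kern a 1 is the coordinate
    in which zeros are encoded. *)
Definition kern a t z : R :=
  if z is r%:E then (if r <= a then (a + t - r)^-1 else 0) else 0.

Lemma kern_fin a t r : r <= a -> kern a t r%:E = (a + t - r)^-1.
Proof. by rewrite /kern => ->. Qed.

Lemma kern01 a t z : 1 <= t -> 0 <= kern a t z <= 1.
Proof.
move=> t1; rewrite /kern; case: z => [r| |]; rewrite ?lexx ?ler01 //.
case: ifPn => ra; last by rewrite lexx ler01.
have d1 : 1 <= a + t - r by lra.
by rewrite invr_ge0 invf_le1 //; [rewrite d1 andbT; lra|lra].
Qed.

Lemma lower_rayP a z : lower_ray a z -> z = -oo%E \/ exists2 r, z = r%:E & r <= a.
Proof.
rewrite /lower_ray /=; case: z => [r| |] //; last by left.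
by rewrite lee_fin => ra; right; exists r.
Qed.

Lemma cauchyk_kern a t z : 0 < t -> lower_ray a z ->
  cauchyk t (kern a 1 z) = kern a t z.
Proof.
move=> t0 /lower_rayP[->|[r -> ra]]; first by rewrite /cauchyk mul0r.
rewrite !kern_fin // /cauchyk; have d1 : 0 < a + 1 - r by lra.
have d2 : 0 < a + t - r by lra.
by field; rewrite !gt_eqF //; lra.
Qed.

Lemma kern_continuous a t : 0 < t -> {within lower_ray a, continuous (kern a t)}.
Proof.
move=> t0; apply/subspace_continuousP => z; rewrite /from_subspace.
move=> /lower_rayP[->|[r -> ra]].
  rewrite -[X in _ --> X]/(0 : R); apply/cvgrPdist_lt => e e0.
  rewrite /nbhs /= /ereal_nbhs /=; exists (a + t - e^-1); split; first exact: num_real.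
  move=> y yM /lower_rayP[->|[s ys sa]]; first by rewrite /kern subr0 normr0.
  move: yM; rewrite ys lte_fin kern_fin // => sM.
  have d : e^-1 < a + t - s by lra.
  have d0 : 0 < a + t - s by apply: lt_trans d; rewrite invr_gt0.
  rewrite sub0r normrN gtr0_norm ?invr_gt0 // -[ltRHS]invrK.
  by rewrite ltf_pV2 ?posrE ?invr_gt0.
rewrite kern_fin //.
have H : (a + t - s)^-1 @[s --> r] --> (a + t - r)^-1.
  apply: cvgV; first by rewrite gt_eqF //; lra.
  by apply: cvgB; [exact: cvg_cst|exact: cvg_id].
move=> V /H HV.
have {}HV : nbhs r (fun s => V (a + t - s)^-1) := HV.
change (nbhs r (fun s => lower_ray a s%:E -> V (kern a t s%:E))).
apply: filterS HV => s Vs /lower_rayP[//|[s' [<-] sa]].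
by rewrite kern_fin.
Qed.

End ReciprocalKernel.

Section WithinLowerRay.
Context {R : realType}.
Variables (a : R) (f : \bar R -> R).
Hypothesis cf : {within lower_ray a, continuous f}.

Lemma within_lower_ray_comp (g : R -> R) :
  (forall z, lower_ray a z -> {for f z, continuous g}) ->
  {within lower_ray a, continuous (g \o f)}.
Proof.
move=> cg; apply/subspace_continuousP => z az.
by apply: (cvg_comp (f : _ -> _) g); [exact: (subspace_continuousP _ _).1|exact: cg].
Qed.

Lemma within_lower_ray_cvg (u : nat -> \bar R) z :
  lower_ray a z -> (\forall n \near \oo, lower_ray a (u n)) -> u n @[n --> \oo] --> z ->
  f (u n) @[n --> \oo] --> f z.
Proof.
move=> az au uz V fV.
have /(_ V fV) := (subspace_continuousP _ _).1 cf z az.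
move=> H; have {}H : nbhs z (fun y => lower_ray a y -> V (f y)) := H.
have {}H : \forall n \near \oo, lower_ray a (u n) -> V (f (u n)) := uz _ H.
change (\forall n \near \oo, V (f (u n))).
by apply: filterS2 au H => n h; apply.
Qed.

Lemma within_EFin : {within `]-oo, a]%classic, continuous (f \o EFin)}.
Proof.
apply/subspace_continuousP => r ra V fV.
have az : lower_ray a r%:E by move: ra; rewrite /= in_itv /lower_ray /= lee_fin.
have /(_ V fV) := (subspace_continuousP _ _).1 cf _ az.
move=> H; have {}H : nbhs r (fun s => lower_ray a s%:E -> V (f s%:E)) by exact: H.
change (nbhs r (fun s => `]-oo, a]%classic s -> V (f s%:E))).
apply: filterS H => s H sa; apply: H.
by move: sa; rewrite /= in_itv /lower_ray /= lee_fin.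
Qed.

Lemma measurable_lower_ray : measurable (lower_ray a).
Proof.
have -> : lower_ray a = [set` `]-oo, a%:E]].
  by apply/seteqP; split => z /=; rewrite /lower_ray /= in_itv.
exact: emeasurable_itv.
Qed.

Lemma within_lower_ray_measurable : measurable_fun (lower_ray a) f.
Proof.
have mh : measurable_fun `]-oo, a]%classic (f \o EFin).
  by apply: subspace_continuous_measurable_fun => //; exact: within_EFin.
move=> _ Y mY.
have -> : lower_ray a `&` f @^-1` Y =
   ([set -oo%E] `&` (fun=> Y (f -oo%E))) `|`
   EFin @` (`]-oo, a]%classic `&` (f \o EFin) @^-1` Y).
  apply/seteqP; split => z /=.
    move=> [/lower_rayP[->|[r -> ra]] Yz]; first by left.
    by right; exists r => //; split => //=; rewrite in_itv.
  move=> [[-> Yz]|[r [ra Yr] <-]]; first by split => //; rewrite /lower_ray /= leNye.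
  by split => //; move: ra; rewrite /= in_itv /lower_ray /= lee_fin.
apply: measurableU; last first.
  by apply: measurable_image_EFin; apply: mh.
apply: measurableI; first exact: emeasurable_set1.
have [yY|nY] := pselect (Y (f -oo%E)).
  by rewrite (_ : (fun=> _) = setT) //; apply/seteqP; split.
by rewrite (_ : (fun=> _) = set0) //; apply/seteqP; split.
Qed.

(** Near minus infinity f is close to its value there, and the rest of the
    half-line is a compact segment. *)
Lemma within_lower_ray_bounded : exists2 M, 0 < M & forall z, lower_ray a z -> `|f z| <= M.
Proof.
have aN : lower_ray a -oo%E by rewrite /lower_ray /= leNye.
have /cvgrPdist_lt/(_ 1 ltr01) H := (subspace_continuousP _ _).1 cf _ aN.
have {H} : nbhs (-oo%E : \bar R) (fun y => lower_ray a y -> `|f -oo%E - f y| < 1) := H.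
case=> m [_ Hm].
pose b := Num.min (m - 1) a.
have bm1 : b <= m - 1 by rewrite ge_min lexx.
have bm : b < m by lra.
have ba : b <= a by rewrite ge_min lexx orbT.
have cb : {within `[b, a]%classic, continuous (f \o EFin)}.
  apply: continuous_subspaceW within_EFin => r /=; rewrite !in_itv /=.
  by case/andP.
have cb' : {within `[b, a]%classic, continuous (fun r => `|(f \o EFin) r|)}.
  move=> r; apply: (@continuous_comp _ _ _ (f \o EFin : subspace _ -> R) Num.norm).
    exact: cb.
  exact: norm_continuous.
have [c _ Hc] := EVT_max ba cb'.
exists (`|f -oo%E| + 1 + `|f c%:E|); first by rewrite ltr_pwDl ?ltr_pwDr.
move=> z /lower_rayP[->|[r -> ra]].
  by rewrite -addrA lerDl addr_ge0.
have [rb|br] := ltP r b.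
  have : `|f -oo%E - f r%:E| < 1.
    by apply: Hm; [rewrite lte_fin; lra|rewrite /lower_ray /= lee_fin].
  have := normr_ge0 (f c%:E).
  have := lerB_dist (f r%:E) (f -oo%E); rewrite [ `|f r%:E - _|]distrC; lra.
apply: le_trans (Hc r _) _; first by rewrite in_itv /= br.
by rewrite lerDr addr_ge0.
Qed.

Lemma within_lower_ray_integrable (mu : {measure set (\bar R) -> \bar R}) :
  (mu (lower_ray a) < +oo)%E -> mu.-integrable (lower_ray a) (EFin \o f).
Proof.
move=> muoo; have [M M0 HM] := within_lower_ray_bounded.
apply: measurable_bounded_integrable => //.
- exact: measurable_lower_ray.
- exact: within_lower_ray_measurable.
- exists M; split; first exact: num_real.
  by move=> x Mx z az /=; apply: le_trans (HM z az) (ltW Mx).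
Qed.

End WithinLowerRay.

(** * Zeros as a list of extended reals *)

Lemma avg_map (R : realType) (S T : Type) (k : S -> T) (s : seq S) (f : T -> R) :
  avg (map k s) f = avg s (f \o k).
Proof. by rewrite /avg size_map big_map. Qed.

Section Zeros.
Context {R : realType}.
Implicit Types (P : {poly R}) (a : R).

(** Completing by minus infinity gives all these lists the length n, so that the
    empirical measure is a plain average over them. *)
Definition zero_list (n : nat) P : seq (\bar R) :=
  map EFin (real_zeros P) ++ nseq (n - (size P).-1) -oo%E.

Lemma real_rooted_factor a P : P != 0 -> real_rooted_le a P ->
  P = lead_coef P *: \prod_(r <- real_zeros P) ('X - r%:P) /\
  {in real_zeros P, forall r, r <= a}.
Proof.
move=> P0 rP; rewrite /real_zeros /complex_zeros.
case: closed_field_poly_normal => s /= Es.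
have lc : lead_coef (complexify P) = (lead_coef P)%:C%C by rewrite lead_coef_map.
have lc0 : lead_coef (complexify P) != 0.
  by rewrite lead_coef_eq0 map_poly_eq0.
have sP z : z \in s -> complex.Im z = 0 /\ complex.Re z <= a.
  move=> zs; have [|x -> xa] := rP z; last by split.
  by rewrite Es rootZ // root_prod_XsubC.
have -> : [seq z <- s | complex.Im z == 0] = s.
  by apply/all_filterP/allP => z /sP[-> _]; rewrite eqxx.
split; last by move=> r /mapP[z /sP[_ za] ->].
apply: (@map_poly_inj _ _ (real_complex R)).
rewrite -/(complexify P) Es map_polyZ /= lc rmorph_prod /= big_map; congr (_ *: _).
rewrite big_seq [RHS]big_seq; apply: eq_bigr => z /sP[zi _].
rewrite map_polyXsubC /=; congr ('X - _%:P).
by case: z zi => x y /= ->.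
Qed.

Lemma size_real_zeros a P : P != 0 -> real_rooted_le a P ->
  size (real_zeros P) = (size P).-1.
Proof.
move=> P0 rP; have [E _] := real_rooted_factor P0 rP.
rewrite [in RHS]E size_scale ?lead_coef_eq0 //.
by rewrite size_prod_XsubC.
Qed.

Lemma size_zero_list n a P : P != 0 -> real_rooted_le a P -> (size P <= n.+1)%N ->
  size (zero_list n P) = n.
Proof.
move=> P0 rP sP; rewrite size_cat size_map size_nseq (size_real_zeros P0 rP).
by rewrite subnKC // -ltnS (leq_trans _ sP) // prednK // size_poly_gt0.
Qed.

Lemma zero_list_lower_ray n a P : P != 0 -> real_rooted_le a P ->
  {in zero_list n P, forall z, lower_ray a z}.
Proof.
move=> P0 rP z; have [_ ra] := real_rooted_factor P0 rP.
rewrite mem_cat => /orP[/mapP[r rs ->]|/nseqP[-> _]]; rewrite /lower_ray /=.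
  by rewrite lee_fin; apply: ra.
exact: leNye.
Qed.

Lemma comp_shift_pgf n a P : P != 0 -> real_rooted_le a P ->
  exists2 c, c != 0 & P \Po ('X + a%:P) = c *: pgf (map (kern a 1) (zero_list n P)).
Proof.
move=> P0 rP; have [E ra] := real_rooted_factor P0 rP.
rewrite /zero_list; move: (real_zeros P) E ra => s E ra.
exists (lead_coef P * \prod_(r <- s) (a + 1 - r)).
  rewrite mulf_neq0 ?lead_coef_eq0 // prodf_seq_neq0; apply/allP => r /ra ra1.
  by apply/implyP => _; rewrite gt_eqF //; lra.
rewrite [in LHS]E comp_polyZ -scalerA; congr (_ *: _).
rewrite /pgf map_cat big_cat /= [X in _ * X]big1_seq ?mulr1; last first.
  move=> y /=; rewrite map_nseq => /nseqP[-> _].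
  by rewrite subr0 scale0r addr0.
rewrite !big_map rmorph_prod -scaler_prod big_seq [RHS]big_seq.
apply: eq_bigr => r /ra ra1.
rewrite [kern _ _ _]kern_fin //= comp_polyB comp_polyX comp_polyC scalerDr scalerA.
have d : a + 1 - r != 0 by rewrite gt_eqF //; lra.
rewrite mulfV // scale1r -mul_polyC -polyCM -addrA -polyCB addrC; congr (_%:P + _).
by rewrite mulrBr mulr1 mulfV //; ring.
Qed.

Let ge0_integral_empirical n a P (f : \bar R -> \bar R) : P != 0 ->
  real_rooted_le a P ->
  measurable_fun (lower_ray a) f -> (forall z, lower_ray a z -> 0 <= f z)%E ->
  (\int[empirical_zeros n P]_(z in lower_ray a) f z =
   (n%:R^-1)%:E * (\sum_(r <- real_zeros P) f r%:E +
   ((n - (size P).-1)%:R)%:E * f -oo))%E.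
Proof.
move=> P0 rP mf f0; have mS := measurable_lower_ray a.
have [_ ra] := real_rooted_factor P0 rP.
rewrite /empirical_zeros ge0_integral_measure_add // !ge0_integral_mscale //.
rewrite ge0_integral_measure_sum // integral_dirac // diracE mem_set; last first.
  by rewrite /lower_ray /= leNye.
rewrite mul1e ge0_muleDr; last 2 first.
- rewrite big_seq; apply: sume_ge0 => r /ra ra1; apply: f0.
  by rewrite /lower_ray /= lee_fin.
- by rewrite mule_ge0 // ?lee_fin // f0 // /lower_ray /= leNye.
congr (_ + _)%E; last first.
  by rewrite [RHS]muleA -EFinM; congr (_%:E * _)%E; rewrite [RHS]mulrC.
congr (_ * _)%E; rewrite (big_nth 0) big_mkord; apply: eq_bigr => i _.
rewrite integral_dirac // diracE mem_set ?mul1e //.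
by rewrite /lower_ray /= lee_fin; apply: ra; exact: mem_nth.
Qed.

Lemma Rintegral_empirical n a P (f : \bar R -> R) : (0 < n)%N -> P != 0 ->
  (size P <= n.+1)%N -> real_rooted_le a P ->
  {within lower_ray a, continuous f} ->
  \int[empirical_zeros n P]_(z in lower_ray a) f z = avg (zero_list n P) f.
Proof.
move=> n0 P0 sP rP cf; have mf := within_lower_ray_measurable cf.
have mE : measurable_fun (lower_ray a) (EFin \o f) by apply/measurable_EFinP.
rewrite /Rintegral integralE.
rewrite (ge0_integral_empirical n P0 rP (measurable_funepos mE)) //.
rewrite (ge0_integral_empirical n P0 rP (measurable_funeneg mE)) //.
rewrite /avg (size_zero_list P0 rP sP) /zero_list big_cat /= big_map.
have Ep z : (EFin \o f)^\+%E z = (Num.max (f z) 0)%:E.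
  by rewrite funeposE EFin_max.
have En z : (EFin \o f)^\-%E z = (Num.max (- f z) 0)%:E.
  by rewrite funenegE EFin_max.
have mx (x : R) : Num.max x 0 - Num.max (- x) 0 = x.
  by rewrite /Num.max; case: (ltP x 0) => ?; case: (ltP (- x) 0) => ?; lra.
under eq_bigr do rewrite Ep; under [X in (_ - _ * (X + _))%E]eq_bigr do rewrite En.
rewrite (Ep -oo%E) (En -oo%E) !sumEFin -!EFinM -EFinB /= -mulrBr; congr (_ * _).
rewrite opprD addrACA -sumrB -mulrBr mx; congr (_ + _).
  by apply: eq_bigr => r _; rewrite mx.
by rewrite big_nseq iter_addr_0 mulr_natl.
Qed.

End Zeros.

(** * Counting zeros with ramps *)

Lemma cvge_sandwich (R : realType) (u : nat -> \bar R) (l : \bar R) :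
  (forall x : R, (x%:E < l)%E -> \forall n \near \oo, (x%:E <= u n)%E) ->
  (forall y : R, (l < y%:E)%E -> \forall n \near \oo, (u n <= y%:E)%E) ->
  u n @[n --> \oo] --> l.
Proof.
case: l => [r| |] lo hi V.
- move=> rV; have {rV} : nbhs r (fun s => V s%:E) := rV.
  move=> /nbhs_ballP[e /= e0 eV].
  have lo' : \forall n \near \oo, ((r - e / 2)%:E <= u n)%E by apply: lo; rewrite lte_fin; lra.
  have hi' : \forall n \near \oo, (u n <= (r + e / 2)%:E)%E by apply: hi; rewrite lte_fin; lra.
  change (\forall n \near \oo, V (u n)).
  apply: filterS2 lo' hi' => n.
  case: (u n) => [s| |] //; rewrite !lee_fin => h1 h2; apply: eV.
  by rewrite /ball /= ltr_norml; lra.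
- case=> m [_ mV]; have lo' := lo (m + 1) (ltry _).
  change (\forall n \near \oo, V (u n)).
  apply: filterS lo' => n h; apply: mV; apply: lt_le_trans h.
  by rewrite lte_fin ltrDl.
- case=> m [_ mV]; have hi' := hi (m - 1) (ltNyr _).
  change (\forall n \near \oo, V (u n)).
  apply: filterS hi' => n h; apply: mV; apply: le_lt_trans h _.
  by rewrite lte_fin ltrBlDr ltrDl.
Qed.

Lemma avg_perm (R : realType) (T : eqType) (s s' : seq T) (f : T -> R) :
  perm_eq s s' -> avg s f = avg s' f.
Proof. by move=> ss'; rewrite /avg (perm_size ss') (perm_big _ ss'). Qed.

Section Ramp.
Context {R : realType}.
Variables (a T : R).
Hypothesis T1 : 1 <= T.
Implicit Types (p q : R) (z : \bar R).

(** It decreases from 1 below p to 0 above q, and is built from distances to two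
    points in the coordinate kern, so its averages converge by avg_cvg_dist. *)
Definition ramp p q z : R :=
  2^-1 - (2 * (kern a T q%:E - kern a T p%:E))^-1 *
    (`|kern a T z - kern a T p%:E| - `|kern a T z - kern a T q%:E|).

Lemma kern_homo z z' : (z <= z')%E -> (z' <= a%:E)%E -> kern a T z <= kern a T z'.
Proof.
have T1' := T1; case: z => [r| |]; case: z' => [r'| |] //; rewrite ?lee_fin //.
  move=> rr' r'a; rewrite !kern_fin ?(le_trans rr') //.
  by rewrite lef_pV2 ?posrE; lra.
by move=> _ r'a; rewrite kern_fin // invr_ge0; lra.
Qed.

Lemma kern_lt p q : p < q -> q <= a -> kern a T p%:E < kern a T q%:E.
Proof.
have T1' := T1; move=> pq qa; rewrite !kern_fin //; last by lra.
by rewrite ltf_pV2 ?posrE; lra.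
Qed.

Lemma ramp01 p q z : p < q -> q <= a -> 0 <= ramp p q z <= 1.
Proof.
move=> pq qa; have := kern_lt pq qa; rewrite /ramp -subr_gt0.
move: (kern a T z) (kern a T p%:E) (kern a T q%:E) => k x y xy.
set d := `|k - x| - `|k - y|.
have : `|d| <= y - x.
  by rewrite -[leRHS]gtr0_norm // [leRHS](_ : _ = `|(k - x) - (k - y)|) ?ler_dist_dist //; congr `|_|; ring.
rewrite ler_norml => /andP[d1 d2].
have y20 : 0 < 2 * (y - x) by rewrite mulr_gt0.
have h1 : (2 * (y - x))^-1 * d <= 2^-1 by rewrite ler_pdivrMl //; lra.
have h2 : - 2^-1 <= (2 * (y - x))^-1 * d by rewrite ler_pdivlMl //; lra.
by apply/andP; split; lra.
Qed.

Lemma ramp_low p q z : p < q -> q <= a -> (z <= p%:E)%E -> ramp p q z = 1.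
Proof.
move=> pq qa zp; have := kern_lt pq qa; rewrite /ramp.
have := kern_homo zp; rewrite lee_fin => /(_ (le_trans (ltW pq) qa)).
move: (kern a T z) (kern a T p%:E) (kern a T q%:E) => k x y kx xy.
rewrite ler0_norm ?subr_le0 // ler0_norm; last by lra.
by field; lra.
Qed.

Lemma ramp_high p q z : p < q -> q <= a -> (q%:E <= z)%E -> (z <= a%:E)%E ->
  ramp p q z = 0.
Proof.
move=> pq qa zq za; have := kern_lt pq qa; rewrite /ramp.
have := kern_homo zq za.
move: (kern a T z) (kern a T p%:E) (kern a T q%:E) => k x y ky xy.
rewrite ger0_norm; last by lra.
rewrite ger0_norm ?subr_ge0 //.
by field; lra.
Qed.

Lemma avg_ramp_ge (s : seq (\bar R)) j p q : p < q -> q <= a ->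
  sorted <=%O s -> (j < size s)%N -> (nth -oo%E s j <= p%:E)%E ->
  j.+1%:R <= (size s)%:R * avg s (ramp p q).
Proof.
move=> pq qa ss js jp; rewrite size_mul_avg (big_nth -oo%E).
rewrite (big_cat_nat _ (n := j.+1)) //= -[leLHS]addr0; apply: lerD; last first.
  by apply: sumr_ge0 => i _; case/andP: (ramp01 (nth -oo%E s i) pq qa).
rewrite [leRHS](eq_big_nat _ _ (F2 := fun=> 1)) ?sumr_const_nat ?subn0 //.
move=> i /andP[_ ij]; apply: ramp_low => //; apply: le_trans jp.
have := le_sorted_leq_nth -oo%E ss; apply => //.
by rewrite inE (leq_ltn_trans _ js).
Qed.

Lemma avg_ramp_le (s : seq (\bar R)) j p q : p < q -> q <= a ->
  sorted <=%O s -> {in s, forall z, (z <= a%:E)%E} ->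
  (j < size s)%N -> (q%:E <= nth -oo%E s j)%E ->
  (size s)%:R * avg s (ramp p q) <= j%:R.
Proof.
move=> pq qa ss sa js jq; rewrite size_mul_avg (big_nth -oo%E).
rewrite (big_cat_nat _ (n := j)) //=; last exact: ltnW.
rewrite [X in _ + X]big_nat_cond [X in _ + X]big1 ?addr0.
  apply: le_trans (ler_sum _ (G := fun=> 1) _) _; last by rewrite sumr_const_nat subn0.
  by move=> i _; case/andP: (ramp01 (nth -oo%E s i) pq qa).
move=> i /andP[/andP[ji si] _]; apply: ramp_high => //.
  apply: le_trans jq _; have := le_sorted_leq_nth -oo%E ss; apply => //.
by apply: sa; apply: mem_nth.
Qed.

End Ramp.

(** * The limit measure *)

Section UniformUnit.
Context {R : realType}.

Definition uniform01 : probability (measurableTypeR R) R :=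
  uniform_prob (@ltr01 R).

Lemma uniform01_itv (x y : R) : 0 <= x -> x <= y -> y <= 1 ->
  uniform01 `[x, y[%classic = (y - x)%:E.
Proof.
move=> x0 xy y1; rewrite /uniform01 /= /uniform_prob.
under eq_integral => u.
  rewrite inE /= in_itv /= => /andP[xu uy].
  rewrite /uniform_pdf (le_trans x0 xu) (le_trans (ltW uy) y1) subr0 invr1.
  over.
rewrite (integral_cst _ _ 1%E) // mul1e [LHS](lebesgue_measure_itv `[x, y[) /= lte_fin.
by case: ltP => [_|yx]; [rewrite EFinB|rewrite (le_anti (introT andP (conj xy yx))) subrr].
Qed.

Lemma uniform01_countable (C : set R) : countable C -> uniform01 C = 0%E.
Proof.
move=> cC; have mC : measurable C.
  by apply: countable_measurable cC => t; exact: measurable_set1.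
apply: (@dominates_uniform_prob R 0 1 ltr01 C _ C) => //.
move=> B mB BC; apply: countable_lebesgue_measure0.
exact: sub_countable (subset_card_le BC) cC.
Qed.

End UniformUnit.

(** The quantile functions of the lists converge outside the countable set of
    limits of ramp averages. The limit measure is the law of the limiting
    quantile function under the uniform distribution, and weak convergence is
    dominated convergence. *)
Section QuantileLimit.
Context {R : realType}.
Variables (a T : R) (zs : nat -> seq (\bar R)).
Hypothesis T1 : 1 <= T.
Hypothesis zsP : \forall n \near \oo,
  size (zs n) = n /\ {in zs n, forall z, (z <= a%:E)%E}.
Hypothesis kern_cvg : forall x : R, 0 <= x <= 1 ->
  exists l : R, avg (zs n) (fun z => `|kern a T z - x|) @[n --> \oo] --> l.

Let qs n : seq (\bar R) :=
  if (size (zs n) == n) && all (fun z => (z <= a%:E)%E) (zs n)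
  then sort <=%O (zs n) else nseq n -oo%E.

Let size_qs n : size (qs n) = n.
Proof.
rewrite /qs; case: ifP => [/andP[/eqP sn _]|_]; last by rewrite size_nseq.
by rewrite size_sort.
Qed.

Let qs_le n : {in qs n, forall z, (z <= a%:E)%E}.
Proof.
move=> z; rewrite /qs; case: ifP => [/andP[_ /allP za]|_].
  by rewrite mem_sort; exact: za.
by move=> /nseqP[-> _]; exact: leNye.
Qed.

Let sorted_qs n : sorted <=%O (qs n).
Proof.
rewrite /qs; case: ifP => _; first exact: sort_le_sorted.
by apply: (@path_sorted _ _ -oo%E); elim: n => //= n ->; rewrite lexx.
Qed.

Let avg_qs (f : \bar R -> R) : \forall n \near \oo, avg (qs n) f = avg (zs n) f.
Proof.
apply: filterS zsP => n [sn za]; apply: avg_perm; rewrite /qs sn eqxx /=.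
by rewrite (introT allP za) perm_sort.
Qed.

Let I (n i : nat) : set R := `[i%:R / n%:R, i.+1%:R / n%:R[%classic.

(* The n-th quantile function on [0, 1[, as a finite sum to make measurability
   immediate: 0 times -oo is 0. *)
Let Z (n : nat) (u : R) : \bar R :=
  (\sum_(i < n) (nth -oo%E (qs n) i * (\1_(I n i) u)%:E))%E.

Let I_disjoint n i j u : (0 < n)%N -> I n i u -> I n j u -> i = j.
Proof.
move=> n0; rewrite /I /= !in_itv /= => /andP[i1 i2] /andP[j1 j2].
have nR : 0 < n%:R :> R by rewrite ltr0n.
have := le_lt_trans i1 j2; have := le_lt_trans j1 i2.
rewrite !ltr_pM2r ?invr_gt0 // !ltr_nat !ltnS => ji ij.
by apply/eqP; rewrite eqn_leq ij ji.
Qed.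

Let ZE n j u : (j < n)%N -> I n j u -> Z n u = nth -oo%E (qs n) j.
Proof.
move=> jn Iu; rewrite /Z (bigD1 (Ordinal jn)) //= indicE mem_set // mule1.
rewrite big1 ?adde0 // => i ij; rewrite indicE memNset ?mule0 // => Iiu.
case/eqP: ij; apply: val_inj => /=; apply: I_disjoint Iiu Iu.
exact: leq_ltn_trans jn.
Qed.

Let D : set R := `[0, 1[%classic.

Let D_cover n u : (0 < n)%N -> D u -> exists2 j, (j < n)%N & I n j u.
Proof.
rewrite /D /= in_itv /= => n0 /andP[u0 u1].
have nR : 0 < n%:R :> R by rewrite ltr0n.
have un0 : 0 <= u * n%:R by rewrite mulr_ge0.
have /andP[h1 h2] := truncn_itv un0.
exists (Num.truncn (u * n%:R)).
  rewrite -(ltr_nat R); apply: le_lt_trans h1 _.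
  by rewrite -[ltRHS]mul1r ltr_pM2r.
by rewrite /I /= in_itv /= ler_pdivrMr // h1 ltr_pdivlMr.
Qed.

Let Z_lower n u : (0 < n)%N -> D u -> lower_ray a (Z n u).
Proof.
move=> n0 Du; have [j jn Iu] := D_cover n0 Du.
by rewrite (ZE jn Iu); apply: (@qs_le n); rewrite mem_nth ?size_qs.
Qed.

(* Limits of the averages of ramps with rational ends. *)
Let L (pq : rat * rat) : R :=
  lim (avg (zs n) (ramp a T (ratr pq.1) (ratr pq.2)) @[n --> \oo]).

Let L_cvg (pq : rat * rat) : ratr pq.1 < ratr pq.2 :> R -> ratr pq.2 <= a ->
  avg (qs n) (ramp a T (ratr pq.1) (ratr pq.2)) @[n --> \oo] --> L pq.
Proof.
case: pq => p q /= pq qa.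
suff [l Hl] : exists l : R, avg (zs n) (ramp a T (ratr p) (ratr q)) @[n --> \oo] --> l.
  rewrite /L /= (cvg_lim _ Hl) //; apply: cvg_trans Hl; apply: near_eq_cvg.
  by apply: filterS (avg_qs (ramp a T (ratr p) (ratr q))) => n ->.
have [l1 H1] := kern_cvg (kern01 a (ratr p)%:E T1).
have [l2 H2] := kern_cvg (kern01 a (ratr q)%:E T1).
pose c : R := (2 * (kern a T (ratr q)%:E - kern a T (ratr p)%:E))^-1.
exists (2^-1 - c * (l1 - l2)).
have H : 2^-1 - c * (avg (zs n) (fun z => `|kern a T z - kern a T (ratr p)%:E|) -
   avg (zs n) (fun z => `|kern a T z - kern a T (ratr q)%:E|)) @[n --> \oo] -->
   2^-1 - c * (l1 - l2).
  by apply: cvgB; [exact: cvg_cst|apply: cvgMl_tmp; exact: cvgB].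
apply: cvg_trans H; apply: near_eq_cvg; near=> n.
have [sn _] : size (zs n) = n /\ {in zs n, forall z, (z <= a%:E)%E} by near: n.
have n0 : (0 < size (zs n))%N by rewrite sn; near: n; exact: nbhs_infty_gt.
by rewrite -avgB -avgZ -(avg_cst 2^-1 n0) -avgB.
Unshelve. all: by end_near. Qed.

Let C : set R := range L.

Let C_countable : countable C.
Proof. exact: sub_countable (card_image_le _ _) (countableP _). Qed.

Let Zlim (u : R) : \bar R := limn_esup (fun n => Z n u).

(* If the quantiles at u do not converge, they are below p infinitely often and
   above q infinitely often for some rational p < q. The first makes the
   limiting average of the ramp at least u, the second makes it at most u. *)
Let Z_cvg u : D u -> ~ C u -> Z n u @[n --> \oo] --> Zlim u.
Proof.
move=> Du Cu.
suff [l H] : exists l : \bar R, Z n u @[n --> \oo] --> l.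
  by rewrite /Zlim (cvg_limn_einf_sup H).2.
exists (ereal_sup [set x | \forall n \near \oo, (x <= Z n u)%E]).
apply: cvge_sandwich => [x /ereal_sup_gt[y Hy xy]|y Hy].
  by apply: filterS Hy => n; apply: le_trans; exact: ltW.
set l := ereal_sup _ in Hy.
have [ay|ya] := ltP a y.
  near=> n; have n0 : (0 < n)%N by near: n; exact: nbhs_infty_gt.
  by apply: le_trans (Z_lower n0 Du) _; rewrite lee_fin ltW.
have [m [lm my]] : exists m : R, (l <= m%:E)%E /\ m < y.
  case: l Hy => [r| |] // Hy; first by exists r; split.
  by exists (y - 1); split; [exact: leNye|rewrite ltrBlDr ltrDl].
have [q /andP[mq qy]] := rat_in_itvoo my.
rewrite !bnd_simp in mq qy.
have [p /andP[mp pq]] := rat_in_itvoo mq.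
rewrite !bnd_simp in mp pq.
have qa : ratr q <= a by apply: ltW; apply: lt_le_trans qy ya.
have cL := @L_cvg (p, q) pq qa.
have idx n : (0 < n)%N -> exists j, [/\ (j < n)%N, Z n u = nth -oo%E (qs n) j,
    j%:R <= u * n%:R & u * n%:R < j.+1%:R].
  move=> n0; have [j jn Iu] := D_cover n0 Du; exists j; split => //.
  - exact: ZE.
  - by move: Iu; rewrite /I /= in_itv /= ler_pdivrMr ?ltr0n // => /andP[].
  - by move: Iu; rewrite /I /= in_itv /= ltr_pdivlMr ?ltr0n // => /andP[].
have [Lu|uL|Lu] := ltgtP (L (p, q)) u; last by case: Cu; exists (p, q).
- exfalso.
  have Hp : \forall n \near \oo, ((ratr p)%:E <= Z n u)%E.
    near=> n; have n0 : (0 < n)%N by near: n; exact: nbhs_infty_gt.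
    have nR : 0 < n%:R :> R by rewrite ltr0n.
    have [j [jn -> ju uj]] := idx n n0.
    rewrite leNgt; apply/negP => /ltW jp.
    have : avg (qs n) (ramp a T (ratr p) (ratr q)) < u.
      by near: n; exact: (cvgr_lt _ cL).
    apply/negP; rewrite -leNgt -(ler_pM2l nR) mulrC.
    have := avg_ramp_ge T1 pq qa (@sorted_qs n) _ jp; rewrite size_qs => /(_ jn).
    by apply: le_trans; exact: ltW.
  have : ((ratr p)%:E <= l)%E by apply: ereal_sup_ubound.
  by rewrite leNgt => /negP; apply; apply: le_lt_trans lm _; rewrite lte_fin.
- near=> n; have n0 : (0 < n)%N by near: n; exact: nbhs_infty_gt.
  have nR : 0 < n%:R :> R by rewrite ltr0n.
  have [j [jn -> ju uj]] := idx n n0.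
  rewrite leNgt; apply/negP => yj.
  have qj : ((ratr q)%:E <= nth -oo%E (qs n) j)%E.
    by apply: le_trans (ltW yj); rewrite lee_fin ltW.
  have : u < avg (qs n) (ramp a T (ratr p) (ratr q)).
    by near: n; exact: (cvgr_gt _ cL).
  apply/negP; rewrite -leNgt -(ler_pM2l nR) [leRHS]mulrC.
  have := avg_ramp_le T1 pq qa (@sorted_qs n) (@qs_le n) _ qj; rewrite size_qs => /(_ jn).
  by move=> /le_trans; apply.
Unshelve. all: by end_near. Qed.

Let measurable_Z n : measurable_fun setT (Z n).
Proof.
rewrite /Z; apply: emeasurable_sum => i; apply: measurable_funeM.
apply/measurable_EFinP; apply: measurable_indic; exact: measurable_itv.
Qed.

Let measurable_Zlim : measurable_fun setT Zlim.
Proof. exact: measurable_fun_limn_esup. Qed.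

Let Zrv : {mfun measurableTypeR R >-> \bar R} :=
  HB.pack_for {mfun measurableTypeR R >-> \bar R} Zlim
    (isMeasurableFun.Build _ _ (measurableTypeR R) (\bar R) Zlim measurable_Zlim).

Let mu : probability (\bar R) R := distribution (@uniform01 R) Zrv.

Let Zlim_lower u : D u -> ~ C u -> lower_ray a (Zlim u).
Proof.
move=> Du Cu; apply: (cvge_to_le (Z_cvg Du Cu)).
near=> n; apply: Z_lower => //; near: n; exact: nbhs_infty_gt.
Unshelve. all: by end_near. Qed.

Let aeDC (Q : R -> Prop) : (forall u, D u -> ~ C u -> Q u) ->
  {ae @uniform01 R, forall u, Q u}.
Proof.
move=> DCQ; suff : (@uniform01 R).-negligible (~` D `|` C).
  apply: negligibleS => u /= nQ; have [Du|nD] := pselect (D u); last by left.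
  by right; apply: contrapT => Cu; apply: nQ; exact: DCQ.
apply: negligibleU; apply/negligibleP.
- by apply: measurableC; exact: measurable_itv.
- have mD : measurable (D : set (measurableTypeR R)) by exact: measurable_itv.
  apply: (etrans (@probability_setC _ _ R (@uniform01 R) D mD)).
  have h : @uniform01 R D = (1 - 0)%:E by apply: uniform01_itv.
  by rewrite h subr0 subee.
- by apply: countable_measurable C_countable => t; exact: measurable_set1.
- exact: uniform01_countable.
Qed.

Let mu_lower : mu (lower_ray a) = 1%E.
Proof.
have mS := measurable_lower_ray a.
have mZ : measurable (Zlim @^-1` lower_ray a) by rewrite -[X in measurable X]setTI; exact: measurable_Zlim.
have mZ' : measurable (~` (Zlim @^-1` lower_ray a)) by exact: measurableC.
have E := @probability_setC _ _ R (@uniform01 R) _ mZ'; rewrite setCK in E.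
apply: (etrans E).
suff -> : @uniform01 R (~` (Zlim @^-1` lower_ray a)) = 0%E by rewrite sube0.
by apply/negligibleP; [exact: mZ'|apply: aeDC; exact: Zlim_lower].
Qed.

Section Test.
Variable f : \bar R -> R.
Hypothesis cf : {within lower_ray a, continuous f}.

Let g := f \_ (lower_ray a).

Let gE z : lower_ray a z -> g z = f z.
Proof. by move=> az; rewrite /g patchE mem_set. Qed.

Let measurable_g : measurable_fun setT g.
Proof.
apply/(measurable_restrictT _ (measurable_lower_ray a)).
exact: within_lower_ray_measurable.
Qed.

Let g_bounded : exists2 M, 0 < M & forall z, `|g z| <= M.
Proof.
have [M M0 HM] := within_lower_ray_bounded cf; exists M => // z.
rewrite /g patchE; case: ifPn => [|_]; last by rewrite normr0 ltW.
by rewrite inE; exact: HM.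
Qed.

Let integrable_g (X : R -> \bar R) : measurable_fun setT X ->
  (@uniform01 R).-integrable setT (EFin \o (g \o X)).
Proof.
move=> mX; have [M M0 HM] := g_bounded.
apply: measurable_bounded_integrable => //.
- exact: le_lt_trans (probability_le1 (@uniform01 R) measurableT) (ltry _).
- exact: measurableT_comp.
- by exists M; split; [exact: num_real|move=> x Mx u _ /=; apply: le_trans (HM _) (ltW Mx)].
Qed.

Let integral_Z n : (0 < n)%N ->
  (\int[@uniform01 R]_u (g (Z n u))%:E = (avg (qs n) f)%:E)%E.
Proof.
move=> n0; have nR : 0 < n%:R :> R by rewrite ltr0n.
have mI i : measurable (I n i) by exact: measurable_itv.
have int_i (i : 'I_n) : (@uniform01 R).-integrable setT
    (fun u => ((f (nth -oo%E (qs n) i))%:E * (\1_(I n i) u)%:E)%E).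
  apply: integrableZl => //; exact: (@integrable_indic _ _ R (@uniform01 R) _ (mI i)).
transitivity (\int[@uniform01 R]_u
   (\sum_(i < n) ((f (nth -oo%E (qs n) i))%:E * (\1_(I n i) u)%:E))%E)%E.
  apply: ae_eq_integral => //.
  - by apply/measurable_EFinP; exact: (measurableT_comp measurable_g (@measurable_Z n)).
  - by apply: emeasurable_sum => i; exact: measurable_int (int_i i).
  - apply: aeDC => u Du _ _; have [j jn Iu] := D_cover n0 Du.
    rewrite (gE (Z_lower n0 Du)) (ZE jn Iu) (bigD1 (Ordinal jn)) //= indicE mem_set // mule1.
    rewrite big1 ?adde0 // => i ij; rewrite indicE memNset ?mule0 // => Iiu.
    by case/eqP: ij; apply: val_inj => /=; apply: I_disjoint Iiu Iu.
rewrite integral_sum //.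
rewrite /avg size_qs (big_nth -oo%E) big_mkord size_qs mulr_sumr -sumEFin.
apply: eq_bigr => i _; rewrite integralZl //; last exact: (@integrable_indic _ _ R (@uniform01 R) _ (mI i)).
rewrite integral_indic //; last exact: (mI i).
transitivity ((f (nth -oo%E (qs n) i))%:E * (i.+1%:R / n%:R - i%:R / n%:R)%:E)%E.
  congr (_ * _)%E; apply: (etrans (congr1 (@uniform01 R) (setIT (I n i)))).
  apply: uniform01_itv.
  - by rewrite divr_ge0.
  - by rewrite ler_pM2r ?invr_gt0 // ler_nat.
  - by rewrite ler_pdivrMr // mul1r ler_nat.
by rewrite -EFinM -mulrBl -natrB // subSnn mul1r mulrC.
Qed.

Lemma avg_cvg_integral :
  avg (zs n) f @[n --> \oo] --> \int[mu]_(z in lower_ray a) f z.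
Proof.
have [M M0 HM] := g_bounded.
have -> : \int[mu]_(z in lower_ray a) f z = fine (\int[@uniform01 R]_u (g (Zlim u))%:E).
  rewrite Rintegral_mkcond /Rintegral -/g; congr fine.
  rewrite /mu integral_distribution //; first exact/measurable_EFinP.
  exact: integrable_g.
have := @dominated_convergence _ _ R (@uniform01 R) setT measurableT
  (fun n u => (g (Z n u))%:E) (fun u => (g (Zlim u))%:E) (fun=> M%:E).
case.
- by move=> n; apply/measurable_EFinP; exact: (measurableT_comp measurable_g (@measurable_Z n)).
- by apply/measurable_EFinP; exact: (measurableT_comp measurable_g measurable_Zlim).
- apply: aeDC => u Du Cu _; have Zl := Zlim_lower Du Cu.
  apply: cvg_EFin; first by near=> n.
  rewrite /comp /= (gE Zl).
  have Hn : \forall n \near \oo, lower_ray a (Z n u).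
    by near=> n; apply: Z_lower => //; near: n; exact: nbhs_infty_gt.
  apply: cvg_trans (within_lower_ray_cvg cf Zl Hn (Z_cvg Du Cu)); apply: near_eq_cvg.
  by apply: filterS Hn => n /gE ->.
- exact: finite_measure_integrable_cst.
- by apply: aeDC => u _ _ n _; rewrite lee_fin; exact: HM.
move=> ig _ H.
have fin : (\int[@uniform01 R]_u (g (Zlim u))%:E)%E \is a fin_num.
  by apply: integrable_fin_num.
have {}H : (\int[@uniform01 R]_u (g (Z n u))%:E)%E @[n --> \oo] -->
    (fine (\int[@uniform01 R]_u (g (Zlim u))%:E))%:E by rewrite fineK.
apply: cvg_trans (fine_cvg H); apply: near_eq_cvg.
have := avg_qs f; apply: filterS2 (nbhs_infty_gt 0) => n n0 <-.
by rewrite /= integral_Z.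
Unshelve. all: by end_near. Qed.

End Test.

Theorem quantile_limit : exists mu : probability (\bar R) R,
  mu (lower_ray a) = 1%E /\
  forall f : \bar R -> R, {within lower_ray a, continuous f} ->
    avg (zs n) f @[n --> \oo] --> \int[mu]_(z in lower_ray a) f z.
Proof. by exists mu; split; [exact: mu_lower|move=> f; exact: avg_cvg_integral]. Qed.

End QuantileLimit.

(** * Cauchy transforms of measures on the extended half-line *)

Section CauchyMeasure.
Context {R : realType}.
Variables (a : R) (mu : probability (\bar R) R).
Hypothesis muS : mu (lower_ray a) = 1%E.

Definition cauchy_int (t : R) : R := \int[mu]_(z in lower_ray a) kern a t z.
Definition logpot_int (t : R) : R :=
  \int[mu]_(z in lower_ray a) logpot t (kern a 1 z).

Let mS : measurable (lower_ray a). Proof. exact: measurable_lower_ray. Qed.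

Let muS_fin : (mu (lower_ray a) < +oo)%E. Proof. by rewrite muS ltry. Qed.

Let mN : measurable ([set -oo%E] : set (\bar R)). Proof. exact: emeasurable_set1. Qed.

Lemma logpot_kern_continuous (t : R) : 0 < t ->
  {within lower_ray a, continuous (logpot t \o kern a 1)}.
Proof.
move=> t0; apply: within_lower_ray_comp; first exact: kern_continuous.
move=> z az; have y01 := kern01 a z (lexx (1 : R)).
rewrite /logpot; apply: (@continuous_comp _ _ _ (fun y : R => 1 - y + t * y) (@ln R)).
  apply: cvgD; last by apply: cvgMl_tmp; exact: cvg_id.
  by apply: cvgB; [exact: cvg_cst|exact: cvg_id].
by apply: continuous_ln; exact: logpot_arg_gt0.
Qed.

Lemma mu_off_Ny :
  (\int[mu]_(z in lower_ray a) (\1_(~` [set -oo%E]) z)%:E = 1 - mu [set -oo%E])%E.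
Proof.
rewrite integral_indic //; last exact: measurableC.
have E : mu (lower_ray a) = (mu (lower_ray a `\` [set -oo]) + mu (lower_ray a `&` [set -oo]))%E.
  exact: measureDI.
have SN : lower_ray a `&` [set -oo%E] = [set -oo%E].
  by apply/seteqP; split => [z [_ //]|z ->]; split => //; rewrite /lower_ray /= leNye.
rewrite SN muS in E; rewrite E setIC -setDE addeK //.
by rewrite ge0_fin_numE // (le_lt_trans (probability_le1 mu mN)) // ltry.
Qed.

Let kern_int (t : R) : 0 < t -> mu.-integrable (lower_ray a) (EFin \o kern a t).
Proof. by move=> t0; apply: within_lower_ray_integrable => //; exact: kern_continuous. Qed.

Let kern_le (t : R) z : 0 < t -> lower_ray a z ->
  t * kern a t z <= \1_(~` [set -oo%E]) z.
Proof.
move=> t0 /lower_rayP[->|[r -> ra]]; first by rewrite /= mulr0 indicE.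
rewrite indicE mem_set // kern_fin //=; have d : 0 < a + t - r by lra.
by rewrite ler_pdivrMr //; lra.
Qed.

Let kern_ge0 (t : R) z : 0 < t -> 0 <= kern a t z.
Proof.
move=> t0; rewrite /kern; case: z => // r; case: ifP => // ra.
by rewrite invr_ge0; lra.
Qed.

Lemma mul_cauchy_int_le (t : R) : 0 < t -> t * cauchy_int t <= 1 - fine (mu [set -oo%E]).
Proof.
move=> t0; rewrite /cauchy_int -RintegralZl //; last exact: kern_int.
have -> : 1 - fine (mu [set -oo%E]) =
   \int[mu]_(z in lower_ray a) (\1_(~` [set -oo%E]) z : R).
  by rewrite /Rintegral mu_off_Ny fineB // ge0_fin_numE //
    (le_lt_trans (probability_le1 mu mN)) // ltry.
apply: le_Rintegral => //.
- have := integrableZl (mS) t (kern_int t0); apply: eq_integrable => //.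
- apply: measurable_bounded_integrable => //.
    by apply: measurable_indic; exact: measurableC.
  exists 1; split; first exact: num_real.
  by move=> x x1 z _ /=; rewrite indicE; case: (_ \in _); rewrite ?normr1 ?normr0; lra.
- by move=> z az; exact: kern_le.
Qed.

(** The Cauchy transform sees the mass at minus infinity: t / (a + t - z) tends
    boundedly to 1 for real z and is 0 at minus infinity. *)
Lemma mul_cauchy_int_cvg :
  n.+1%:R * cauchy_int n.+1%:R @[n --> \oo] --> 1 - fine (mu [set -oo%E]).
Proof.
have fN : mu [set -oo%E] \is a fin_num.
  by rewrite ge0_fin_numE // (le_lt_trans (probability_le1 mu mN)) // ltry.
have H := @dominated_convergence _ _ R mu (lower_ray a) mS
  (fun n z => (n.+1%:R * kern a n.+1%:R z)%:E)
  (fun z => (\1_(~` [set -oo%E]) z)%:E) (fun=> 1%E).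
have n0 n : 0 < n.+1%:R :> R by [].
have mk n : measurable_fun (lower_ray a) (fun z => (n.+1%:R * kern a n.+1%:R z)%:E).
  apply/measurable_EFinP; apply: measurable_funM => //.
  by apply: within_lower_ray_measurable; exact: kern_continuous.
case: (H mk) => {H} [||||_ _ H].
- by apply/measurable_EFinP; apply: measurable_indic; exact: measurableC.
- apply: aeW => z /lower_rayP[->|[r -> ra]].
    rewrite indicE memNset /=; last by apply.
    by under eq_fun do rewrite mulr0; exact: cvg_cst.
  rewrite indicE mem_set //; apply: cvg_EFin; first by near=> n.
  rewrite /comp /=.
  have H : ((a - r) * harmonic n + 1)^-1 @[n --> \oo] --> (0 + 1 : R)^-1.
    apply: cvgV; first by rewrite add0r oner_eq0.
    apply: cvgD; last exact: cvg_cst.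
    by rewrite -(mulr0 (a - r)); apply: cvgMl_tmp; exact: cvg_harmonic.
  rewrite add0r invr1 in H; apply: cvg_trans H; apply: near_eq_cvg; near=> n.
  have d1 : 0 < n.+1%:R :> R by [].
  have d2 : 0 < a + n.+1%:R - r by lra.
  have E : ((a - r) * harmonic n + 1)^-1 = n.+1%:R * kern a n.+1%:R r%:E.
    rewrite kern_fin // /harmonic /=.
    have -> : (a - r) / n.+1%:R + 1 = (a + n.+1%:R - r) / n.+1%:R.
      by field; rewrite gt_eqF.
    by rewrite invf_div.
  exact: E.
- apply: finite_measure_integrable_cst => //.
- have Q (z : \bar R) n : lower_ray a z -> (`|(n.+1%:R * kern a n.+1%:R z)%:E| <= 1%E)%E.
    move=> az; rewrite lee_fin ger0_norm ?mulr_ge0 ?kern_ge0 //.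
    by apply: le_trans (kern_le (n0 n) az) _; rewrite indicE; case: (_ \in _).
  by exact: (@aeW _ _ _ mu _ (fun z n => Q z n)).
rewrite mu_off_Ny in H.
have {}H : (\int[mu]_(z in lower_ray a) (n.+1%:R * kern a n.+1%:R z)%:E)%E @[n --> \oo]
   --> (1 - fine (mu [set -oo%E]))%:E by rewrite EFinB fineK.
apply: cvg_trans (fine_cvg H); apply: near_eq_cvg; near=> n.
by rewrite /= -/(Rintegral _ _ _) /cauchy_int RintegralZl //; exact: kern_int.
Unshelve. all: by end_near. Qed.

Section Limit.
Variable zs : nat -> seq (\bar R).
Hypothesis zsP : \forall n \near \oo,
  size (zs n) = n /\ {in zs n, forall z, lower_ray a z}.
Hypothesis zs_cvg : forall f : \bar R -> R, {within lower_ray a, continuous f} ->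
  avg (zs n) f @[n --> \oo] --> \int[mu]_(z in lower_ray a) f z.

Lemma avg_cauchyk_cvg (t : R) : 0 < t ->
  avg (map (kern a 1) (zs n)) (cauchyk t) @[n --> \oo] --> cauchy_int t.
Proof.
move=> t0; have H : avg (zs n) (kern a t) @[n --> \oo] --> cauchy_int t.
  by apply: zs_cvg; exact: kern_continuous.
apply: cvg_trans H; apply: near_eq_cvg.
apply: filterS zsP => n [_ za]; rewrite avg_map; apply: eq_avg => z /za az.
by rewrite /= cauchyk_kern.
Qed.

Lemma avg_logpot_cvg (t : R) : 0 < t ->
  avg (map (kern a 1) (zs n)) (logpot t) @[n --> \oo] --> logpot_int t.
Proof.
move=> t0; have H : avg (zs n) (logpot t \o kern a 1) @[n --> \oo] --> logpot_int t.
  by apply: zs_cvg; exact: logpot_kern_continuous.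
by apply: cvg_trans H; apply: near_eq_cvg; near=> n; rewrite avg_map.
Unshelve. all: by end_near. Qed.

Lemma unit_seq_kern (s : seq (\bar R)) : unit_seq (map (kern a 1) s).
Proof. by move=> y /mapP[z _ ->]; exact: kern01. Qed.

(** The profile inequalities for mu are inherited from the finite averages that
    approximate it. *)
Lemma profile_measure : profile logpot_int cauchy_int.
Proof.
apply: (@profile_cvg _ (fun n => map (kern a 1) (zs n))).
- by move=> n; exact: unit_seq_kern.
- by apply: filterS zsP => n [sn _]; rewrite size_map.
- exact: avg_logpot_cvg.
- exact: avg_cauchyk_cvg.
Qed.

End Limit.

Section NoMass.
Hypothesis mu0 : mu [set -oo%E] = 0%E.

Let ae_mu (Q : \bar R -> Prop) : (forall r, r <= a -> Q r%:E) ->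
  {ae mu, forall z, Q z}.
Proof.
move=> HQ; suff : mu.-negligible (~` lower_ray a `|` [set -oo%E]).
  apply: negligibleS => z /= nQ; have [az|nz] := pselect (lower_ray a z); last by left.
  by right; case/lower_rayP: az nQ => [//|[r -> /HQ]].
apply: negligibleU; apply/negligibleP => //; first exact: measurableC.
have := @probability_setC _ _ R mu _ mS; rewrite muS subee //.
Qed.

Lemma finite_part_lower : finite_part mu `]-oo, a]%classic = 1%E.
Proof.
rewrite /finite_part /distribution /= /pushforward.
have mA : measurable ((fine : \bar R -> R) @^-1` `]-oo, a]%classic).
  rewrite -[X in measurable X]setTI; apply: fine_measurable => //.
have E := @probability_setC _ _ R mu _ (measurableC mA); rewrite setCK in E.
apply: (etrans E); suff -> : mu (~` ((fine : \bar R -> R) @^-1` `]-oo, a]%classic)) = 0%E by rewrite sube0.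
apply/negligibleP; first exact: measurableC.
by apply: ae_mu => r ra /=; rewrite in_itv.
Qed.

Let kernE : (kern a : R -> _) = (fun t => kern a t \_ (lower_ray a)).
Proof.
apply/funext => t; apply/funext => z; rewrite patchE; case: ifPn => // nz.
rewrite /kern; case: z nz => // r; rewrite notin_setE /lower_ray /= lee_fin => /negP/negbTE ->.
by [].
Qed.

Let measurable_kern (t : R) : 0 < t -> measurable_fun setT (kern a t).
Proof.
move=> t0; rewrite kernE; apply/(measurable_restrictT _ mS).
by apply: within_lower_ray_measurable; exact: kern_continuous.
Qed.

Let kern_bound (t : R) z : 0 < t -> `|kern a t z| <= t^-1.
Proof.
move=> t0; rewrite ger0_norm ?kern_ge0 // /kern; case: z => [r| |]; rewrite ?invr_ge0 ?(ltW t0) //.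
case: ifP => ra; last by rewrite invr_ge0 ltW.
by rewrite lef_pV2 ?posrE; lra.
Qed.

Let measurable_inv_sub (x : R) : measurable_fun setT (fun z : R => (x - z)^-1).
Proof.
have -> : [set: R] = `]-oo, x[%classic `|` ([set x] `|` `]x, +oo[%classic).
  apply/seteqP; split => // z _ /=; rewrite !in_itv /= andbT.
  by case: (ltgtP z x) => [||->]; [left|right; right|right; left].
have c z : z != x -> {for z, continuous (fun z : R => (x - z)^-1)}.
  move=> zx; apply: cvgV; first by rewrite subr_eq0 eq_sym.
  by apply: cvgB; [exact: cvg_cst|exact: cvg_id].
apply/measurable_funU => //; first exact: measurableU.
split.
  apply: open_continuous_measurable_fun; first exact: interval_open.
  by move=> z; rewrite inE /= in_itv /= => zx; apply: c; rewrite lt_eqF.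
apply/measurable_funU => //; split; first exact: measurable_fun_set1.
apply: open_continuous_measurable_fun; first exact: interval_open.
by move=> z; rewrite inE /= in_itv /= andbT => zx; apply: c; rewrite gt_eqF.
Qed.

(** Almost every point of the real line lies in ]-oo, a], where the two kernels
    agree; the bounded one can be integrated on either side of the
    push-forward. *)
Lemma cauchy_transformE (t : R) : 0 < t ->
  cauchy_transform (finite_part mu) (a + t) = cauchy_int t.
Proof.
move=> t0; rewrite /cauchy_transform /cauchy_int /Rintegral; congr fine.
have mh : measurable_fun setT (fun r : R => kern a t r%:E).
  exact: (measurableT_comp (measurable_kern t0)).
transitivity (\int[finite_part mu]_r (kern a t r%:E)%:E)%E.
  apply: ae_eq_integral => //.
  - by apply/measurable_EFinP; exact: measurable_inv_sub.
  - by apply/measurable_EFinP.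
  - have N : (finite_part mu).-negligible (~` `]-oo, a]%classic).
      apply/negligibleP; first by apply: measurableC; exact: measurable_itv.
      have mI : measurable (`]-oo, a]%classic : set R) by exact: measurable_itv.
      have := @probability_setC _ _ R (finite_part mu) _ mI.
      by rewrite finite_part_lower subee.
    apply: negligibleS N => r /= nE ra; apply: nE => _.
    have E : kern a t r%:E = (a + t - r)^-1 by apply: kern_fin; move: ra; rewrite /= in_itv.
    exact: (congr1 EFin (esym E)).
rewrite /finite_part integral_distribution; last 2 first.
- by apply/measurable_EFinP.
- apply: (@measurable_bounded_integrable _ _ R mu (fun z => kern a t (fine z)%:E)) => //.
  + exact: le_lt_trans (probability_le1 mu measurableT) (ltry _).
  + exact: (measurableT_comp mh (fine_measurable measurableT)).
  + exists t^-1; split; first exact: num_real.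
    by move=> x tx z _; exact: le_trans (kern_bound (fine z)%:E t0) (ltW tx).
transitivity (\int[mu]_z (kern a t z)%:E)%E.
  apply: ae_eq_integral => //.
  - by apply/measurable_EFinP; exact: (measurableT_comp mh (fine_measurable measurableT)).
  - by apply/measurable_EFinP; exact: measurable_kern.
  - by apply: ae_mu => r ra _.
rewrite [RHS]integral_mkcond; apply: eq_integral => z _.
rewrite {1}kernE /patch; by case: ifP.
Qed.

End NoMass.
End CauchyMeasure.

(** * Assembling the convergence theorem *)

Lemma R_transform_inverse (R : realType) (a : R) (mu : probability (\bar R) R)
  (U : R -> R) (s t : R) :
  mu (lower_ray a) = 1%E -> mu [set -oo%E] = 0%E ->
  profile U (cauchy_int a mu) -> (forall u : R, 0 < u -> 0 < cauchy_int a mu u) ->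
  0 < t -> cauchy_int a mu t = s ->
  R_transform a (finite_part mu) s = s * (a + t) - 1.
Proof.
move=> muS mu0 pr pos t0 Gt; rewrite /R_transform; congr (s * _ - 1).
have E u : a < u -> cauchy_transform (finite_part mu) u = cauchy_int a mu (u - a).
  by move=> au; rewrite -(cauchy_transformE muS mu0) ?subr_gt0 // addrC subrK.
have inj : {in `]a, +oo[%classic &, injective (cauchy_transform (finite_part mu))}.
  move=> x y; rewrite !inE /= !in_itv /= !andbT => ax ay.
  rewrite !E // => Exy; apply/eqP; rewrite eq_le !leNgt; apply/andP.
  split; apply/negP => xy.
    have := profile_decr pr pos (_ : 0 < y - a) (_ : y - a < x - a).
    by rewrite !subr_gt0 ltrD2r => /(_ ay xy); rewrite Exy ltxx.
  have := profile_decr pr pos (_ : 0 < x - a) (_ : x - a < y - a).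
  by rewrite !subr_gt0 ltrD2r => /(_ ax xy); rewrite Exy ltxx.
rewrite -{1}Gt -(cauchy_transformE muS mu0 t0) pinvKV //.
by rewrite inE /= in_itv /= andbT ltrDl.
Qed.

Lemma zero_list_weak_cvg (R : realType) (a : R) (P : nat -> {poly R})
    (mu : probability (\bar R) R) :
  (\forall n \near \oo, [/\ P n != 0, (size (P n) <= n.+1)%N & real_rooted_le a (P n)]) ->
  weak_cvg_on (lower_ray a) (fun n => empirical_zeros n (P n)) mu <->
  (forall f : \bar R -> R, {within lower_ray a, continuous f} ->
    avg (zero_list n (P n)) f @[n --> \oo] --> \int[mu]_(z in lower_ray a) f z).
Proof.
move=> HP; have E (f : \bar R -> R) : {within lower_ray a, continuous f} ->
    \forall n \near \oo, avg (zero_list n (P n)) f =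
      \int[empirical_zeros n (P n)]_(z in lower_ray a) f z.
  move=> cf; near=> n; rewrite Rintegral_empirical //; near: n.
  - exact: nbhs_infty_gt.
  - by apply: filterS HP => n [].
  - by apply: filterS HP => n [].
  - by apply: filterS HP => n [].
split=> H f cf; have {}H := H f cf; apply: cvg_trans H; apply: near_eq_cvg.
  by apply: filterS (E f cf) => n ->.
by apply: filterS (E f cf) => n ->.
Unshelve. all: by end_near. Qed.

(** Every finite zero contributes at most 1 and zeros at minus infinity
    contribute nothing, so the Cauchy transform bounds the degree from below. *)
Lemma avg_cauchyk_degree (R : realType) (a t : R) n (P : {poly R}) :
  0 < t -> P != 0 -> (size P <= n.+1)%N -> real_rooted_le a P ->
  n%:R * (t * avg (map (kern a 1) (zero_list n P)) (cauchyk t)) <= (size P).-1%:R.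
Proof.
move=> t0 P0 sP rP; have sz := size_zero_list P0 rP sP.
rewrite mulrCA -{1}sz -(size_map (kern a 1)) size_mul_avg big_map /zero_list big_cat /=.
rewrite [X in _ + X]big1_seq ?addr0; last first.
  by move=> z /andP[_ /nseqP[-> _]]; rewrite /cauchyk mul0r.
rewrite big_map mulr_sumr -(size_real_zeros P0 rP) -sum1_size natr_sum.
apply: ler_sum => r _; apply: cauchyk_le1 => //; exact: kern01.
Qed.

Lemma cauchy_mass_gt1 (R : realType) (a : R) (mu1 mu2 : probability (\bar R) R) :
  mu1 (lower_ray a) = 1%E -> mu2 (lower_ray a) = 1%E ->
  (mu1 [set -oo%E] + mu2 [set -oo%E] < 1)%E ->
  exists2 T : R, 0 < T & 1 < T * cauchy_int a mu1 T + T * cauchy_int a mu2 T.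
Proof.
move=> mu1S mu2S m12.
have mN : measurable ([set -oo%E] : set (\bar R)) by exact: emeasurable_set1.
have fin (mu : probability (\bar R) R) : mu [set -oo%E] \is a fin_num.
  by rewrite ge0_fin_numE // (le_lt_trans (probability_le1 mu mN)) // ltry.
have lt1 : 1 < (1 - fine (mu1 [set -oo%E])) + (1 - fine (mu2 [set -oo%E])).
  have : fine (mu1 [set -oo%E]) + fine (mu2 [set -oo%E]) < 1.
    by rewrite -lte_fin EFinD !fineK.
  lra.
have [N _ HN] := cvgr_gt _ (cvgD (mul_cauchy_int_cvg mu1S) (mul_cauchy_int_cvg mu2S)) _ lt1.
by exists N.+1%:R => //; exact: HN (leqnn N).
Qed.

Lemma finite_free_addZ (R : realType) n (c d : R) (P Q : {poly R}) :
  finite_free_add n (c *: P) (d *: Q) = (c * d) *: finite_free_add n P Q.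
Proof.
apply/polyP => k; rewrite [RHS]coefZ; have [nk|kn] := ltnP n k.
  have Z (S T : {poly R}) : (finite_free_add n S T)`_k = 0.
    by apply: nth_default; exact: leq_trans (size_finite_free_add _ _ _ _) nk.
  by rewrite !Z mulr0.
rewrite !coef_finite_free_add // mulrCA; congr (_ * _); rewrite mulr_sumr.
apply: eq_bigr => i _; rewrite mulr_sumr; apply: eq_bigr => j _.
by rewrite !coefZ; ring.
Qed.

Lemma finite_free_add_nonneg (R : realType) n (P Q : {poly R}) :
  nonneg_coef P -> nonneg_coef Q -> nonneg_coef (finite_free_add n P Q).
Proof.
move=> P0 Q0 k; have [nk|kn] := ltnP n k.
  by rewrite nth_default ?(leq_trans (size_finite_free_add _ _ _ _)).
rewrite coef_finite_free_add // mulr_ge0 ?invr_ge0 ?mulr_ge0 //.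
by apply: sumr_ge0 => i _; apply: sumr_ge0 => j _; rewrite !mulr_ge0.
Qed.

Lemma horner_nonneg_gt0 (R : realType) (p : {poly R}) (t : R) :
  p != 0 -> nonneg_coef p -> 0 < t -> 0 < p.[t].
Proof.
move=> p0 pn t0; have sp : (0 < size p)%N by rewrite size_poly_gt0.
rewrite horner_coef -(prednK sp) big_ord_recr /=.
apply: ltr_wpDl.
  by apply: sumr_ge0 => i _; rewrite mulr_ge0 // exprn_ge0 // ltW.
by rewrite mulr_gt0 ?exprn_gt0 // lt_def pn andbT lead_coef_eq0.
Qed.

(** Translated by a, both factors have coefficients of constant sign, hence so
    has their convolution, which therefore has no zero above 2 a; that all its
    zeros are real is conv_op_lower. *)
Lemma finite_free_add_roots (R : realType) n (A : R) (P Q : {poly R}) :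
  P != 0 -> Q != 0 -> (size P <= n.+1)%N -> (size Q <= n.+1)%N ->
  (n.+1 < size P + size Q)%N -> real_rooted_le A P -> real_rooted_le A Q ->
  [/\ finite_free_add n P Q != 0, real_rooted_le (2 * A) (finite_free_add n P Q) &
    exists2 c, 0 < c &
    finite_free_add n (pgf (map (kern A 1) (zero_list n P)))
                      (pgf (map (kern A 1) (zero_list n Q))) =
    c *: pgf (map (kern (2 * A) 1) (zero_list n (finite_free_add n P Q)))].
Proof.
move=> P0 Q0 sP sQ sPQ rP rQ.
have F0 := finite_free_add_neq0 _ _ _ _ _ _ sP sQ sPQ rP rQ.
have [c1 c10 E1] := comp_shift_pgf n P0 rP.
have [c2 c20 E2] := comp_shift_pgf n Q0 rQ.
set q := finite_free_add n (pgf _) (pgf _).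
have Eq : finite_free_add n P Q \Po ('X + (2 * A)%:P) = (c1 * c2) *: q.
  by rewrite -finite_free_add_shift // E1 E2 finite_free_addZ.
have c120 : c1 * c2 != 0 by rewrite mulf_neq0.
have qn : nonneg_coef q.
  by apply: finite_free_add_nonneg; apply: pgf_nonneg; exact: unit_seq_kern.
have q0 : q != 0.
  apply: contraNneq F0 => q0; rewrite -[X in X == 0](comp_polyXr).
  have -> : 'X = ('X + (2 * A)%:P) \Po ('X - (2 * A)%:P) :> {poly R}.
    by rewrite comp_polyD comp_polyX comp_polyC subrK.
  by rewrite comp_polyA Eq q0 scaler0 comp_poly0.
have rF : real_rooted_le (2 * A) (finite_free_add n P Q).
  move=> z Rz; have zi := finite_free_add_real_rooted _ _ _ _ _ _ _ sP sQ sPQ rP rQ Rz.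
  case: z zi Rz => x y /= -> Rz; exists x => //; rewrite leNgt; apply/negP => xA.
  have Fx : (finite_free_add n P Q).[x] = 0.
    apply/eqP; rewrite -(fmorph_eq0 (real_complex R)) /= -horner_map.
    exact: Rz.
  have : 0 < q.[x - 2 * A] by apply: horner_nonneg_gt0 => //; rewrite subr_gt0.
  have /(congr1 (fun p => p.[x - 2 * A])) := Eq.
  rewrite horner_comp hornerD hornerX hornerC [RHS]hornerZ subrK Fx => /eqP.
  by rewrite eq_sym mulf_eq0 (negPf c120) /= => /eqP ->; rewrite ltxx.
split => //; have [c3 c30 E3] := comp_shift_pgf n F0 rF.
exists (c3 / (c1 * c2)).
  have p1 : 0 < (pgf (map (kern (2 * A) 1) (zero_list n (finite_free_add n P Q)))).[1].
    by apply: horner_pgf_gt0 => //; exact: unit_seq_kern.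
  rewrite -(pmulr_lgt0 _ p1) -hornerZ mulrC -scalerA -E3 Eq scalerA mulVf // scale1r.
  exact: horner_nonneg_gt0.
by rewrite mulrC -scalerA -E3 Eq scalerA mulVf // scale1r.
Qed.

Unset Implicit Arguments.

Theorem theorem3p5 (R : realType) (A : R) (P1 P2 : nat -> {poly R})
    (mu1 mu2 : probability (\bar R) R)
    (P1_neq0 : forall n, (0 < n)%N -> P1 n != 0)
    (P2_neq0 : forall n, (0 < n)%N -> P2 n != 0)
    (P1_deg : forall n, (0 < n)%N -> (size (P1 n) <= n.+1)%N)
    (P2_deg : forall n, (0 < n)%N -> (size (P2 n) <= n.+1)%N)
    (P1_roots : forall n, (0 < n)%N -> real_rooted_le A (P1 n))
    (P2_roots : forall n, (0 < n)%N -> real_rooted_le A (P2 n))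
    (mu1_supp : mu1 (lower_ray A) = 1%E)
    (mu2_supp : mu2 (lower_ray A) = 1%E)
    (P1_cvg : weak_cvg_on (lower_ray A) (fun n => empirical_zeros n (P1 n)) mu1)
    (P2_cvg : weak_cvg_on (lower_ray A) (fun n => empirical_zeros n (P2 n)) mu2)
    (mass_lt1 : (mu1 [set -oo%E] + mu2 [set -oo%E] < 1)%E) :
  (\forall n \near \oo,
     finite_free_add n (P1 n) (P2 n) != 0 /\
     real_rooted_le (2 * A) (finite_free_add n (P1 n) (P2 n))) /\
  exists mu : probability (\bar R) R,
    [/\ mu (lower_ray (2 * A)) = 1%E,
        weak_cvg_on (lower_ray (2 * A))
          (fun n => empirical_zeros n (finite_free_add n (P1 n) (P2 n))) mu
      & mu1 [set -oo%E] = 0%E -> mu2 [set -oo%E] = 0%E ->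
        mu [set -oo%E] = 0%E /\
        is_free_add_conv A (finite_part mu1) (finite_part mu2)
          (finite_part mu)].
Proof.
have [T T0 TG] := cauchy_mass_gt1 mu1_supp mu2_supp mass_lt1.
have P1P : \forall n \near \oo,
    [/\ P1 n != 0, (size (P1 n) <= n.+1)%N & real_rooted_le A (P1 n)].
  by apply: filterS (nbhs_infty_gt 0) => n n0; split; auto.
have P2P : \forall n \near \oo,
    [/\ P2 n != 0, (size (P2 n) <= n.+1)%N & real_rooted_le A (P2 n)].
  by apply: filterS (nbhs_infty_gt 0) => n n0; split; auto.
have W1 := (zero_list_weak_cvg mu1 P1P).1 P1_cvg.
have W2 := (zero_list_weak_cvg mu2 P2P).1 P2_cvg.
have zlP a (P : nat -> {poly R}) : (\forall n \near \oo,
    [/\ P n != 0, (size (P n) <= n.+1)%N & real_rooted_le a (P n)]) ->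
  \forall n \near \oo, size (zero_list n (P n)) = n /\
     {in zero_list n (P n), forall z, lower_ray a z}.
  apply: filterS => n [p0 ps pr]; split; first exact: size_zero_list pr ps.
  exact: zero_list_lower_ray.
have Z1 := zlP A P1 P1P; have Z2 := zlP A P2 P2P.
have cG1 (t : R) (t0 : 0 < t) := avg_cauchyk_cvg Z1 W1 t0.
have cG2 (t : R) (t0 : 0 < t) := avg_cauchyk_cvg Z2 W2 t0.
have cU1 (t : R) (t0 : 0 < t) := avg_logpot_cvg W1 t0.
have cU2 (t : R) (t0 : 0 < t) := avg_logpot_cvg W2 t0.
have sP12 : \forall n \near \oo, (n.+1 < size (P1 n) + size (P2 n))%N.
  have H := cvgr_gt _ (cvgD (cvgMl_tmp (a := T) (cG1 T T0)) (cvgMl_tmp (a := T) (cG2 T T0))) _ TG.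
  near=> n; have n0 : (0 < n)%N by near: n; exact: nbhs_infty_gt.
  have [p0 ps pr] : [/\ P1 n != 0, (size (P1 n) <= n.+1)%N & real_rooted_le A (P1 n)] by near: n.
  have [q0 qs qr] : [/\ P2 n != 0, (size (P2 n) <= n.+1)%N & real_rooted_le A (P2 n)] by near: n.
  have gt1 : 1 < T * avg (map (kern A 1) (zero_list n (P1 n))) (cauchyk T) +
                 T * avg (map (kern A 1) (zero_list n (P2 n))) (cauchyk T) by near: n; exact: H.
  have h1 := avg_cauchyk_degree T0 p0 ps pr.
  have h2 := avg_cauchyk_degree T0 q0 qs qr.
  have nR : 0 < n%:R :> R by rewrite ltr0n.
  have : n%:R < ((size (P1 n)).-1 + (size (P2 n)).-1)%:R :> R.
    rewrite natrD; apply: lt_le_trans (lerD h1 h2).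
    by rewrite -mulrDr -[ltLHS]mulr1 ltr_pM2l.
  rewrite ltr_nat; have := size_poly_gt0 (P1 n); have := size_poly_gt0 (P2 n).
  rewrite p0 q0; move: (size (P1 n)) (size (P2 n)) => a b; lia.
pose Q n := finite_free_add n (P1 n) (P2 n).
have QP : \forall n \near \oo, [/\ Q n != 0, real_rooted_le (2 * A) (Q n) &
    exists2 c, 0 < c &
    finite_free_add n (pgf (map (kern A 1) (zero_list n (P1 n))))
                      (pgf (map (kern A 1) (zero_list n (P2 n)))) =
    c *: pgf (map (kern (2 * A) 1) (zero_list n (Q n)))].
  near=> n.
  have [p0 ps pr] : [/\ P1 n != 0, (size (P1 n) <= n.+1)%N & real_rooted_le A (P1 n)] by near: n.
  have [q0 qs qr] : [/\ P2 n != 0, (size (P2 n) <= n.+1)%N & real_rooted_le A (P2 n)] by near: n.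
  by apply: finite_free_add_roots => //; near: n.
have QP' : \forall n \near \oo,
    [/\ Q n != 0, (size (Q n) <= n.+1)%N & real_rooted_le (2 * A) (Q n)].
  by apply: filterS QP => n [q0 qr _]; split => //; exact: size_finite_free_add.
split; first by apply: filterS QP => n [q0 qr _].
have ZQ := zlP (2 * A) Q QP'.
pose ws n := map (kern (2 * A) 1) (zero_list n (Q n)).
(* Generating polynomials have value 1 at 1, so c n is forced. *)
pose c n := (finite_free_add n (pgf (map (kern A 1) (zero_list n (P1 n))))
                      (pgf (map (kern A 1) (zero_list n (P2 n))))).[1] / (pgf (ws n)).[1].
have uk a (P : nat -> {poly R}) n : unit_seq (map (kern a 1) (zero_list n (P n))).
  exact: unit_seq_kern.
have convE : \forall n \near \oo, [/\ size (ws n) = n, unit_seq (ws n), 0 < c n &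
    finite_free_add n (pgf (map (kern A 1) (zero_list n (P1 n))))
                      (pgf (map (kern A 1) (zero_list n (P2 n)))) =
    c n *: pgf (ws n)].
  apply: filterS2 QP ZQ => n [_ _ [d d0 E]] [sz _].
  have w1 : 0 < (pgf (ws n)).[1] by apply: horner_pgf_gt0 => //; exact: uk.
  have cd : c n = d by rewrite /c E hornerZ mulfK // gt_eqF.
  by split; rewrite ?size_map ?cd //; exact: uk.
have sz1 : \forall n \near \oo, size (map (kern A 1) (zero_list n (P1 n))) = n.
  by apply: filterS Z1 => n [sz _]; rewrite size_map.
have sz2 : \forall n \near \oo, size (map (kern A 1) (zero_list n (P2 n))) = n.
  by apply: filterS Z2 => n [sz _]; rewrite size_map.
have [s0 [t0 [tau [tau' /= [s00 tauP KP Konto]]]]] :=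
  cauchy_avg_conv (uk A P1) (uk A P2) sz1 sz2 convE cU1 cU2 cG1 cG2 T0 TG.
pose K s := tau s + tau' s - s^-1.
(* Enlarged to be at least 1, so that Cauchy kernels take values in [0, 1]. *)
pose T' := Num.max t0 1.
have T'1 : 1 <= T' by rewrite le_max lexx orbT.
have wsP : \forall n \near \oo, (0 < size (ws n))%N /\ unit_seq (ws n).
  apply: filterS2 (nbhs_infty_gt 0) convE => n n0 [sz us _ _].
  by split => //; rewrite sz.
have cws t : T' <= t -> avg_cvg ws (cauchyk t).
  move=> Tt; have [|s ss <-] := Konto t; first by apply: le_trans Tt; rewrite le_max lexx.
  by exists s; have [_] := KP s ss.
have kern_cvg x : 0 <= x <= 1 ->
    exists l : R, avg (zero_list n (Q n)) (fun z => `|kern (2 * A) T' z - x|) @[n --> \oo] --> l.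
  move=> x01; have [l Hl] := avg_cvg_dist wsP T'1 cws x01; exists l.
  apply: cvg_trans Hl; apply: near_eq_cvg; apply: filterS ZQ => n [_ za].
  rewrite /ws avg_map; apply: eq_avg => z /za az /=.
  by rewrite cauchyk_kern // (lt_le_trans ltr01).
have [mu [muS muW]] := quantile_limit T'1 ZQ kern_cvg.
exists mu; split => //; first exact/zero_list_weak_cvg.
move=> m1 m2.
have pr1 := profile_measure Z1 W1; have pr2 := profile_measure Z2 W2.
have pr := profile_measure ZQ muW.
have G1T : 0 < cauchy_int A mu1 T.
  by rewrite -(pmulr_rgt0 _ T0); have := profile_le1 pr2 T0; lra.
have G2T : 0 < cauchy_int A mu2 T.
  by rewrite -(pmulr_rgt0 _ T0); have := profile_le1 pr1 T0; lra.
have pos1 (t : R) : 0 < t -> 0 < cauchy_int A mu1 t by exact: (profile_gt0 pr1 T0 G1T).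
have pos2 (t : R) : 0 < t -> 0 < cauchy_int A mu2 t by exact: (profile_gt0 pr2 T0 G2T).
have GK s : 0 < s < s0 -> cauchy_int (2 * A) mu (K s) = s.
  move=> ss; have [K0 cK] := KP s ss.
  exact: (cvg_unique _ (avg_cauchyk_cvg ZQ muW K0) cK).
have ss0 : 0 < s0 / 2 < s0 by apply/andP; split; lra.
have pos (t : R) : 0 < t -> 0 < cauchy_int (2 * A) mu t.
  have [K0 _] := KP _ ss0; apply: (profile_gt0 pr K0).
  by rewrite (GK _ ss0); case/andP: ss0.
(* With t = K s, the bound t * cauchy_int t <= 1 - mu {-oo} has a left-hand
   side tending to 1 as s tends to 0. *)
have mu0 : mu [set -oo%E] = 0%E.
  have mN : measurable ([set -oo%E] : set (\bar R)) by exact: emeasurable_set1.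
  have fN : mu [set -oo%E] \is a fin_num.
    by rewrite ge0_fin_numE // (le_lt_trans (probability_le1 mu mN)) // ltry.
  rewrite -(fineK fN); congr (_%:E); apply/eqP; rewrite eq_le.
  apply/andP; split; last by rewrite fine_ge0.
  rewrite leNgt; apply/negP => e0; set e := fine _ in e0.
  have c1 := mul_cauchy_int_cvg mu1_supp; have c2 := mul_cauchy_int_cvg mu2_supp.
  rewrite m1 subr0 in c1; rewrite m2 subr0 in c2.
  have e1 : 1 - e / 2 < 1 by lra.
  have [n [g1 g2]] : exists n : nat, 1 - e / 2 < n.+1%:R * cauchy_int A mu1 n.+1%:R /\
       1 - e / 2 < n.+1%:R * cauchy_int A mu2 n.+1%:R.
    have [N _ HN] := cvgr_gt _ c1 _ e1; have [N' _ HN'] := cvgr_gt _ c2 _ e1.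
    by exists (maxn N N'); split; [apply: HN|apply: HN'];
      rewrite /= ?leq_maxl ?leq_maxr.
  have n0 : 0 < n.+1%:R :> R by [].
  pose s := Num.min (s0 / 2) (Num.min (cauchy_int A mu1 n.+1%:R) (cauchy_int A mu2 n.+1%:R) / 2).
  have s_1 : s <= s0 / 2 by rewrite ge_min lexx.
  have s_2 : s <= Num.min (cauchy_int A mu1 n.+1%:R) (cauchy_int A mu2 n.+1%:R) / 2.
    by rewrite ge_min lexx orbT.
  have mm : 0 < Num.min (cauchy_int A mu1 n.+1%:R) (cauchy_int A mu2 n.+1%:R).
    by rewrite lt_min pos1 ?pos2.
  have mm1 : Num.min (cauchy_int A mu1 n.+1%:R) (cauchy_int A mu2 n.+1%:R) <=
    cauchy_int A mu1 n.+1%:R by rewrite ge_min lexx.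
  have mm2 : Num.min (cauchy_int A mu1 n.+1%:R) (cauchy_int A mu2 n.+1%:R) <=
    cauchy_int A mu2 n.+1%:R by rewrite ge_min lexx orbT.
  have sp : 0 < s by rewrite lt_min !divr_gt0.
  have ss : 0 < s < s0 by apply/andP; split; lra.
  have [tp Gt tp' Gt'] := tauP s ss; have [K0 _] := KP s ss.
  have nt : n.+1%:R <= tau s.
    rewrite leNgt; apply/negP => /ltW /(profile_nonincr pr1 tp); rewrite Gt; lra.
  have nt' : n.+1%:R <= tau' s.
    rewrite leNgt; apply/negP => /ltW /(profile_nonincr pr2 tp'); rewrite Gt'; lra.
  have := profile_mul_nondecr pr1 n0 nt; have := profile_mul_nondecr pr2 n0 nt'.
  have := mul_cauchy_int_le muS K0; rewrite GK // Gt Gt'.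
  rewrite !mulrDl mulNr mulVf ?gt_eqF // -/e; lra.
split => //; split; first exact: finite_part_lower.
near=> s.
have ss : 0 < s < s0.
  by apply/andP; split; near: s; [exact: nbhs_right_gt|exact: nbhs_right_lt].
have [tp Gt tp' Gt'] := tauP s ss; have [K0 _] := KP s ss.
rewrite (R_transform_inverse muS mu0 pr pos K0 (GK s ss)).
rewrite (R_transform_inverse mu1_supp m1 pr1 pos1 tp Gt).
rewrite (R_transform_inverse mu2_supp m2 pr2 pos2 tp' Gt').
by field; case/andP: ss => sp _; rewrite gt_eqF.
Unshelve. all: by end_near. Qed.
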